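(* Let $f:\mathbb{R}\to\mathbb{R}$ and $\rho>0$ be as in the context, and assume that conditions (A1)', (A2)', (A3)' and (A4)' listed in the context hold. Then there exist $N+3$ disjoint simply connected subsets $A_0,A_1,\dots,A_{N+2}\subset\mathbb{R}^2$ such that $\mathrm{cl}(A_0\cup\cdots\cup A_{N+2})=\mathbb{R}^2$ and $$\lim_{t\to\infty}\Phi^t(x_0,q_0)=\begin{cases}(x_i^s,0)&\text{for }(x_0,q_0)\in A_i\quad(i=1,\dots,N+1),\\ \infty&\text{for }(x_0,q_0)\in A_0\cup A_{N+2}.\end{cases}$$
   Context: Setting. $f:\mathbb{R}\to\mathbb{R}$ is a smooth map such that $\dot x=f(x)$ has more than two stable fixed points. The sets of stable and unstable fixed points are denoted $FP^s=\{x_1^s,\dots,x_{N+1}^s\}$ and $FP^u=\{x_1^u,\dots,x_N^u\}$. For a constant $\rho>0$ consider the two-dimensional system $$\dot x=f(x)+q,\qquad \dot q=-(\rho+f'(x))q,$$ and let $\Phi^t(x_0,q_0)$ denote its solution starting at $(x_0,q_0)$. Let $D_\rho:=\{x\in\mathbb{R} : \rho+f'(x)>0\}$; $\mathrm{cl}$ denotes closure, and $\lim=\infty$ means that the orbit diverges. Conditions. (A1)' $FP^s\subset D_\rho$ and $FP^u\subset D_\rho$. (A2)' $\#\{x\in\mathbb{R} : \rho+f'(x)=0\}=2$. (A3)' $f(x)f''(x)>0$ in $\mathbb{R}\setminus D_\rho$. (A4)' $f'(x)\to-\infty$ as $|x|\to\infty$. *)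

(* Defs.v *)
From HB Require Import structures.
From mathcomp Require Import all_boot all_order all_algebra.
From mathcomp Require Import all_classical all_reals all_analysis.
Set Implicit Arguments.
Unset Strict Implicit.
Unset Printing Implicit Defensive.
Import Order.TTheory GRing.Theory Num.Theory.
Import numFieldNormedType.Exports.
Local Open Scope ring_scope.
Local Open Scope classical_set_scope.

Definition smooth (R : realType) (f : R -> R) : Prop :=
  forall (n : nat) (x : R), derivable (derive1n n f) x 1.

(* phi solves phi' = F(phi) on [0, T[, where T may be +oo.  At 0 only right
   continuity is required; by the mean value theorem the right derivative of
   phi at 0 is then F (phi 0) when F is continuous.  The values of phi outside
   [0, T[ are irrelevant. *)
Definition is_solution (R : realType) (V : normedModType R) (F : V -> V)
    (T : \bar R) (phi : R -> V) : Prop :=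
  [/\ (0 < T)%E,
      phi t @[t --> 0^'+] --> phi 0 &
      forall t : R, 0 < t -> (t%:E < T)%E -> is_derive t 1 phi (F (phi t))].

Definition is_maximal_solution (R : realType) (V : normedModType R)
    (F : V -> V) (z : V) (T : \bar R) (phi : R -> V) : Prop :=
  [/\ is_solution F T phi,
      phi 0 = z &
      forall (T' : \bar R) (psi : R -> V),
        is_solution F T' psi -> psi 0 = z -> (T' <= T)%E].

(* A maximal forward solution from z together with its existence time.  When F
   is locally Lipschitz one exists and is unique on [0, T[.  The default has
   existence time 0, so that neither flow_tends_to nor flow_diverges below can
   hold at a point without a maximal solution. *)
Definition maximal_solution (R : realType) (V : normedModType R)
    (F : V -> V) (z : V) : \bar R * (R -> V) :=
  xget (0%E, cst z)
    [set p : \bar R * (R -> V) | is_maximal_solution F z p.1 p.2].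

Definition existence_time (R : realType) (V : normedModType R)
    (F : V -> V) (z : V) : \bar R := (maximal_solution F z).1.

Definition flow (R : realType) (V : normedModType R)
    (F : V -> V) (t : R) (z : V) : V := (maximal_solution F z).2 t.

Definition flow_tends_to (R : realType) (V : normedModType R)
    (F : V -> V) (z l : V) : Prop :=
  existence_time F z = +oo%E /\ flow F t z @[t --> +oo] --> l.

(* Divergence of the orbit: its norm tends to infinity as t tends to the
   existence time, which may be finite (blow-up): for instance, if
   f(x) = - x ^ 3 near infinity then the diverging orbits of the planar system
   reach infinity in finite time. *)
Definition flow_diverges (R : realType) (V : normedModType R)
    (F : V -> V) (z : V) : Prop :=
  forall M : R, exists t0 : R,
    [/\ 0 <= t0, (t0%:E < existence_time F z)%E &
        forall t : R, t0 <= t -> (t%:E < existence_time F z)%E ->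
          M <= `|flow F t z|].

(* Stability in the sense of Lyapunov. *)
Definition lyapunov_stable (R : realType) (V : normedModType R)
    (F : V -> V) (x : V) : Prop :=
  forall eps : R, 0 < eps -> exists2 delta : R, 0 < delta &
    forall (T : \bar R) (phi : R -> V), is_solution F T phi ->
      `|phi 0 - x| < delta ->
      forall t : R, 0 <= t -> (t%:E < T)%E -> `|phi t - x| < eps.

Definition stable_fixed_points (R : realType) (f : R -> R) : set R :=
  [set x | f x = 0 /\ lyapunov_stable f x].

Definition unstable_fixed_points (R : realType) (f : R -> R) : set R :=
  [set x | f x = 0 /\ ~ lyapunov_stable f x].

Definition planar_field (R : realType) (f : R -> R) (rho : R)
    (z : R * R) : R * R :=
  (f z.1 + z.2, - (rho + derive1 f z.1) * z.2).

Definition D_set (R : realType) (f : R -> R) (rho : R) : set R :=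
  [set x | 0 < rho + derive1 f x].

Definition path_connected (R : realType) (T : topologicalType)
    (A : set T) : Prop :=
  forall a b : T, A a -> A b -> exists g : R -> T,
    [/\ {within `[0, 1]%classic, continuous g}, g 0 = a, g 1 = b &
        forall t : R, 0 <= t <= 1 -> A (g t)].

(* H (s, t) is the position at time t of the s-th loop; the homotopy fixes the
   base point g 0 = g 1. *)
Definition null_homotopic_in (R : realType) (T : topologicalType)
    (A : set T) (g : R -> T) : Prop :=
  exists H : R * R -> T,
    [/\ {within `[0, 1]%classic `*` `[0, 1]%classic, continuous H},
        forall s t : R, 0 <= s <= 1 -> 0 <= t <= 1 -> A (H (s, t)),
        forall t : R, 0 <= t <= 1 -> H (0, t) = g t,
        forall t : R, 0 <= t <= 1 -> H (1, t) = g 0 &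
        forall s : R, 0 <= s <= 1 -> H (s, 0) = g 0 /\ H (s, 1) = g 0].

(* The empty set is not considered simply connected. *)
Definition simply_connected (R : realType) (T : topologicalType)
    (A : set T) : Prop :=
  [/\ A !=set0,
      path_connected R A &
      forall g : R -> T,
        {within `[0, 1]%classic, continuous g} -> g 0 = g 1 ->
        (forall t : R, 0 <= t <= 1 -> A (g t)) -> null_homotopic_in A g].

(* Main.v *)
Require Import Defs.
From HB Require Import structures.
From mathcomp Require Import all_boot all_order all_algebra.
From mathcomp Require Import all_classical all_reals all_analysis.
From mathcomp Require Import lra ring.
Import Order.TTheory GRing.Theory Num.Theory.
Import numFieldNormedType.Exports.
Set Implicit Arguments.
Unset Strict Implicit.
Local Open Scope ring_scope.
Local Open Scope classical_set_scope.

(** In the momentum coordinate [p = f x + q] the system is the damped Newton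
    equation [x' = p], [p' = - rho p + g x] with [g = (rho + f') f], whose energy
    [p^2 / 2 + V x], [V' = - g], is dissipated. By counting, every unstable fixed
    point is repelling from both sides, so that [g] goes from negative to positive
    ("hump" of [V]) at the two zeros [a < b] of [rho + f'] and at the unstable
    fixed points, and from positive to negative (well of [V]) at the stable ones.
    The sets [A_k] are the points whose orbit enters one of the forward invariant
    open star-shaped sets [{x < a, p < 0}], [{x > b, p > 0}] or a sublevel set of
    the energy around a stable fixed point; flowing a loop into such a set and
    contracting it there shows that [A_k] is simply connected. An orbit entering
    none of them is bounded, hence converges to a hump. Two orbits which stay near
    a hump approach it like [exp (- rho t)], whereas their distance, if initially
    horizontal, decays at most like [exp (- rho t / 4)]; so the points staying near
    a hump after a given time form a closed set with empty interior, and Baire's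
    theorem gives the density. Orbits may explode in finite time, so all this is
    done for the complete flows in which [g] is frozen outside [[- K, K]]. *)

(** * Differential inequalities *)

(** No fixed point is assumed hyperbolic, so linearization and stable manifolds are replaced by sign
    changes ([attracting], [repelling]). These pass from [f] to [g] between [a] and [b], where
    [rho + f'] is positive. At a hump the sign change only yields [g' >= 0] at the point itself,
    hence [g' >= - rho ^ 2 / 8] nearby. For that constant slope the characteristic equation
    [s ^ 2 + rho s + rho ^ 2 / 8 = 0] has real roots, the larger one above [- rho / 4]: this is what
    keeps the two decay rates apart. Outside [[a, b]] the function [f x + rho x] is decreasing and
    [f] has no zero, so [f] is positive on the left and negative on the right. The level [K] at
    which [g] may be frozen depends on the point and on the time span. A basin is therefore a union
    over all levels, and flows of different levels are compared as long as the orbit stays below the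
    smaller one. *)

Lemma is_derive_cts (R : realType) (f : R -> R) (t d : R) :
  is_derive t 1 f d -> {for t, continuous f}.
Proof. by move=> h; apply/differentiable_continuous/derivable1_diffP. Qed.

(** Only right continuity is asked at [a], because [is_solution] provides no more at time 0. *)
Lemma nondecr_ivl (R : realType) (f df : R -> R) (a b : R) : a <= b ->
  f t @[t --> a^'+] --> f a ->
  (forall t : R, a < t -> t <= b -> is_derive t 1 f (df t)) ->
  (forall t : R, a < t -> t < b -> 0 <= df t) -> f a <= f b.
Proof.
rewrite le_eqVlt => /orP[/eqP ->//|ab] fa fd df0.
have [||c cab h] := @MVT R f df a b ab.
- by move=> x; rewrite in_itv/= => /andP[ax xb]; apply: fd => //; exact: ltW.
- apply/continuous_within_itvP => //; split => //.
  + move=> x; rewrite in_itv/= => /andP[ax xb].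
    exact: (is_derive_cts (fd x ax (ltW xb))).
  + apply: cvg_at_left_filter; exact: (is_derive_cts (fd b ab (lexx _))).
- rewrite -subr_ge0 h mulr_ge0 ?subr_ge0//; last exact: ltW.
  by move: cab; rewrite in_itv/= => /andP[ac cb]; rewrite df0.
Qed.

Lemma nondecr_line (R : realType) (f df : R -> R) (a b : R) : a <= b ->
  (forall t : R, is_derive t 1 f (df t)) ->
  (forall t : R, a < t -> t < b -> 0 <= df t) -> f a <= f b.
Proof.
move=> ab fd df0; apply: (@nondecr_ivl _ _ df) => //.
exact: cvg_at_right_filter (is_derive_cts (fd a)).
Qed.

(** Stands for the bound of an integral by the integral of a majorant; it follows from the
    monotonicity of [v - u] and [v + u]. *)
Lemma dominated_increment (R : realType) (u du v dv : R -> R) (a b : R) :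
  a <= b ->
  (forall t : R, is_derive t 1 u (du t)) -> (forall t : R, is_derive t 1 v (dv t)) ->
  (forall t : R, a < t -> t < b -> `|du t| <= dv t) -> `|u b - u a| <= v b - v a.
Proof.
move=> ab ud vd h.
have h1 : v a - u a <= v b - u b.
  apply: (@nondecr_line R (v - u) (fun t => dv t - du t)) => // t at_ tb.
  by rewrite subr_ge0; move: (h t at_ tb); rewrite ler_norml => /andP[].
have h2 : v a + u a <= v b + u b.
  apply: (@nondecr_line R (v + u) (fun t => dv t + du t)) => // t at_ tb.
  by move: (h t at_ tb); rewrite ler_norml => /andP[]; lra.
by rewrite ler_norml; apply/andP; split; lra.
Qed.

Lemma is_derive_expRM (R : realType) (k t : R) :
  is_derive t 1 (fun s => expR (k * s)) (k * expR (k * t)).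
Proof.
have h : is_derive t 1 (fun s : R => k * s) k.
  by have := is_deriveZ k (is_derive_id t (1 : R)); rewrite /GRing.scale/= mulr1.
by have := is_derive1_comp (is_derive_expR (k * t)) h; rewrite mulrC.
Qed.

Lemma gronwall (R : realType) (D dD : R -> R) (C T : R) : 0 <= T ->
  D t @[t --> 0^'+] --> D 0 ->
  (forall t : R, 0 < t -> t <= T -> is_derive t 1 D (dD t)) ->
  (forall t : R, 0 < t -> t < T -> dD t <= C * D t) ->
  D T <= expR (C * T) * D 0.
Proof.
move=> T0 D0 Dd h.
pose E (s : R) : R := expR (- C * s).
have Ed (s : R) : is_derive s 1 E (- C * E s) by exact: is_derive_expRM.
have : - (E 0 * D 0) <= - (E T * D T).
  apply: (@nondecr_ivl R (fun t => - (E t * D t))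
    (fun t => - (E t * dD t + D t * (- C * E t)))) => //.
  - apply: cvgN; apply: cvgM => //.
    exact: cvg_at_right_filter (is_derive_cts (Ed 0)).
  - move=> t t0 tT; have := Dd t t0 tT => ?.
    exact: is_deriveN.
  - move=> t t0 tT; rewrite oppr_ge0.
    have -> : E t * dD t + D t * (- C * E t) = E t * (dD t - C * D t) by ring.
    by rewrite pmulr_rle0 ?expR_gt0// subr_le0 h.
rewrite lerN2 /E mulr0 expR0 mul1r mulNr expRN mulrC ler_pdivrMr ?expR_gt0//.
by rewrite mulrC.
Qed.

(** The time [s] is the infimum of the times where [h <= 0]. The trapping arguments below apply this
    to a barrier function and examine the first time at which it vanishes. *)
Lemma ge0_first_exit (R : realType) (h : R -> R) (t : R) : 0 <= t ->
  continuous h -> 0 < h 0 -> h t <= 0 ->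
  exists s, [/\ 0 < s, s <= t, h s = 0 & forall r : R, 0 <= r -> r < s -> 0 < h r].
Proof.
move=> t0 hc h0 ht.
pose S := [set r | 0 <= r <= t /\ h r <= 0].
have Sne : S !=set0 by exists t; split => //; rewrite t0 lexx.
have Slb : has_lbound S by exists 0 => r [/andP[]].
have hS : has_inf S by split.
pose s := inf S.
have s0 : 0 <= s by apply: (lb_le_inf Sne) => r [/andP[]].
have st : s <= t by apply: ge_inf => //; split => //; rewrite t0 lexx.
have pos r : 0 <= r -> r < s -> 0 < h r.
  move=> r0 rs; rewrite ltNge; apply/negP => hr.
  have : s <= r by apply: ge_inf => //; split => //; rewrite r0 (le_trans (ltW rs)).
  by rewrite leNgt rs.
have hs : h s <= 0.
  rewrite leNgt; apply/negP => hs.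
  have : \forall x \near s, 0 < h x by exact: (cvgr_gt (h s) (hc s)).
  move=> /nbhs_ballP[e /= e0 he].
  have [r Sr rs] : exists2 r, S r & r < s + e by exact: (inf_adherent e0 hS).
  have sr : s <= r by exact: ge_inf.
  have : 0 < h r.
    by apply: he; rewrite /ball/= ltr_norml; apply/andP; split; lra.
  by case: Sr => _; rewrite leNgt => /negP.
have s_gt0 : 0 < s.
  rewrite lt_neqAle s0 andbT; apply/eqP => s0'.
  by move: hs; rewrite -s0' leNgt h0.
exists s; split => //.
apply/eqP; rewrite eq_le hs /= leNgt; apply/negP => {}hs.
have : \forall x \near s, h x < 0 by exact: (cvgr_lt (h s) (hc s)).
move=> /nbhs_ballP[e /= e0 he].
pose r := Num.max 0 (s - e / 2).
have rs : r < s by rewrite gt_max s_gt0 /=; lra.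
have r0 : 0 <= r by rewrite le_max lexx.
have := pos r r0 rs; rewrite ltNge => /negP; apply; apply/ltW/he.
rewrite /ball/= ltr_norml; apply/andP; split; first lra.
have : s - e / 2 <= r by rewrite le_max lexx orbT.
lra.
Qed.

Lemma bound_below_decay (R : realType) (X dX : R -> R) (k t : R) : 0 <= t ->
  (forall s : R, is_derive s 1 X (dX s)) ->
  (forall s : R, 0 < s -> s < t -> - k * X s <= dX s) ->
  X 0 * expR (- k * t) <= X t.
Proof.
move=> t0 Xd h.
have := @nondecr_line R (fun s => expR (k * s) * X s)
  (fun s => expR (k * s) * dX s + X s * (k * expR (k * s))) 0 t t0.
rewrite mulr0 expR0 mul1r mulNr expRN => H.
rewrite ler_pdivrMr ?expR_gt0// mulrC [leRHS]mulrC mulrC; apply: H.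
- move=> s; have := Xd s => ?; have := is_derive_expRM k s => ?.
  exact: is_deriveM.
- move=> s s0 st.
  have -> : expR (k * s) * dX s + X s * (k * expR (k * s)) =
    expR (k * s) * (dX s - (- k * X s)) by ring.
  by rewrite mulr_ge0 ?expR_ge0// subr_ge0 h.
Qed.

(** While both functions are positive they dominate decaying exponentials, so [min (X, Y)] cannot
    reach zero at a first exit time. The rates [(k, l)] will be [(0, rho)] on rays, [(rho, 0)] for
    the decay at a hump and [(rho / 4, 3 rho / 4)] for the separation of two orbits. *)
Lemma quadrant_invariant (R : realType) (X Y dX dY : R -> R) (k l : R) :
  (forall s : R, is_derive s 1 X (dX s)) -> (forall s : R, is_derive s 1 Y (dY s)) ->
  0 < X 0 -> 0 < Y 0 ->
  (forall s : R, 0 <= s -> 0 < X s -> 0 < Y s -> - k * X s <= dX s) ->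
  (forall s : R, 0 <= s -> 0 < X s -> 0 < Y s -> - l * Y s <= dY s) ->
  forall t : R, 0 <= t -> [/\ 0 < X t, 0 < Y t,
    X 0 * expR (- k * t) <= X t & Y 0 * expR (- l * t) <= Y t].
Proof.
move=> Xd Yd X0 Y0 hX hY.
have Xc : continuous X by move=> s; exact: is_derive_cts (Xd s).
have Yc : continuous Y by move=> s; exact: is_derive_cts (Yd s).
have est t : 0 <= t -> (forall r : R, 0 <= r -> r < t -> 0 < X r /\ 0 < Y r) ->
    X 0 * expR (- k * t) <= X t /\ Y 0 * expR (- l * t) <= Y t.
  move=> t0 h; split.
  - apply: (bound_below_decay t0 Xd) => s s0 st.
    by have [? ?] := h s (ltW s0) st; apply: hX => //; exact: ltW.
  - apply: (bound_below_decay t0 Yd) => s s0 st.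
    by have [? ?] := h s (ltW s0) st; apply: hY => //; exact: ltW.
have main t : 0 <= t -> 0 < Num.min (X t) (Y t).
  move=> t0; rewrite ltNge; apply/negP => hm.
  have [||s [s0 st hs pos]] := @ge0_first_exit R (X \min Y) t t0 _ _ hm.
  - by move=> s; apply: continuous_min; [exact: Xc|exact: Yc].
  - by rewrite /= lt_min X0 Y0.
  - have [|e1 e2] := est s (ltW s0).
      by move=> r r0 rs; have /= := pos r r0 rs; rewrite lt_min => /andP.
    have : 0 < Num.min (X s) (Y s).
      by rewrite lt_min (lt_le_trans _ e1) ?(lt_le_trans _ e2)// mulr_gt0// expR_gt0.
    by rewrite /= in hs; rewrite hs ltxx.
move=> t t0; have := main t t0; rewrite lt_min => /andP[? ?].
have [|? ?] := est t t0; last by split.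
by move=> r r0 _; have := main r r0; rewrite lt_min => /andP.
Qed.

Lemma const_ivl (R : realType) (f : R -> R) (a b : R) : a <= b ->
  (forall t : R, a <= t -> t <= b -> is_derive t 1 f 0) -> f a = f b.
Proof.
move=> ab h; apply/eqP; rewrite eq_le; apply/andP; split.
- apply: (@nondecr_ivl _ f (fun=> 0)) => //.
    apply: cvg_at_right_filter; apply: (is_derive_cts (h a _ _)) => //.
  by move=> t at_ tb; apply: h => //; exact: ltW.
- rewrite -lerN2; apply: (@nondecr_ivl _ (- f) (fun=> 0)) => //.
    apply: cvgN; apply: cvg_at_right_filter; apply: (is_derive_cts (h a _ _)) => //.
  by move=> t at_ tb; have := h t (ltW at_) tb => ?; rewrite -oppr0; exact: is_deriveN.
Qed.

(** The integrals over growing bounded intervals, normalized at 0, agree where they are both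
    defined; the primitive at [x] uses an interval large enough for [x]. *)
Lemma antiderivative (R : realType) (f : R -> R) : continuous f ->
  exists F : R -> R, F 0 = 0 /\ forall t : R, is_derive t 1 F (f t).
Proof.
move=> fc; pose mu := @lebesgue_measure R.
pose J (n : nat) x := (\int[mu]_(t in [set` `[- n.+1%:R, x]]) f t)%R.
have Jd n (x : R) : `|x| < n.+1%:R -> is_derive x 1 (J n) (f x).
  rewrite ltr_norml => /andP[x1 x2].
  have [|d e] := @continuous_FTC1_closed R f (- n.+1%:R) x n.+1%:R x2 _ x1 (fc x).
    apply: continuous_compact_integrable; first exact: segment_compact.
    by apply: continuous_subspaceT.
  by apply: DeriveDef => //; rewrite -derive1E.
pose G n (x : R) := J n x - J n 0.
have Gd n (x : R) : `|x| < n.+1%:R -> is_derive x 1 (G n) (f x).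
  move=> /Jd ?; apply: is_derive_eq; exact: subr0.
have GG n m (x : R) : `|x| < n.+1%:R -> `|x| < m.+1%:R -> G n x = G m x.
  move=> xn xm; apply/eqP; rewrite -subr_eq0; apply/eqP.
  have D0 (t : R) : `|t| <= `|x| -> is_derive t 1 (G n - G m) 0.
    move=> tx; have := Gd n t (le_lt_trans tx xn).
    have := Gd m t (le_lt_trans tx xm) => ? ?.
    by apply: is_derive_eq; exact: subrr.
  have z : (G n - G m) 0 = 0 by rewrite /G !fctE !subrr.
  rewrite -[LHS]/((G n - G m) x) -z; have [x0|x0] := leP 0 x.
    apply/esym/const_ivl => // t t0 tx; apply: D0.
    by rewrite ger0_norm// ger0_norm.
  apply: const_ivl => [|t xt t0]; first exact: ltW.
  by apply: D0; rewrite ler0_norm// ltr0_norm// lerN2.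
pose N (x : R) := Num.truncn `|x|.
have xN x : `|x| < (N x).+1%:R by exact: truncnS_gt.
exists (fun x => G (N x) x); split; first by rewrite /G subrr.
move=> t; apply: (near_eq_is_derive _ (Gd (N t) t (xN t))).
have : \forall y \near t, `|y| < (N t).+1%:R.
  have c : {for t, continuous (Num.norm : R -> R)} by exact: norm_continuous.
  exact: (cvgr_lt _ c).
by apply: filterS => y yN; apply: GG.
Qed.

(** * Global existence for Lipschitz planar systems *)

Section Picard.
Context {R : realType}.
Implicit Types (x y u v : R -> R) (c t A B : R).

(** The radius [2 B / 2 ^ n] is the sum of the remaining steps, so the intervals of this radius
    around [u n] are nested; the limit is the supremum of their left ends. *)
Lemma geometric_limit (u : nat -> R) B :
  (forall n, `|u n.+1 - u n| <= B / 2 ^+ n) ->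
  exists l, forall n, `|u n - l| <= 2 * B / 2 ^+ n.
Proof.
move=> h.
have half n : B / 2 ^+ n.+1 = B / 2 ^+ n / 2 by rewrite exprSr invfM mulrA.
pose a n := u n - 2 * (B / 2 ^+ n); pose b n := u n + 2 * (B / 2 ^+ n).
have a_nd n : a n <= a n.+1.
  by rewrite /a half; move: (h n); rewrite ler_norml => /andP[]; lra.
have b_ni n : b n.+1 <= b n.
  by rewrite /b half; move: (h n); rewrite ler_norml => /andP[]; lra.
have B0 n : 0 <= B / 2 ^+ n by exact: le_trans (h n).
have an m n : (m <= n)%N -> a m <= a n.
  by move=> mn; apply: (homo_leq (@lexx _ R) (@le_trans _ R) a_nd mn).
have bn m n : (m <= n)%N -> b n <= b m.
  elim: n => [|n ih]; first by rewrite leqn0 => /eqP ->.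
  rewrite leq_eqVlt => /predU1P[->//|]; rewrite ltnS => /ih; exact: le_trans.
have ab m n : a m <= b n.
  apply: (@le_trans _ _ (a (maxn m n))); first by rewrite an ?leq_maxl.
  apply: (@le_trans _ _ (b (maxn m n))); last by rewrite bn ?leq_maxr.
  by rewrite /a /b; have := B0 (maxn m n); lra.
exists (sup (range a)) => n.
have un : ubound (range a) (b n) by move=> _ [m _ <-].
have h1 : a n <= sup (range a) by apply: ub_le_sup; [exists (b n)|exists n].
have h2 : sup (range a) <= b n by apply: ge_sup => //; exists (a 0%N), 0%N.
by rewrite -mulrA ler_norml; move: h1 h2; rewrite /a /b => ? ?; apply/andP; split; lra.
Qed.

Let w c t : R := expR (c * t) + expR (- c * t).

Lemma cosh_weight_ge1 c t : 1 <= w c t.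
Proof.
have [h|h] := leP 0 (c * t).
- have := @expR_ge1Dx _ (c * t); have := expR_ge0 (- c * t); rewrite /w; lra.
- have := @expR_ge1Dx _ (- c * t); have := expR_ge0 (c * t).
  by rewrite /w mulNr; lra.
Qed.

(* Even and equal, up to the factor [1 / c], to a bound on its own primitive,
   this weight makes the Picard operator a contraction on both half-lines. *)
Lemma cosh_weight_primitive c B (D dD : R -> R) : 0 < c -> 0 <= B ->
  D 0 = 0 -> (forall t : R, is_derive t 1 D (dD t)) ->
  (forall t : R, `|dD t| <= B * w c t) -> forall t : R, `|D t| <= B / c * w c t.
Proof.
move=> c0 B0 D0 Dd h t.
pose v (s : R) := B / c * (expR (c * s) - expR (- c * s)).
have vd (s : R) : is_derive s 1 v (B * w c s).
  have h1 := is_derive_expRM c s; have h2 := is_derive_expRM (- c) s.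
  have := is_deriveZ (B / c) (is_deriveB h1 h2); rewrite /GRing.scale/=.
  have -> // : B / c * (c * expR (c * s) - - c * expR (- c * s)) = B * w c s.
  by rewrite /w mulNr opprK -mulrDr; field; rewrite gt_eqF.
have v0 : v 0 = 0 by rewrite /v !mulr0 subrr mulr0.
have wv s : `|v s| <= B / c * w c s.
  rewrite /v /w normrM ger0_norm ?divr_ge0 ?(ltW c0)//.
  rewrite ler_wpM2l ?divr_ge0 ?(ltW c0)// ler_norml.
  by have := expR_ge0 (c * s); have := expR_ge0 (- c * s); lra.
apply: le_trans (wv t); have [t0|t0] := leP 0 t.
- have := dominated_increment t0 Dd vd (fun s _ _ => h s).
  by rewrite D0 v0 !subr0 => /le_trans; apply; exact: ler_norm.
- have := dominated_increment (ltW t0) Dd vd (fun s _ _ => h s).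
  rewrite D0 v0 !sub0r normrN => /le_trans; apply.
  by rewrite -[leRHS]normrN ler_norm.
Qed.

Variables (F1 F2 : R -> R -> R) (L : R).
Hypothesis L0 : 0 < L.
Hypothesis F1L : forall x y x' y' : R,
  `|F1 x y - F1 x' y'| <= L * (`|x - x'| + `|y - y'|).
Hypothesis F2L : forall x y x' y' : R,
  `|F2 x y - F2 x' y'| <= L * (`|x - x'| + `|y - y'|).

Lemma lipschitz2_continuous (F : R -> R -> R) x y :
  (forall a b a' b' : R, `|F a b - F a' b'| <= L * (`|a - a'| + `|b - b'|)) ->
  continuous x -> continuous y -> continuous (fun t => F (x t) (y t)).
Proof.
move=> FL xc yc t; apply/cvgrPdist_lt => e e0.
have d0 : 0 < e / (L * 2) by rewrite divr_gt0// mulr_gt0.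
near=> s; apply: le_lt_trans (FL _ _ _ _) _.
have -> : e = L * (e / (L * 2) + e / (L * 2)) by field; rewrite gt_eqF.
rewrite ltr_pM2l// ltrD//; near: s.
- exact: (cvgr_dist_lt _ _ (xc t) _ d0).
- exact: (cvgr_dist_lt _ _ (yc t) _ d0).
Unshelve. all: by end_near. Qed.

Lemma picard_lindelof (x0 y0 : R) : exists x y : R -> R,
  [/\ x 0 = x0, y 0 = y0,
    forall t : R, is_derive t 1 x (F1 (x t) (y t)) &
    forall t : R, is_derive t 1 y (F2 (x t) (y t))].
Proof.
(* [I] is integration from 0, chosen among primitives; on discontinuous functions it takes a
   meaningless default value. *)
have [I IP] : exists I : (R -> R) -> R -> R, forall u, continuous u ->
    I u 0 = 0 /\ forall t : R, is_derive t 1 (I u) (u t).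
  have : forall u, exists v : R -> R, continuous u ->
      v 0 = 0 /\ forall t : R, is_derive t 1 v (u t).
    move=> u; have [uc|nu] := pselect (continuous u); last by exists (fun=> 0).
    by have [v] := antiderivative uc; exists v.
  by move=> /choice[I IP]; exists I.
pose step (z : (R -> R) * (R -> R)) : (R -> R) * (R -> R) :=
  ((fun t => x0 + I (fun s => F1 (z.1 s) (z.2 s)) t),
   (fun t => y0 + I (fun s => F2 (z.1 s) (z.2 s)) t)).
pose Z n := iter n step (cst x0, cst y0).
have Ic u k : continuous u -> forall t : R, is_derive t 1 (fun s => k + I u s) (u t).
  move=> uc t; have [_ /(_ t) ?] := IP u uc.
  by have := is_deriveD (is_derive_cst k t (1 : R)) (_ : is_derive t 1 (I u) (u t));
    rewrite add0r; apply.
have Zc n : continuous (Z n).1 /\ continuous (Z n).2.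
  elim: n => [|n [c1 c2]]; first by split=> t; exact: cvg_cst.
  split=> t; apply: is_derive_cts; apply: Ic; exact: lipschitz2_continuous.
pose f n s := F1 ((Z n).1 s) ((Z n).2 s); pose g n s := F2 ((Z n).1 s) ((Z n).2 s).
have fc n : continuous (f n) by case: (Zc n) => *; exact: lipschitz2_continuous.
have gc n : continuous (g n) by case: (Zc n) => *; exact: lipschitz2_continuous.
(* One integration divides a multiple of the weight by [c]. Each of the two components contributes a
   factor [L / c = 1 / 4], so a Picard step halves the weighted distance. *)
pose c := 4 * L; have c0 : 0 < c by rewrite mulr_gt0.
pose K := `|F1 x0 y0| + `|F2 x0 y0|; pose A := K / c.
have K0 : 0 <= K by rewrite addr_ge0.
have A0 : 0 <= A by rewrite divr_ge0// ltW.
have w0 t : 0 <= w c t by exact: le_trans (cosh_weight_ge1 _ _).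
have cmp u v B : 0 <= B -> continuous u -> continuous v ->
    (forall s : R, `|u s - v s| <= B * w c s) ->
    forall t : R, `|I u t - I v t| <= B / c * w c t.
  move=> B0 uc vc h t.
  have [u0 ud] := IP u uc; have [v0 vd] := IP v vc.
  apply: (@cosh_weight_primitive c B (I u - I v) (fun s => u s - v s)) => //.
  by rewrite !fctE u0 v0 subrr.
pose q n : R := A / 2 ^+ n.
have q0 n : 0 <= q n by rewrite divr_ge0// exprn_ge0.
have qS n : q n.+1 = q n / 2 by rewrite /q exprSr invfM mulrA.
have cL : L / c = 4^-1 by rewrite /c invfM mulrCA divff ?gt_eqF// mulr1.
have est n t : `|(Z n.+1).1 t - (Z n).1 t| + `|(Z n.+1).2 t - (Z n).2 t| <= q n * w c t.
  elim: n t => [|n ih] t.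
    have h1 : `|I (f 0%N) t| <= `|F1 x0 y0| / c * w c t.
      have [u0 ud] := IP _ (fc 0%N).
      apply: (cosh_weight_primitive c0 _ u0 ud) => // s.
      by rewrite ler_peMr// cosh_weight_ge1.
    have h2 : `|I (g 0%N) t| <= `|F2 x0 y0| / c * w c t.
      have [u0 ud] := IP _ (gc 0%N).
      apply: (cosh_weight_primitive c0 _ u0 ud) => // s.
      by rewrite ler_peMr// cosh_weight_ge1.
    rewrite /= ![_ + I _ _]addrC !addrK.
    apply: le_trans (lerD h1 h2) _.
    by rewrite -mulrDl -mulrDl /q expr0 divr1.
  have h s : L * (`|(Z n.+1).1 s - (Z n).1 s| + `|(Z n.+1).2 s - (Z n).2 s|)
       <= L * q n * w c s.
    by rewrite -mulrA ler_pM2l.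
  have Lq : 0 <= L * q n by rewrite mulr_ge0// ltW.
  have h1 : `|I (f n.+1) t - I (f n) t| <= L * q n / c * w c t.
    by apply: cmp => // s; exact: le_trans (F1L _ _ _ _) (h s).
  have h2 : `|I (g n.+1) t - I (g n) t| <= L * q n / c * w c t.
    by apply: cmp => // s; exact: le_trans (F2L _ _ _ _) (h s).
  have e (k a b : R) : (k + a) - (k + b) = a - b by ring.
  rewrite /= !e; apply: le_trans (lerD h1 h2) _.
  rewrite -mulrDl ler_wpM2r// qS mulrAC cL; lra.
have lim1 t : exists l, forall n, `|(Z n).1 t - l| <= 2 * (A * w c t) / 2 ^+ n.
  apply: geometric_limit => n; rewrite mulrAC; apply: le_trans (est n t).
  by rewrite lerDl.
have lim2 t : exists l, forall n, `|(Z n).2 t - l| <= 2 * (A * w c t) / 2 ^+ n.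
  apply: geometric_limit => n; rewrite mulrAC; apply: le_trans (est n t).
  by rewrite lerDr.
have [x hx] := choice lim1; have [y hy] := choice lim2.
have qw t n : 2 * (A * w c t) / 2 ^+ n = 2 * q n * w c t by rewrite /q; ring.
have q_small M e : 0 < e -> exists n, q n * M < e.
  move=> e0.
  have /cvgrPdist_lt/(_ e e0) : (A * M) * (2^-1) ^+ n @[n --> \oo] --> (A * M) * 0.
    by apply: cvgMr; apply: cvg_expr; rewrite ger0_norm//; lra.
  rewrite mulr0 => -[n _ /(_ n (leqnn n))/=]; rewrite sub0r normrN => h.
  exists n; apply: le_lt_trans h; rewrite /q -exprVn mulrAC; exact: ler_norm.
have wc : continuous (w c).
  move=> t; apply: cvgD; first exact: (is_derive_cts (is_derive_expRM c t)).
  exact: (is_derive_cts (is_derive_expRM (- c) t)).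
have cts (i : nat -> R -> R) z : (forall n, continuous (i n)) ->
    (forall t n, `|i n t - z t| <= 2 * (A * w c t) / 2 ^+ n) -> continuous z.
  move=> ic hz t; apply/cvgrPdist_lt => e e0.
  have e6 : 0 < e / 6 by lra.
  have [n qn] := q_small (w c t + 1) _ e6.
  near=> s.
  have ws : w c s <= w c t + 1.
    apply/ltW; near: s; apply: (cvgr_lt _ (wc t)); lra.
  have h1 := hz t n; have h2 := hz s n; rewrite !qw in h1 h2.
  have h3 : `|i n t - i n s| < e / 6 by near: s; exact: (cvgr_dist_lt _ _ (ic n t) _ e6).
  have h4 : q n * w c t <= q n * (w c t + 1) by rewrite ler_wpM2l//; lra.
  have h5 : q n * w c s <= q n * (w c t + 1) by rewrite ler_wpM2l.
  have -> : z t - z s = - (i n t - z t) + (i n t - i n s) + (i n s - z s) by ring.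
  apply: le_lt_trans (ler_normD _ _) _; have := ler_normD (- (i n t - z t)) (i n t - i n s).
  by rewrite normrN; lra.
have xc : continuous x by apply: (cts (fun n => (Z n).1)) => // n; case: (Zc n).
have yc : continuous y by apply: (cts (fun n => (Z n).2)) => // n; case: (Zc n).
have uc : continuous (fun t => F1 (x t) (y t)) by exact: lipschitz2_continuous.
have vc : continuous (fun t => F2 (x t) (y t)) by exact: lipschitz2_continuous.
(* The limit differs from iterate [n + 1] by at most [q n * w], and so do their images under the
   Picard operator one step earlier; both bounds tend to zero. *)
have fix_ (i : nat -> R -> R) z k F :
    (forall a b a' b' : R, `|F a b - F a' b'| <= L * (`|a - a'| + `|b - b'|)) ->
    (forall n t, i n.+1 t = k + I (fun s => F ((Z n).1 s) ((Z n).2 s)) t) ->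
    (forall t n, `|i n t - z t| <= 2 * (A * w c t) / 2 ^+ n) ->
    z = (fun t => k + I (fun s => F (x s) (y s)) t).
  move=> FL iS hz; apply/funext => t; apply/eqP; rewrite -subr_eq0 -normr_eq0.
  rewrite eq_le normr_ge0 andbT; apply/ler_addgt0Pl => e e0; rewrite addr0.
  have e2 : 0 < e / 2 by lra.
  have [n qn] := q_small (w c t) _ e2.
  have h1 := hz t n.+1; rewrite qw qS in h1.
  have h2 : `|I (fun s => F ((Z n).1 s) ((Z n).2 s)) t - I (fun s => F (x s) (y s)) t|
      <= L * (4 * q n) / c * w c t.
    apply: cmp.
    - by rewrite mulr_ge0 ?(ltW L0)// mulr_ge0.
    - by case: (Zc n) => *; exact: lipschitz2_continuous.
    - exact: lipschitz2_continuous.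
    - move=> s; apply: le_trans (FL _ _ _ _) _; rewrite -mulrA ler_pM2l//.
      by have := hx s n; have := hy s n; rewrite !qw; lra.
  rewrite (mulrAC L) cL in h2.
  have -> : z t - (k + I (fun s => F (x s) (y s)) t) = - (i n.+1 t - z t) +
     (I (fun s => F ((Z n).1 s) ((Z n).2 s)) t - I (fun s => F (x s) (y s)) t).
    by rewrite iS; ring.
  apply: le_trans (ler_normD _ _) _; rewrite normrN.
  by move: h2 qn h1; set Q := q n * w c t; have -> : 4^-1 * (4 * q n) * w c t = Q
    by [rewrite /Q; field]; rewrite /Q; lra.
have xE := fix_ (fun n => (Z n).1) x x0 F1 F1L (fun n t => erefl) hx.
have yE := fix_ (fun n => (Z n).2) y y0 F2 F2L (fun n t => erefl) hy.
exists x, y; split.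
- by rewrite xE (IP _ uc).1 addr0.
- by rewrite yE (IP _ vc).1 addr0.
- by move=> t; rewrite {1}xE; exact: Ic.
- by move=> t; rewrite {1}yE; exact: Ic.
Unshelve. all: by end_near. Qed.

End Picard.

(** * The damped Newton equation *)

(** Orbits live on the whole line: the density argument flows points backwards, which the complete
    truncated systems permit. *)
Definition orbit (R : realType) (g : R -> R) (rho : R) (x p : R -> R) : Prop :=
  forall t : R, is_derive t 1 x (p t) /\ is_derive t 1 p (- rho * p t + g (x t)).

Definition is_flow (R : realType) (g : R -> R) (rho : R)
    (Phi : R * R -> R -> R * R) : Prop :=
  forall z, Phi z 0 = z /\
    orbit g rho (fun t => (Phi z t).1) (fun t => (Phi z t).2).

Lemma sqr_dist_le0 (R : realType) (u v : R * R) :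
  (u.1 - v.1) ^+ 2 + (u.2 - v.2) ^+ 2 <= 0 -> u = v.
Proof.
rewrite le_eqVlt ltNge addr_ge0 ?sqr_ge0//= orbF paddr_eq0 ?sqr_ge0//.
rewrite !sqrf_eq0 !subr_eq0.
by case: u v => [? ?] [? ?] /= /andP[/eqP -> /eqP ->].
Qed.

Section Flow.
Context {R : realType}.
Variables (g : R -> R) (rho l : R).
Hypothesis rho0 : 0 < rho.
Hypothesis l0 : 0 < l.
Hypothesis gl : forall x y : R, `|g x - g y| <= l * `|x - y|.

Lemma is_flow_exists : exists Phi, is_flow g rho Phi.
Proof.
have L0 : 0 < 1 + rho + l by rewrite !addr_gt0.
suff /choice[Phi h] : forall z : R * R, exists phi : R -> R * R,
    phi 0 = z /\ orbit g rho (fun t => (phi t).1) (fun t => (phi t).2).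
  by exists Phi.
move=> [x0 p0].
have h1 (x y x' y' : R) : `|y - y'| <= (1 + rho + l) * (`|x - x'| + `|y - y'|).
  have := normr_ge0 (x - x'); have := normr_ge0 (y - y').
  set a := `|y - y'|; set b := `|x - x'| => a0 b0.
  have : 0 <= (rho + l) * (b + a) by rewrite mulr_ge0 ?addr_ge0// ltW.
  have -> : (1 + rho + l) * (b + a) = a + b + (rho + l) * (b + a) by ring.
  lra.
have h2 (x y x' y' : R) : `|(- rho * y + g x) - (- rho * y' + g x')|
    <= (1 + rho + l) * (`|x - x'| + `|y - y'|).
  have -> : - rho * y + g x - (- rho * y' + g x') = - rho * (y - y') + (g x - g x').
    by ring.
  apply: le_trans (ler_normD _ _) _; rewrite normrM normrN (gtr0_norm rho0).
  apply: le_trans (lerD (lexx _) (gl _ _)) _.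
  have := normr_ge0 (x - x'); have := normr_ge0 (y - y').
  set a := `|y - y'|; set b := `|x - x'| => a0 b0.
  have := mulr_ge0 (ltW rho0) b0; have := mulr_ge0 (ltW l0) a0; lra.
have [x [p [x0E p0E xd pd]]] :=
  picard_lindelof L0 h1 h2 x0 p0.
by exists (fun t => (x t, p t)); rewrite /= x0E p0E; split.
Qed.

Let C := 1 + l + 2 * rho.

(** The absolute value lets Gronwall's inequality run in both directions of time in [orbit_dist]. *)
Lemma orbit_dist_derive (x p y q : R) :
  `|2 * (x - y) * (p - q) + 2 * (p - q) * ((- rho * p + g x) - (- rho * q + g y))|
  <= C * ((x - y) ^+ 2 + (p - q) ^+ 2).
Proof.
have -> : 2 * (x - y) * (p - q) +
  2 * (p - q) * ((- rho * p + g x) - (- rho * q + g y)) =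
  2 * ((x - y) * (p - q)) + 2 * ((p - q) * (g x - g y)) - 2 * rho * (p - q) ^+ 2.
  by ring.
have h := gl x y; move: h.
set a := x - y; set b := p - q; set d := g x - g y => h.
have hb : `|b * d| <= l * (`|a| * `|b|).
  by rewrite normrM mulrC mulrA ler_wpM2r.
have ab : 2 * (`|a| * `|b|) <= a ^+ 2 + b ^+ 2.
  rewrite -(real_normK (num_real a)) -(real_normK (num_real b)) -subr_ge0.
  by have := sqr_ge0 (`|a| - `|b|); rewrite sqrrB; lra.
have ab' : `|a * b| = `|a| * `|b| by rewrite normrM.
have lab : l * (2 * (`|a| * `|b|)) <= l * (a ^+ 2 + b ^+ 2) by rewrite ler_pM2l.
have e : `|2 * rho * b ^+ 2| = 2 * rho * b ^+ 2.
  by rewrite ger0_norm// mulr_ge0 ?sqr_ge0// mulr_ge0// ltW.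
have ra : 0 <= rho * a ^+ 2 by rewrite mulr_ge0 ?sqr_ge0// ltW.
apply: le_trans (ler_normB _ _) _; rewrite e.
apply: (@le_trans _ _ (`|2 * (a * b)| + `|2 * (b * d)| + 2 * rho * b ^+ 2)).
  by rewrite lerD2r ler_normD.
rewrite !(normrM 2) ger0_norm// ab' /C; lra.
Qed.

(** Version for curves that solve the equation on []0, T]] only. It serves to compare a truncated
    orbit with a solution of the planar system, or with an orbit of another truncation. *)
Lemma orbit_gronwall (x p y q : R -> R) (T : R) : 0 <= T ->
  x t @[t --> 0^'+] --> x 0 -> p t @[t --> 0^'+] --> p 0 ->
  y t @[t --> 0^'+] --> y 0 -> q t @[t --> 0^'+] --> q 0 ->
  (forall t : R, 0 < t -> t <= T ->
     is_derive t 1 x (p t) /\ is_derive t 1 p (- rho * p t + g (x t))) ->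
  (forall t : R, 0 < t -> t <= T ->
     is_derive t 1 y (q t) /\ is_derive t 1 q (- rho * q t + g (y t))) ->
  (x T - y T) ^+ 2 + (p T - q T) ^+ 2 <=
  expR (C * T) * ((x 0 - y 0) ^+ 2 + (p 0 - q 0) ^+ 2).
Proof.
move=> T0 xc pc yc qc h1 h2.
apply: (@gronwall R (fun t => (x t - y t) ^+ 2 + (p t - q t) ^+ 2)
  (fun t => 2 * (x t - y t) * (p t - q t) + 2 * (p t - q t) *
    ((- rho * p t + g (x t)) - (- rho * q t + g (y t)))) C T T0).
- by apply: cvgD; rewrite !expr2; apply: cvgM; exact: cvgB.
- move=> t t0 tT; have [xd pd] := h1 t t0 tT; have [yd qd] := h2 t t0 tT.
  have := is_deriveD (is_deriveX 2 (is_deriveB xd yd)) (is_deriveX 2 (is_deriveB pd qd)).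
  by rewrite /GRing.scale/= !expr1.
- move=> t t0 tT; apply: le_trans (ler_norm _) _; exact: orbit_dist_derive.
Qed.

Lemma orbit_dist (x p y q : R -> R) (T t : R) : orbit g rho x p ->
  orbit g rho y q -> `|t| <= T ->
  (x t - y t) ^+ 2 + (p t - q t) ^+ 2 <=
  expR (C * T) * ((x 0 - y 0) ^+ 2 + (p 0 - q 0) ^+ 2).
Proof.
move=> h1 h2 tT.
pose D s := (x s - y s) ^+ 2 + (p s - q s) ^+ 2.
pose dD s := 2 * (x s - y s) * (p s - q s) + 2 * (p s - q s) *
    ((- rho * p s + g (x s)) - (- rho * q s + g (y s))).
have Dd (s : R) : is_derive s 1 D (dD s).
  have [xd pd] := h1 s; have [yd qd] := h2 s.
  have := is_deriveD (is_deriveX 2 (is_deriveB xd yd)) (is_deriveX 2 (is_deriveB pd qd)).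
  by rewrite /GRing.scale/= !expr1.
have D0 s : 0 <= D s by rewrite addr_ge0 ?sqr_ge0.
have C0 : 0 < C by rewrite /C; move: l0 rho0; lra.
have [t0|t0] := leP 0 t.
- apply: (@le_trans _ _ (expR (C * t) * D 0)).
    apply: (@gronwall R D dD) => // [|s _ _].
      exact: cvg_at_right_filter (is_derive_cts (Dd 0)).
    apply: le_trans (ler_norm _) _; exact: orbit_dist_derive.
  rewrite ler_wpM2r// ler_expR ler_pM2l//.
  by move: tT; rewrite ger0_norm.
- apply: (@le_trans _ _ (expR (C * - t) * D 0)).
    have t0' : 0 <= - t by lra.
    have Dd' (s : R) : is_derive s 1 (fun s => D (- s)) (- dD (- s)).
      have := is_derive1_comp (Dd (- s)) (is_deriveNid s (1 : R)).
      by rewrite mulrN1.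
    have := @gronwall R (fun s => D (- s)) (fun s => - dD (- s)) C (- t) t0'.
    rewrite opprK oppr0; apply => // [|s _ _].
      have := cvg_at_right_filter (is_derive_cts (Dd' 0)).
      by rewrite oppr0.
    apply: le_trans (ler_norm _) _; rewrite normrN; exact: orbit_dist_derive.
  rewrite ler_wpM2r// ler_expR ler_pM2l//.
  by move: tT; rewrite ltr0_norm.
Qed.

Lemma orbit_shift (x p : R -> R) (s : R) : orbit g rho x p ->
  orbit g rho (fun t => x (s + t)) (fun t => p (s + t)).
Proof.
move=> h t; have [xd pd] := h (s + t).
have sd : is_derive t 1 (fun u : R => s + u) 1.
  by have := is_deriveD (is_derive_cst s t (1 : R)) (is_derive_id t (1 : R)); rewrite add0r.
have := is_derive1_comp xd sd; have := is_derive1_comp pd sd.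
by rewrite !mulr1.
Qed.

Variables (Phi : R * R -> R -> R * R).
Hypothesis PhiP : is_flow g rho Phi.

Lemma flow0 z : Phi z 0 = z. Proof. by case: (PhiP z). Qed.

Lemma flow_orbit z : orbit g rho (fun t => (Phi z t).1) (fun t => (Phi z t).2).
Proof. by case: (PhiP z). Qed.

Lemma flow_uniq (x p : R -> R) (t : R) : orbit g rho x p ->
  Phi (x 0, p 0) t = (x t, p t).
Proof.
move=> h; have := orbit_dist (flow_orbit (x 0, p 0)) h (lexx `|t|).
rewrite flow0/= !subrr expr0n/= addr0 mulr0 => h'.
exact: sqr_dist_le0.
Qed.

Lemma flowD z s t : Phi (Phi z s) t = Phi z (s + t).
Proof.
have := flow_uniq t (orbit_shift s (flow_orbit z)).
by rewrite addr0 -surjective_pairing => ->; rewrite -surjective_pairing.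
Qed.

Lemma flow_unif T e : 0 < e -> exists2 d, 0 < d & forall z w t, `|t| <= T ->
  `|z - w| < d -> `|Phi z t - Phi w t| < e.
Proof.
(* The norm of the plane is the maximum of the coordinates: [|z - w| < d] bounds the sum of squares
   by [2 d ^ 2], and the flow multiplies it by at most [exp (C T)]. *)
move=> e0; pose k := Num.sqrt (2 * expR (C * T)).
have k0 : 0 < k by rewrite sqrtr_gt0 mulr_gt0 ?expR_gt0.
have k2 : k ^+ 2 = 2 * expR (C * T).
  by rewrite sqr_sqrtr// mulr_ge0 ?expR_ge0.
exists (e / k); first by rewrite divr_gt0.
move=> z w t tT zw.
have := orbit_dist (flow_orbit z) (flow_orbit w) tT; rewrite !flow0.
move: zw; rewrite !prod_normE/= !gt_max => /andP[zw1 zw2].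
set a := z.1 - w.1 in zw1 *; set b := z.2 - w.2 in zw2 *.
set a' := _ - (Phi w t).1; set b' := _ - (Phi w t).2 => h.
have d0 : 0 <= e / k by apply: divr_ge0; exact: ltW.
have sq (u v : R) : 0 <= v -> `|u| < v -> u ^+ 2 < v ^+ 2.
  by move=> v0 uv; rewrite -(real_normK (num_real u)) ltr_pXn2r// nnegrE.
have sq' (u v : R) : 0 <= v -> u ^+ 2 < v ^+ 2 -> `|u| < v.
  by move=> v0; rewrite -(real_normK (num_real u)) ltr_pXn2r// nnegrE.
have ha := sq _ _ d0 zw1; have hb := sq _ _ d0 zw2.
have E0 := expR_gt0 (C * T).
have lt : a' ^+ 2 + b' ^+ 2 < e ^+ 2.
  apply: le_lt_trans h _.
  have -> : e ^+ 2 = expR (C * T) * (2 * (e / k) ^+ 2).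
    by rewrite exprMn exprVn k2; field; rewrite gt_eqF.
  by rewrite ltr_pM2l//; lra.
apply/andP; split; apply: sq' (ltW e0) _; apply: le_lt_trans lt.
- by rewrite lerDl sqr_ge0.
- by rewrite lerDr sqr_ge0.
Qed.

Lemma flow_time_continuous z : continuous (Phi z).
Proof.
move=> t; have [h1 h2] := flow_orbit z t.
rewrite [Phi z](_ : _ = (fun s => ((Phi z s).1, (Phi z s).2))); last first.
  by apply/funext => s; exact: surjective_pairing.
exact: cvg_pair (is_derive_cts h1) (is_derive_cts h2).
Qed.

Lemma flow_continuous : continuous (fun u : R * (R * R) => Phi u.2 u.1).
Proof.
move=> [t z]; apply/cvgrPdist_lt => e e0 /=.
have e2 : 0 < e / 2 by lra.
have [d d0 hd] := flow_unif (`|t| + 1) e2.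
have h : \forall s \near t, `|Phi z t - Phi z s| < e / 2.
  by apply: (cvgr_dist_lt _ _ (@flow_time_continuous z t)).
have h3 : \forall u \near t, `|u| < `|t| + 1.
  have c : {for t, continuous (Num.norm : R -> R)} by exact: norm_continuous.
  by apply: (cvgr_lt _ c); lra.
exists ([set s | `|Phi z t - Phi z s| < e / 2 /\ `|s| < `|t| + 1],
    [set w | `|z - w| < d]).
  split => /=; first exact: (filterI h h3).
  by have := @nbhsx_ballx _ (R * R)%type z d d0; rewrite -ball_normE.
move=> [s w] /= [[h1 h2] zw].
have -> : Phi z t - Phi w s = (Phi z t - Phi z s) + (Phi z s - Phi w s).
  by rewrite addrA subrK.
apply: le_lt_trans (ler_normD _ _) _; rewrite [e]splitr ltrD//.
by apply: hd => //; exact: ltW.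
Qed.

End Flow.

(** * Convergence of bounded orbits to zeros of the force *)

Section Damped.
Context {R : realType}.
Variables (g : R -> R) (rho : R).
Hypothesis rho0 : 0 < rho.

Lemma orbit_continuous1 (x p : R -> R) : orbit g rho x p -> continuous x.
Proof. by move=> h t; have [/is_derive_cts] := h t. Qed.

Lemma orbit_continuous2 (x p : R -> R) : orbit g rho x p -> continuous p.
Proof. by move=> h t; have [_ /is_derive_cts] := h t. Qed.

(** The integrating factor [exp (rho t)] removes the friction: the derivative of [exp (rho t) * p]
    is [exp (rho t) * g x]. *)
Lemma orbit_momentum_bounded (G : R) (x p : R -> R) :
  (forall y, `|g y| <= G) -> orbit g rho x p ->
  forall t, 0 <= t -> `|p t| <= `|p 0| + G / rho.
Proof.
move=> gG h t t0.
have pd (s : R) : is_derive s 1 p (- rho * p s + g (x s)) by case: (h s).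
have ud (s : R) : is_derive s 1 (fun s => expR (rho * s) * p s) (expR (rho * s) * g (x s)).
  have := is_deriveM (is_derive_expRM rho s) (pd s); rewrite /GRing.scale/=.
  by move=> /is_derive_eq; apply; ring.
have vd (s : R) : is_derive s 1 (fun s => G / rho * expR (rho * s)) (G * expR (rho * s)).
  have := is_deriveZ (G / rho) (is_derive_expRM rho s); rewrite /GRing.scale/=.
  by move=> /is_derive_eq; apply; field; rewrite gt_eqF.
have dom s : 0 < s -> s < t -> `|expR (rho * s) * g (x s)| <= G * expR (rho * s).
  move=> _ _; rewrite normrM ger0_norm ?expR_ge0// mulrC ler_wpM2r// expR_ge0.
have := dominated_increment t0 ud vd dom; rewrite mulr0 expR0 mul1r mulr1.
have G0 : 0 <= G by exact: le_trans (gG 0).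
have Gr : 0 <= G / rho by apply: divr_ge0 => //; exact: ltW.
have e1 : 1 <= expR (rho * t).
  by rewrite -expR0 ler_expR mulr_ge0// ltW.
move=> H.
have H2 : `|expR (rho * t) * p t| <= `|p 0| + G / rho * expR (rho * t).
  rewrite -[X in `|X|](subrK (p 0)); apply: le_trans (ler_normD _ _) _.
  rewrite addrC lerD2l; apply: le_trans H _; lra.
rewrite normrM ger0_norm ?expR_ge0// mulrC in H2.
rewrite -(ler_pM2r (expR_gt0 (rho * t))); apply: le_trans H2 _.
by rewrite mulrDl lerD2r ler_peMr.
Qed.

Lemma energy_derive (V x p : R -> R) (t : R) : orbit g rho x p ->
  is_derive (x t) 1 V (- g (x t)) ->
  is_derive t 1 (fun s => p s ^+ 2 / 2 + V (x s)) (- rho * p t ^+ 2).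
Proof.
move=> h Vd; have [xd pd] := h t.
have h1 := is_derive1_comp Vd xd.
rewrite (_ : (fun s => _) = (2^-1 \*: (p ^+ 2)) + (V \o x)); last first.
  by apply/funext => s; rewrite !fctE /GRing.scale/= mulrC.
have := is_deriveD (is_deriveZ 2^-1 (is_deriveX 2 pd)) h1.
by move=> /is_derive_eq; apply; rewrite /GRing.scale/= expr1; field.
Qed.

(** The energy decreases to a limit [Ei], which forces [p] to 0 and [V x] to [Ei]. Since [V] is
    constant on no interval, there are points arbitrarily close to the limit superior of [x] which
    [x] eventually never crosses, so that [x] itself converges. A nonzero force at the limit would
    keep [p] from tending to 0. *)
Lemma orbit_converges (G M : R) (x p : R -> R) :
  continuous g -> (forall y, `|g y| <= G) ->
  (forall u v, u < v -> exists y, [/\ u < y, y < v & g y != 0]) ->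
  orbit g rho x p -> (forall t, 0 <= t -> `|x t| <= M) ->
  exists c, [/\ g c = 0, x t @[t --> +oo] --> c & p t @[t --> +oo] --> 0].
Proof.
move=> gc gG gz h xM.
have [V0 [_ V0d]] := antiderivative gc.
pose V y := - V0 y.
have Vd (y : R) : is_derive y 1 V (- g y) by have := V0d y => ?; exact: is_deriveN.
have Vc : continuous V by move=> y; exact: is_derive_cts (Vd y).
pose E s := p s ^+ 2 / 2 + V (x s).
have Ed (s : R) : is_derive s 1 E (- rho * p s ^+ 2) by exact: energy_derive.
have Edec s t : s <= t -> E t <= E s.
  move=> st; rewrite -lerN2.
  apply: (nondecr_line st (fun u => is_deriveN (Ed u))) => u _ _.
  by rewrite mulNr opprK mulr_ge0 ?sqr_ge0// ltW.
have M0 : 0 <= M by exact: le_trans (xM 0 (lexx _)).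
have MM : - M <= M by lra.
have [y0 _ y0min] := EVT_min MM (continuous_subspaceT Vc).
have Elb t : 0 <= t -> V y0 <= E t.
  move=> t0; apply: (@le_trans _ _ (V (x t))).
    by apply: y0min; rewrite in_itv/= -ler_norml; exact: xM.
  by rewrite lerDr divr_ge0// sqr_ge0.
pose S := [set E t | t in [set t | 0 <= t]].
have Sinf : has_inf S.
  by split; [exists (E 0), 0 => //=|exists (V y0) => _ [t t0 <-]; exact: Elb].
pose Ei := inf S.
have EiE t : 0 <= t -> Ei <= E t.
  by move=> t0; apply: ge_inf; [case: Sinf|exists t].
have Econv e : 0 < e -> exists2 T, 0 <= T & forall t, T <= t -> E t < Ei + e.
  move=> e0; have [_ [T T0 <-] TE] := inf_adherent e0 Sinf.
  by exists T => // t Tt; apply: le_lt_trans TE; exact: Edec.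
pose B := rho * (`|p 0| + G / rho) + G + 1.
have G0 : 0 <= G by exact: le_trans (gG 0).
have B0 : 0 < B.
  have : 0 <= rho * (`|p 0| + G / rho).
    by apply: mulr_ge0; [exact: ltW|apply: addr_ge0 => //; apply: divr_ge0 => //; exact: ltW].
  rewrite /B; lra.
have pB t : 0 <= t -> `|- rho * p t + g (x t)| <= B.
  move=> t0; apply: le_trans (ler_normD _ _) _.
  rewrite normrM normrN (gtr0_norm rho0).
  have : rho * `|p t| <= rho * (`|p 0| + G / rho).
    by rewrite ler_pM2l//; exact: orbit_momentum_bounded gG h _ t0.
  by have := gG (x t); rewrite /B; lra.
have pinc s t : 0 <= s -> s <= t -> `|p t - p s| <= B * (t - s).
  move=> s0 st; rewrite mulrBr.
  apply: (@dominated_increment R p (fun t => - rho * p t + g (x t)) (fun t => B * t)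
     (fun=> B)) => //.
  - by move=> u; case: (h u).
  - move=> u; have := is_deriveZ B (is_derive_id u (1 : R)).
    by rewrite /GRing.scale/= mulr1.
  - by move=> u su _; apply: pB; lra.
(* a momentum of size [e] persists for a time [e / (2 B)] and costs a fixed
   amount of energy *)
have p_small e : 0 < e -> exists2 T, 0 <= T & forall t, T <= t -> `|p t| < e.
  move=> e0; pose tau := e / (2 * B).
  have tau0 : 0 < tau by rewrite divr_gt0// mulr_gt0.
  have cost0 : 0 < rho * (e / 2) ^+ 2 * tau.
    by apply: mulr_gt0 => //; apply: mulr_gt0 => //; apply: exprn_gt0; lra.
  have [T T0 hT] := Econv _ cost0; exists T => // t Tt.
  rewrite ltNge; apply/negP => et.
  have t0 : 0 <= t by exact: le_trans Tt.
  have pe s : t <= s -> s <= t + tau -> e / 2 <= `|p s|.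
    move=> ts st; have := pinc t s t0 ts.
    have : B * (s - t) <= B * tau by rewrite ler_pM2l//; lra.
    have -> : B * tau = e / 2 by rewrite /tau; field; rewrite gt_eqF.
    have := ler_normB (p s) (p s - p t); rewrite opprB addrC subrK; lra.
  have : rho * (e / 2) ^+ 2 * (t + tau) - rho * (e / 2) ^+ 2 * t <= E t - E (t + tau).
    rewrite -subr_ge0.
    have := @nondecr_line R (fun s => - E s - rho * (e / 2) ^+ 2 * s)
      (fun s => - (- rho * p s ^+ 2) - rho * (e / 2) ^+ 2) t (t + tau).
    have tt : t <= t + tau by lra.
    move=> /(_ tt) H; have : - E t - rho * (e / 2) ^+ 2 * t <=
        - E (t + tau) - rho * (e / 2) ^+ 2 * (t + tau); last lra.
    apply: H => s.
      have h1 := is_deriveZ (rho * (e / 2) ^+ 2) (is_derive_id s (1 : R)).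
      have := is_deriveB (is_deriveN (Ed s)) h1.
      by rewrite /GRing.scale/= mulr1.
    move=> ts st; rewrite mulNr opprK -mulrBr mulr_ge0 ?(ltW rho0)// subr_ge0.
    have e20 : 0 <= e / 2 by lra.
    by rewrite -(real_normK (num_real (p s))) ler_pXn2r ?nnegrE// pe// ltW.
  have := EiE (t + tau); have := hT t Tt.
  have -> : rho * (e / 2) ^+ 2 * (t + tau) - rho * (e / 2) ^+ 2 * t =
    rho * (e / 2) ^+ 2 * tau by ring.
  have tt : 0 <= t + tau by lra.
  by move=> ? /(_ tt); lra.
have VE e : 0 < e -> exists2 T, 0 <= T & forall t, T <= t -> `|V (x t) - Ei| < e.
  move=> e0; have e2 : 0 < e / 2 by lra.
  have [T1 T10 hT1] := Econv _ e2.
  have m0 : 0 < Num.min 1 e by rewrite lt_min e0 ltr01.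
  have [T2 T20 hT2] := p_small _ m0.
  exists (Num.max T1 T2); first by rewrite le_max T10.
  move=> t; rewrite ge_max => /andP[t1 t2].
  have := hT1 t t1; have := hT2 t t2; have := EiE t (le_trans T10 t1).
  rewrite lt_min => ? /andP[p1 pe] ?.
  have ps : p t ^+ 2 < e.
    rewrite -(real_normK (num_real (p t))) expr2.
    by apply: le_lt_trans pe; rewrite ler_piMr// ltW.
  have p0 := sqr_ge0 (p t).
  have EV : V (x t) = E t - p t ^+ 2 / 2 by rewrite /E; ring.
  by rewrite ltr_norml EV; apply/andP; split; lra.
(* A plateau of [V] would make [g] vanish on an interval. *)
have Vne u v : u < v -> exists y, [/\ u < y, y < v & V y != Ei].
  move=> uv; apply: contrapT => H; have [y [uy yv gy]] := gz u v uv.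
  have Vy z : u < z -> z < v -> V z = Ei.
    by move=> uz zv; apply: contrapT => /eqP hz; apply: H; exists z.
  have : \forall z \near y, cst Ei z = V z.
    near=> z; apply/esym/Vy; near: z.
      exact: (cvgr_gt y cvg_id _ uy).
    exact: (cvgr_lt y cvg_id _ yv).
  move=> /near_eq_is_derive/(_ (is_derive_cst Ei y (1 : R))) H0.
  have [_ H1] := H0; have [_ H2] := Vd y.
  by move/eqP: gy; apply; apply/oppr_inj; rewrite oppr0 -H2 H1.
have xc := orbit_continuous1 h.
have avoid y : V y != Ei -> exists2 T, 0 <= T & forall t, T <= t -> x t != y.
  move=> yE; have d0 : 0 < `|V y - Ei| by rewrite normr_gt0 subr_eq0.
  have [T T0 hT] := VE _ d0; exists T => // t Tt; apply/eqP => xy.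
  by have := hT t Tt; rewrite xy ltxx.
(* The supremum of [Z] is the limit superior of [x]. *)
pose Z := [set y | forall T, exists2 t, T <= t & y <= x t].
have ZM : ubound Z M.
  move=> y /(_ 0)[t t0 /le_trans]; apply.
  by apply: le_trans (ler_norm _) _; exact: xM.
have Zsup : has_sup Z.
  split; last by exists M.
  exists (- M) => T; exists (Num.max 0 T); first by rewrite le_max lexx orbT.
  by rewrite lerNl; apply: le_trans (ler_norm _) _; rewrite normrN xM// le_max lexx.
pose c := sup Z.
(* Late values of [x] lie below [y2]. Some late value exceeds [y1], which is no longer attained; by
   the intermediate value theorem all later ones exceed it too. *)
have x_lim e : 0 < e -> exists2 T, 0 <= T & forall t, T <= t -> `|x t - c| < e.
  move=> e0.
  have [|y1 [y1l y1r /avoid[T1 T10 hT1]]] := Vne (c - e) c; first lra.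
  have [|y2 [y2l y2r _]] := Vne c (c + e); first lra.
  have [y yZ y1y] : exists2 y, Z y & c - (c - y1) < y.
    by apply: sup_adherent => //; lra.
  have [T2 hT2] : exists T2, forall t, T2 <= t -> x t < y2.
    apply: contrapT => H.
    have : Z y2.
      move=> T; apply: contrapT => H'; apply: H; exists T => t Tt.
      by rewrite ltNge; apply/negP => ?; apply: H'; exists t.
    by move=> /(ub_le_sup (proj2 Zsup)); rewrite -/c leNgt y2l.
  have [t0 t0T yt0] := yZ (Num.max T1 T2).
  move: t0T; rewrite ge_max => /andP[t01 t02].
  exists t0; first exact: le_trans t01.
  move=> t t0t; rewrite ltr_norml.
  have xt2 : x t < y2 by apply: hT2; exact: le_trans t0t.
  suff xt1 : y1 < x t by apply/andP; split; lra.
  rewrite ltNge; apply/negP => xty.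
  have [||r rI xr] := @IVT R x t0 t y1 t0t.
  - exact: continuous_subspaceT.
  - by rewrite ge_min le_max xty orbT /=; apply/orP; left; lra.
  - move: rI; rewrite in_itv/= => /andP[t0r _].
    by have := hT1 r (le_trans t01 t0r); rewrite xr eqxx.
have x_cvg : x t @[t --> +oo] --> c.
  apply/cvgrPdist_lt => e e0; have [T _ hT] := x_lim e e0.
  by exists T; split; [exact: num_real|move=> t Tt; rewrite distrC hT// ltW].
have p_cvg : p t @[t --> +oo] --> 0.
  apply/cvgrPdist_lt => e e0; have [T _ hT] := p_small e e0.
  by exists T; split; [exact: num_real|move=> t Tt; rewrite sub0r normrN hT// ltW].
exists c; split => //; apply: contrapT => /eqP gc0.
(* If [g c] is not zero, then over a late unit of time [p] changes by [g c] up to an error [k],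
   although both end values are smaller than [k / 2]. *)
pose k := `|g c| / 2.
have k0 : 0 < k by rewrite divr_gt0// normr_gt0.
have k2 : 0 < k / 2 by lra.
have [T1 T10 hT1] : exists2 T, 0 <= T & forall t, T <= t -> `|g (x t) - g c| < k / 2.
  have : \forall y \near c, `|g c - g y| < k / 2.
    exact: (cvgr_dist_lt _ _ (gc c)).
  move=> /nbhs_ballP[d /= d0 hd].
  have [T T0 hT] := x_lim d d0; exists T => // t Tt; rewrite distrC; apply: hd.
  by rewrite /ball/= distrC hT.
have k3 : 0 < Num.min k (k / 2 / rho) / 2 by rewrite divr_gt0// lt_min k0 divr_gt0.
have [T2 T20 hT2] := p_small _ k3.
pose T := Num.max T1 T2.
have pT t : T <= t -> `|p t| < k / 2 /\ rho * `|p t| < k / 2.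
  rewrite ge_max => /andP[_ /hT2 ht]; split.
    apply: lt_le_trans ht _; rewrite ler_pM2r ?invr_gt0//.
    by rewrite ge_min lexx.
  rewrite mulrC -ltr_pdivlMr//; apply: lt_le_trans ht _.
  have : Num.min k (k / 2 / rho) <= k / 2 / rho by rewrite ge_min lexx orbT.
  have : 0 < k / 2 / rho by rewrite divr_gt0.
  lra.
have T_T1 : T <= T + 1 by lra.
suff : `|p (T + 1) - g c * (T + 1) - (p T - g c * T)| <= k * (T + 1) - k * T.
  have [h1 _] := pT T (lexx _); have [h2 _] := pT _ T_T1.
  have -> : p (T + 1) - g c * (T + 1) - (p T - g c * T) = p (T + 1) - p T - g c by ring.
  have -> : k * (T + 1) - k * T = k by ring.
  have := ler_normD (p (T + 1) - p T - g c) (- (p (T + 1) - p T)).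
  have := ler_normB (p (T + 1)) (p T).
  rewrite normrN (_ : _ + - (_ - _) = - g c); last by ring.
  have kE : `|g c| = k * 2 by rewrite /k; field.
  by rewrite normrN kE; lra.
apply: (@dominated_increment R (fun s => p s - g c * s)
  (fun s => - rho * p s + g (x s) - g c) (fun s => k * s) (fun=> k)) => //.
- move=> s; have [_ pd] := h s.
  have := is_deriveB pd (is_deriveZ (g c) (is_derive_id s (1 : R))).
  by rewrite /GRing.scale/= mulr1.
- move=> s; have := is_deriveZ k (is_derive_id s (1 : R)).
  by rewrite /GRing.scale/= mulr1.
- move=> s Ts _.
  have := hT1 s; rewrite (le_trans _ (ltW Ts)) ?le_max ?lexx// => /(_ isT) h1.
  have [_ h2] := pT s (ltW Ts).
  rewrite -addrA; apply: le_trans (ler_normD _ _) _.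
  by rewrite normrM normrN (gtr0_norm rho0); lra.
Unshelve. all: by end_near. Qed.

End Damped.

Lemma pinfty_frequently (R : realType) (P : R -> Prop) (T : R) :
  (\forall t \near +oo, P t) -> exists2 t, T <= t & P t.
Proof.
move=> [M [_ hM]]; exists (Num.max T (M + 1)); first by rewrite le_max lexx.
by apply: hM; rewrite lt_max ltrDl ltr01 orbT.
Qed.

(** * Trapping regions and motion near a hump *)

Section Traps.
Context {R : realType}.
Variables (g : R -> R) (rho : R).
Hypothesis rho0 : 0 < rho.

Lemma is_derive_affine (x : R -> R) (e c d t : R) : is_derive t 1 x d ->
  is_derive t 1 (fun s => e * (x s - c)) (e * d).
Proof.
move=> xd; have := is_deriveZ e (is_deriveB xd (is_derive_cst c t (1 : R))).
by rewrite /GRing.scale/= subr0.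
Qed.

(** The sign [e] is 1 for the ray at [b] and -1 for the ray at [a]. In the ray [e (x - c)] grows,
    and friction alone brings [e p] towards 0 no faster than [exp (- rho t)]. *)
Lemma ray_trap (e c : R) (x p : R -> R) : orbit g rho x p ->
  (forall y, 0 < e * (y - c) -> 0 < e * g y) ->
  0 < e * (x 0 - c) -> 0 < e * p 0 ->
  forall t, 0 <= t -> [/\ 0 < e * (x t - c), 0 < e * p t &
    e * (x 0 - c) <= e * (x t - c)].
Proof.
move=> h gP x0 p0 t t0.
have Xd (s : R) : is_derive s 1 (fun s => e * (x s - c)) (e * p s).
  by apply: is_derive_affine; case: (h s).
have Yd (s : R) : is_derive s 1 (fun s => e * (p s - 0)) (e * (- rho * p s + g (x s))).
  by apply: is_derive_affine; case: (h s).
rewrite -[p 0]subr0 in p0.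
have [||//] := quadrant_invariant (k := 0) (l := rho) Xd Yd x0 p0 _ _ t0.
- by move=> s s0 _; rewrite subr0 oppr0 mul0r => /ltW.
- by move=> s s0 /gP gs _; rewrite subr0; lra.
- by rewrite !subr0 oppr0 mul0r expR0 mulr1; split.
Qed.

(** Go back from [t] to the last time at which [e (x - c)] was at the level [m]. In between it
    exceeds [m >= 0], so outside the ray [e p <= 0] and it cannot have increased. The function [k]
    runs backwards in time, so that this last time becomes a first one. *)
Lemma ray_avoid_bound (e c : R) (x p : R -> R) (t : R) : orbit g rho x p ->
  0 <= t ->
  (forall s, 0 <= s -> s <= t -> ~ (0 < e * (x s - c) /\ 0 < e * p s)) ->
  e * (x t - c) <= Num.max 0 (e * (x 0 - c)).
Proof.
move=> h t0 av; set m := Num.max _ _; rewrite leNgt; apply/negP => mt.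
have Xd (s : R) : is_derive s 1 (fun s => e * (x s - c)) (e * p s).
  by apply: is_derive_affine; case: (h s).
have m0 : 0 <= m by rewrite le_max lexx.
pose k u := e * (x (t - u) - c) - m.
have kc : continuous k.
  move=> u; apply: cvgB; last exact: cvg_cst.
  apply: (@continuous_comp _ _ _ (fun u => t - u) (fun s => e * (x s - c))).
    by apply: cvgB; [exact: cvg_cst|exact: cvg_id].
  exact: is_derive_cts (Xd _).
have [||u [u0 ut ku pos]] := @ge0_first_exit R k t t0 kc.
- by rewrite /k subr0 subr_gt0.
- by rewrite /k subrr subr_le0 le_max lexx orbT.
have : - (e * (x (t - u) - c)) <= - (e * (x t - c)).
  have tu : t - u <= t by lra.
  apply: (nondecr_line tu (fun s => is_deriveN (Xd s))) => s s1 s2.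
  have := pos (t - s); rewrite /k opprB addrCA subrr addr0 => /(_ _ _)H.
  have xs : m < e * (x s - c) by rewrite -subr_gt0 H//; lra.
  rewrite oppr_ge0 leNgt; apply/negP => ps.
  by apply: (av s); [lra|lra|split => //; exact: le_lt_trans xs].
by move: ku mt; rewrite /k; lra.
Qed.

(** The energy never increases, and reaching [|x - c| = eps] would require at least [V c + m]. The
    relation between [V] and the force is asked near [c] only: [V] will be the potential of the
    untruncated force. *)
Lemma well_trap (V : R -> R) (c eps m : R) (x p : R -> R) :
  orbit g rho x p ->
  (forall y : R, `|y - c| <= eps -> is_derive y 1 V (- g y)) ->
  (forall y, `|y - c| = eps -> V c + m <= V y) ->
  `|x 0 - c| < eps -> p 0 ^+ 2 / 2 + V (x 0) < V c + m ->
  forall t, 0 <= t -> `|x t - c| < eps /\ p t ^+ 2 / 2 + V (x t) < V c + m.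
Proof.
move=> h Vd Vm x0 E0.
pose E s := p s ^+ 2 / 2 + V (x s).
have Edec t : 0 <= t -> (forall s, 0 <= s -> s <= t -> `|x s - c| <= eps) -> E t <= E 0.
  move=> t0 hx; rewrite -lerN2.
  have Ed (s : R) : 0 <= s -> s <= t -> is_derive s 1 E (- rho * p s ^+ 2).
    by move=> s0 st; apply: energy_derive => //; apply: Vd; exact: hx.
  apply: (@nondecr_ivl R (- E) (fun s => - (- rho * p s ^+ 2)) 0 t t0).
  - apply: cvg_at_right_filter; apply: is_derive_cts.
    by apply: is_deriveN; apply: Ed.
  - by move=> s /ltW s0 st; apply: is_deriveN; exact: Ed.
  - by move=> s _ _; rewrite mulNr opprK mulr_ge0 ?sqr_ge0// ltW.
have xc := orbit_continuous1 h.
have xin t : 0 <= t -> `|x t - c| < eps.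
  move=> t0; rewrite ltNge; apply/negP => xt.
  have kc : continuous (fun s => eps - `|x s - c|).
    move=> s; apply: cvgB; first exact: cvg_cst.
    by apply: cvg_norm; apply: cvgB; [exact: xc|exact: cvg_cst].
  have [||s [s0 st ks pos]] := @ge0_first_exit R _ t t0 kc.
  - by rewrite subr_gt0.
  - by rewrite subr_le0.
  have hx r : 0 <= r -> r <= s -> `|x r - c| <= eps.
    rewrite [r <= s]le_eqVlt => r0 /predU1P[->|rs]; first lra.
    by have := pos r r0 rs; lra.
  have := Edec s (ltW s0) hx; have xs : `|x s - c| = eps by lra.
  by have := Vm _ xs; have := sqr_ge0 (p s); rewrite /E; lra.
move=> t t0; split; first exact: xin.
apply: le_lt_trans E0; apply: Edec => // s s0 _; exact/ltW/xin.
Qed.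

Section Hump.
Variables (c eps : R).
Hypothesis g_right : forall y, c < y -> y <= c + eps -> 0 < g y.
Hypothesis g_left : forall y, c - eps <= y -> y < c -> g y < 0.
Hypothesis g_slope : forall y z, c - eps <= y -> y <= z -> z <= c + eps ->
  - (rho ^+ 2 / 8) * (z - y) <= g z - g y.

(* [rho (x - c) + p] has derivative [g x]: were it of the same sign as [x - c]
   at some time, it would move away from zero for ever. *)
Lemma hump_decay (x p : R -> R) : orbit g rho x p ->
  (forall t, 0 <= t -> `|x t - c| <= eps) ->
  x t @[t --> +oo] --> c -> p t @[t --> +oo] --> 0 ->
  forall t, 0 <= t -> `|x t - c| <= `|x 0 - c| * expR (- rho * t).
Proof.
move=> h xin xlim plim.
have wu t : 0 <= t -> (x t - c) * (rho * (x t - c) + p t) <= 0.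
  move=> t0; rewrite leNgt; apply/negP => pos.
  suff [e [e2 u0 w0]] : exists e, [/\ e ^+ 2 = 1, 0 < e * (x t - c) &
      0 < e * (rho * (x t - c) + p t)].
    have Xd (s : R) : is_derive s 1 (fun s => e * (x (t + s) - c)) (e * p (t + s)).
      by apply: is_derive_affine; case: (orbit_shift t h s).
    have Wd (s : R) : is_derive s 1 (fun s => e * (rho * (x (t + s) - c) + p (t + s) - 0))
        (e * g (x (t + s))).
      apply: (@is_derive_affine (fun s => rho * (x (t + s) - c) + p (t + s))).
      have [xd pd] := orbit_shift t h s.
      have := is_deriveD (is_derive_affine rho c xd) pd.
      by move=> /is_derive_eq; apply; ring.
    rewrite -{1}[t]addr0 in u0; rewrite -{1 2}[t]addr0 -[X in e * X]subr0 in w0.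
    have Q s : 0 <= s -> 0 < e * (x (t + s) - c) -> 0 <= e * g (x (t + s)).
      move=> s0 xs.
      have := xin (t + s) (addr_ge0 t0 s0); rewrite ler_norml => /andP[x1 x2].
      have /orP[/eqP ue|/eqP ue] : (e == 1) || (e == -1).
        by rewrite -eqf_sqr e2 expr1n.
      - rewrite ue !mul1r in xs *; apply: ltW; apply: g_right; lra.
      - rewrite ue !mulN1r in xs *; rewrite oppr_ge0; apply: ltW; apply: g_left; lra.
    have Y s : 0 <= s -> e * (rho * (x (t + 0) - c) + p (t + 0) - 0) <=
        e * (rho * (x (t + s) - c) + p (t + s) - 0).
      move=> s0.
      have [||_ _ _] := quadrant_invariant (k := rho) (l := 0) Xd Wd u0 w0 _ _ s0.
      - move=> r r0 _; rewrite subr0 => /ltW; lra.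
      - by move=> r r0 /(Q r r0) gr _; rewrite oppr0 mul0r.
      - by rewrite oppr0 mul0r expR0 mulr1.
    have Wlim : e * (rho * (x s - c) + p s) @[s --> +oo] --> e * (rho * (c - c) + 0).
      apply: cvgMr; apply: cvgD => //; apply: cvgMr; apply: cvgB => //.
      exact: cvg_cst.
    rewrite subrr mulr0 addr0 mulr0 in Wlim.
    have [s ts ws] := pinfty_frequently t (cvgr_lt _ Wlim _ w0).
    have := Y (s - t); rewrite subr_ge0 => /(_ ts).
    by rewrite (addrC t (s - t)) subrK [X in _ <= e * X]subr0 leNgt ws.
  move: pos; have [u0|u0|<-] := ltgtP 0 (x t - c); last by rewrite mul0r ltxx.
  - by rewrite pmulr_rgt0// => w0; exists 1; rewrite !mul1r expr1n.
  - by rewrite nmulr_rgt0// => w0; exists (-1); rewrite !mulN1r sqrrN expr1n !oppr_gt0.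
move=> t t0.
(* By [wu] the derivative of [D] is nonpositive. *)
pose D (s : R) := expR (2 * rho * s) * (x s - c) ^+ 2.
have Dd (s : R) : is_derive s 1 D
    (2 * expR (2 * rho * s) * ((x s - c) * (rho * (x s - c) + p s))).
  have [xd _] := h s.
  have h1 := is_deriveX 2 (is_deriveB xd (is_derive_cst c s (1 : R))).
  have := is_deriveM (is_derive_expRM (2 * rho) s) h1.
  move=> /is_derive_eq; apply; rewrite /GRing.scale/= !fctE expr1; ring.
have : - D 0 <= - D t.
  apply: (nondecr_line t0 (fun s => is_deriveN (Dd s))) => s s0 _.
  rewrite oppr_ge0 mulr_ge0_le0 ?wu ?(ltW s0)// mulr_ge0// expR_ge0.
rewrite lerN2 /D mulr0 expR0 mul1r => D0.
rewrite -(@ler_pXn2r _ 2)// ?nnegrE ?mulr_ge0 ?expR_ge0//.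
rewrite exprMn !(real_normK (num_real _)) -expRM_natl.
rewrite (_ : 2 * (- rho * t) = - (2 * rho * t)); last by ring.
by rewrite expRN ler_pdivlMr ?expR_gt0// mulrC.
Qed.

Lemma hump_separation (x1 p1 x2 p2 : R -> R) :
  orbit g rho x1 p1 -> orbit g rho x2 p2 ->
  (forall t, 0 <= t -> `|x1 t - c| <= eps) ->
  (forall t, 0 <= t -> `|x2 t - c| <= eps) ->
  x1 t @[t --> +oo] --> c -> p1 t @[t --> +oo] --> 0 ->
  x2 t @[t --> +oo] --> c -> p2 t @[t --> +oo] --> 0 ->
  x1 0 < x2 0 -> p1 0 = p2 0 -> False.
Proof.
move=> h1 h2 in1 in2 xl1 pl1 xl2 pl2 x0 p0.
have d1 := hump_decay h1 in1 xl1 pl1; have d2 := hump_decay h2 in2 xl2 pl2.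
(* With [M = P + a X] one has [M' = - (rho - a) M + a (rho - a) X + (g x2 - g x1)]. Here
   [a (rho - a) = 3 rho ^ 2 / 16] outweighs the slope bound [rho ^ 2 / 8], so the quadrant [X > 0],
   [M > 0] is invariant. As [P 0 = 0], the start [M 0 = a X 0] lies in it. *)
pose a := rho / 4; have a0 : 0 < a by rewrite divr_gt0.
pose X s := x2 s - x1 s; pose P s := p2 s - p1 s.
have Xd (s : R) : is_derive s 1 X (P s).
  by have [? _] := h1 s; have [? _] := h2 s; exact: is_deriveB.
have Pd (s : R) : is_derive s 1 P (- rho * P s + (g (x2 s) - g (x1 s))).
  have [_ q1] := h1 s; have [_ q2] := h2 s.
  by have := is_deriveB q2 q1; move=> /is_derive_eq; apply; rewrite /P; ring.
have Md (s : R) : is_derive s 1 (fun s => P s + a * X s)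
    (- rho * P s + (g (x2 s) - g (x1 s)) + a * P s).
  by have := is_deriveD (Pd s) (is_deriveZ a (Xd s)).
have X0 : 0 < X 0 by rewrite subr_gt0.
have M0 : 0 < P 0 + a * X 0 by rewrite /P p0 subrr add0r mulr_gt0.
have XM t : 0 <= t -> X 0 * expR (- a * t) <= X t.
  move=> t0.
  have [||//] := quadrant_invariant (k := a) (l := rho - a) Xd Md X0 M0 _ _ t0.
  - move=> s _ _ Ms; lra.
  - move=> s s0 Xs _.
    have := in1 s s0; have := in2 s s0.
    rewrite !ler_norml => /andP[u1 u2] /andP[v1 v2].
    have xx : x1 s <= x2 s by move: Xs; rewrite /X; lra.
    have := @g_slope (x1 s) (x2 s); rewrite xx => /(_ _ isT _) sl.
    have : - (rho ^+ 2 / 8) * X s <= g (x2 s) - g (x1 s) by apply: sl; lra.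
    have : 0 <= rho ^+ 2 / 16 * X s.
      by rewrite mulr_ge0 ?(ltW Xs)// divr_ge0// sqr_ge0.
    rewrite /a; set gg := g (x2 s) - g (x1 s); set Y := X s; set Z := P s; nra.
pose K := `|x1 0 - c| + `|x2 0 - c|.
have K0 : 0 <= K by rewrite addr_ge0.
have XK t : 0 <= t -> X t <= K * expR (- rho * t).
  move=> t0; have := d1 t t0; have := d2 t t0; rewrite /K mulrDl.
  have := ler_norm (x2 t - c); have := ler_norm (- (x1 t - c)); rewrite normrN.
  by rewrite /X; lra.
have bnd t : 0 <= t -> X 0 * (1 + (rho - a) * t) <= K.
  move=> t0; have := le_trans (XM t t0) (XK t t0).
  rewrite -ler_pdivrMr ?expR_gt0// -mulrA -expRN -expRD.
  rewrite (_ : - a * t + _ = (rho - a) * t); last by ring.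
  by apply: le_trans; rewrite ler_pM2l// expR_ge1Dx.
have ra : 0 < rho - a by rewrite /a; move: rho0; lra.
(* At this time the lower bound in [bnd] equals [X 0 + K], which is more than [K]. *)
have t0 : 0 <= (K / X 0) / (rho - a) by rewrite !divr_ge0// ltW.
have := bnd _ t0.
have -> : X 0 * (1 + (rho - a) * (K / X 0 / (rho - a))) = X 0 + K.
  by field; rewrite !gt_eqF.
lra.
Qed.

End Hump.
End Traps.

(** * Points staying near a hump *)

HB.instance Definition _ (R : realType) :=
  Pointed.copy (R * R)%type (R * R)%type.

(** Baire's theorem is applied in the plane, whose completeness is checked coordinate by
    coordinate. *)
Lemma plane_complete (R : realType) (F : set_system (R * R)) :
  ProperFilter F -> cauchy F -> cvg F.
Proof.
move=> FF /cauchyP Fc.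
have c1 : cvg (fst @ F).
  have FP : ProperFilter (fst @ F) by exact: fmap_proper_filter.
  apply: cauchy_cvg; apply/cauchyP => e e0; have [[a b] Fab] := Fc e e0.
  have h x : ball (a, b) e x -> ball a e x.1 by case.
  by exists a; exact: filterS h Fab.
have c2 : cvg (snd @ F).
  have FP : ProperFilter (snd @ F) by exact: fmap_proper_filter.
  apply: cauchy_cvg; apply/cauchyP => e e0; have [[a b] Fab] := Fc e e0.
  have h x : ball (a, b) e x -> ball b e x.2 by case.
  by exists b; exact: filterS h Fab.
move: c1 c2 => /cvg_ex[a ha] /cvg_ex[b hb]; apply/cvg_ex; exists (a, b).
move=> W [[A B] /= [nA nB] AB].
have : F ((fst @^-1` A) `&` (snd @^-1` B)) by apply: filterI; [exact: ha|exact: hb].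
by apply: filterS => x [? ?]; apply: AB.
Qed.

HB.instance Definition _ (R : realType) :=
  Uniform_isComplete.Build (R * R)%type (@plane_complete R).


Section HumpDensity.
Context {R : realType}.
Variables (g : R -> R) (rho l G : R).
Hypothesis rho0 : 0 < rho.
Hypothesis l0 : 0 < l.
Hypothesis gl : forall x y : R, `|g x - g y| <= l * `|x - y|.
Hypothesis gG : forall y, `|g y| <= G.
Hypothesis gz : forall u v, u < v -> exists y, [/\ u < y, y < v & g y != 0].

(** The third clause is an integrated form of [g' >= - rho ^ 2 / 8]. Asking for [g' >= 0] around [c]
    would be too much at a degenerate zero. *)
Definition hump (c eps : R) : Prop :=
  [/\ forall y, c < y -> y <= c + eps -> 0 < g y,
      forall y, c - eps <= y -> y < c -> g y < 0 &
      forall y z, c - eps <= y -> y <= z -> z <= c + eps ->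
        - (rho ^+ 2 / 8) * (z - y) <= g z - g y].

Lemma lipschitz_continuous : continuous g.
Proof.
move=> y; apply/cvgrPdist_lt => e e0.
have d0 : 0 < e / l by rewrite divr_gt0.
near=> z; apply: le_lt_trans (gl _ _) _.
rewrite mulrC -ltr_pdivlMr//; near: z.
Unshelve. all: by end_near. Qed.

(** A bounded orbit converges to a zero of [g], and the signs leave [c] as the only candidate in the
    closed interval. *)
Lemma orbit_in_hump_converges (c eps : R) (x p : R -> R) :
  hump c eps -> orbit g rho x p -> (forall t, 0 <= t -> `|x t - c| <= eps) ->
  x t @[t --> +oo] --> c /\ p t @[t --> +oo] --> 0.
Proof.
move=> [gr gl' _] h xin.
have xM t : 0 <= t -> `|x t| <= `|c| + eps.
  move=> t0; rewrite -[x t](subrK c) addrC.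
  by apply: le_trans (ler_normD _ _) _; rewrite lerD2l; exact: xin.
have [c' [gc' xl pl]] := orbit_converges rho0 lipschitz_continuous gG gz h xM.
suff cc : c' = c by rewrite -{1}cc.
have cin : `|c' - c| <= eps.
  rewrite leNgt; apply/negP => hc.
  have lim : `|x t - c| @[t --> +oo] --> `|c' - c|.
    by apply: cvg_norm; apply: cvgB => //; exact: cvg_cst.
  have [t t0] := pinfty_frequently 0 (cvgr_gt _ lim _ hc).
  by rewrite ltNge xin.
move: cin; rewrite ler_norml => /andP[c1 c2].
have [cc'|cc'|//] := ltgtP c c'.
- by have := gr c' cc'; rewrite gc' ltxx => /(_ _)H; suff: false by []; apply: H; lra.
- by have := gl' c'; rewrite gc' ltxx => H; suff: false by []; apply: H => //; lra.
Qed.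

Variables (Phi : R * R -> R -> R * R).
Hypothesis PhiP : is_flow g rho Phi.

Lemma flow_point_continuous t : continuous (fun z => Phi z t).
Proof.
move=> z; apply/cvgrPdist_lt => e e0.
have [d d0 hd] := flow_unif rho0 l0 gl PhiP `|t| e0.
near=> w; apply: hd => //; near: w.
Unshelve. all: by end_near. Qed.

Let stays (c eps T : R) :=
  [set z : R * R | forall t, T <= t -> `|(Phi z t).1 - c| <= eps].

Lemma open_leaves c eps T : open (~` stays c eps T).
Proof.
rewrite openE => z /= /existsNP[t /not_implyP[Tt /negP]]; rewrite -ltNge => zt.
have ct : `|(Phi w t).1 - c| @[w --> z] --> `|(Phi z t).1 - c|.
  apply: cvg_norm; apply: cvgB; last exact: cvg_cst.
  apply: (@continuous_comp _ _ _ (fun w => Phi w t) fst); last exact: cvg_fst.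
  exact: flow_point_continuous.
have H : \forall w \near z, eps < `|(Phi w t).1 - c| by exact: (cvgr_gt _ ct).
by apply: filterS H => w wt /(_ t Tt); rewrite leNgt wt.
Qed.

(** Were an open set to stay, its image at time [T] would contain two points with the same momentum
    and different positions, against [hump_separation]. Flowing back by [T] brings the shifted point
    into the open set. *)
Lemma dense_leaves c eps T : hump c eps -> dense (~` stays c eps T).
Proof.
move=> hc O [z Oz] oO; apply/set0P/eqP => Oh.
have OS w : O w -> stays c eps T w.
  move=> Ow; apply: contrapT => nS.
  by have : (O `&` ~` stays c eps T) w by []; rewrite Oh.
pose w := Phi z T.
have back : Phi w (- T) = z by rewrite (flowD rho0 l0 gl PhiP) subrr (flow0 PhiP).
have : \forall v \near w, O (Phi v (- T)).
  apply: flow_point_continuous; rewrite back; exact: open_nbhs_nbhs.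
move=> /nbhs_ballP[d /= d0 hd].
pose v : R * R := (w.1 + d / 2, w.2).
have Ov : O (Phi v (- T)).
  apply: hd; split; last exact: ballxx.
  by rewrite /ball/= opprD addrA subrr sub0r normrN gtr0_norm//; lra.
have vE t : Phi (Phi v (- T)) (T + t) = Phi v t.
  by rewrite (flowD rho0 l0 gl PhiP) addKr.
have wE t : Phi z (T + t) = Phi w t by rewrite (flowD rho0 l0 gl PhiP).
have in1 t : 0 <= t -> `|(Phi w t).1 - c| <= eps.
  by move=> t0; rewrite -wE; apply: OS => //; lra.
have in2 t : 0 <= t -> `|(Phi v t).1 - c| <= eps.
  by move=> t0; rewrite -vE; apply: OS => //; lra.
have h1 := flow_orbit PhiP w; have h2 := flow_orbit PhiP v.
have [xl1 pl1] := orbit_in_hump_converges hc h1 in1.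
have [xl2 pl2] := orbit_in_hump_converges hc h2 in2.
have [hr hl hs] := hc.
apply: (hump_separation rho0 hr hl hs h1 h2 in1 in2 xl1 pl1 xl2 pl2).
- by rewrite !(flow0 PhiP) /=; lra.
- by rewrite !(flow0 PhiP).
Qed.

Lemma avoid_humps_dense (n : nat) (c eps : 'I_n -> R) :
  (forall i, hump (c i) (eps i)) ->
  dense [set z | forall i T, exists2 t, T <= t & eps i < `|(Phi z t).1 - c i|].
Proof.
move=> hc.
(* The index [k] codes a hump and a natural waiting time, which makes the family countable; indices
   that code nothing give the whole plane. *)
pose F k : set (R * R) := if unpickle k is Some u then
  ~` stays (c (u : 'I_n * nat).1) (eps u.1) u.2%:R else setT.
have : dense (\bigcap_k F k).
  apply: Baire => k; rewrite /F; case: unpickle => [[i m]|].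
    by split; [exact: open_leaves|exact: dense_leaves].
  by split; [exact: openT|move=> O [z Oz] _; exists z].
move=> dF O O0 oO; have [z [Oz Fz]] := dF O O0 oO; exists z; split => // i T.
have := Fz (pickle (i, Num.bound `|T|)) I; rewrite /F pickleK /=.
move=> /existsNP[t /not_implyP[Tt /negP]]; rewrite -ltNge => zt.
exists t => //; apply: le_trans Tt; apply: le_trans (ler_norm T) _.
by apply: ltW; apply: archi_boundP.
Qed.

End HumpDensity.

(** * Simply connected sets *)

Section SimplyConnected.
Context {R : realType}.

(** Retraction of the line onto [[0, 1]]: composing with it turns continuity within the segment into
    continuity on the line. *)
Definition clamp01 (t : R) : R := Num.max 0 (Num.min 1 t).

Lemma clamp01_itv t : 0 <= clamp01 t <= 1.
Proof.
rewrite /clamp01 le_max lexx /= ge_max ler01 /=.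
by rewrite ge_min lexx.
Qed.

Lemma clamp01_id t : 0 <= t <= 1 -> clamp01 t = t.
Proof. by move=> /andP[t0 t1]; rewrite /clamp01 (min_idPr t1) (max_idPr t0). Qed.

Lemma clamp01_le0 t : t <= 0 -> clamp01 t = 0.
Proof.
move=> t0; rewrite /clamp01 (min_idPr _) ?(max_idPl _)//.
exact: le_trans t0 ler01.
Qed.

Lemma clamp01_ge1 t : 1 <= t -> clamp01 t = 1.
Proof. by move=> t1; rewrite /clamp01 (min_idPl t1) (max_idPr ler01). Qed.

Lemma clamp01K t : clamp01 (clamp01 t) = clamp01 t.
Proof. exact/clamp01_id/clamp01_itv. Qed.

Section Continuity.
Context {X : topologicalType}.
Implicit Types f h : X -> R.

Lemma continuous_fun_min f h : continuous f -> continuous h ->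
  continuous (fun x => Num.min (f x) (h x)).
Proof. by move=> fc hc x; apply: continuous_min; [exact: fc|exact: hc]. Qed.

Lemma continuous_fun_max f h : continuous f -> continuous h ->
  continuous (fun x => Num.max (f x) (h x)).
Proof. by move=> fc hc x; apply: continuous_max; [exact: fc|exact: hc]. Qed.

Lemma continuous_fun_clamp f : continuous f -> continuous (fun x => clamp01 (f x)).
Proof.
move=> fc; apply: continuous_fun_max; first exact: cst_continuous.
by apply: continuous_fun_min => //; exact: cst_continuous.
Qed.

Lemma continuous_fun_add f h : continuous f -> continuous h ->
  continuous (fun x => f x + h x).
Proof. by move=> fc hc x; apply: cvgD; [exact: fc|exact: hc]. Qed.

Lemma continuous_fun_sub f h : continuous f -> continuous h ->
  continuous (fun x => f x - h x).
Proof. by move=> fc hc x; apply: cvgB; [exact: fc|exact: hc]. Qed.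

Lemma continuous_fun_mul f h : continuous f -> continuous h ->
  continuous (fun x => f x * h x).
Proof. by move=> fc hc x; apply: cvgM; [exact: fc|exact: hc]. Qed.

Lemma continuous_fun_pair (Y Z : topologicalType) (f : X -> Y) (h : X -> Z) :
  continuous f -> continuous h -> continuous (fun x => (f x, h x)).
Proof. by move=> fc hc x; apply: cvg_pair; [exact: fc|exact: hc]. Qed.

Lemma continuous_fun_comp (Y Z : topologicalType) (f : X -> Y) (h : Y -> Z) :
  continuous f -> continuous h -> continuous (fun x => h (f x)).
Proof. by move=> fc hc x; apply: continuous_comp; [exact: fc|exact: hc]. Qed.

End Continuity.

Lemma fst_continuous (X Y : topologicalType) : continuous (@fst X Y).
Proof. by move=> [x y]; exact: cvg_fst. Qed.

Lemma snd_continuous (X Y : topologicalType) : continuous (@snd X Y).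
Proof. by move=> [x y]; exact: cvg_snd. Qed.

Lemma path_clamp_continuous (X : topologicalType) (g : R -> X) :
  {within `[0, 1], continuous g} -> continuous (fun t : R => g (clamp01 t)).
Proof.
move=> /subspace_continuousP gc t.
have c01 s : `[0, 1]%classic (clamp01 s) by rewrite /= in_itv/=; exact: clamp01_itv.
move=> W nW; have := gc _ (c01 t) W nW.
have cc : {for t, continuous clamp01}.
  by apply: continuous_fun_clamp => s; exact: cvg_id.
rewrite /= !nbhs_simpl /= => H; have := cc _ H.
by rewrite /= !nbhs_simpl /=; apply: filterS => s /(_ (c01 s)).
Qed.

Lemma simply_connected_homeo (X Y : topologicalType) (h : X -> Y) (k : Y -> X)
    (A : set Y) : continuous h -> continuous k -> cancel h k -> cancel k h ->
  simply_connected R A -> simply_connected R (h @^-1` A).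
Proof.
move=> hc kc hk kh [[a Aa] pc nh].
have comp (Z : topologicalType) (B : set Z) (X' Y' : topologicalType)
    (f : Z -> X') (j : X' -> Y') : continuous j ->
    {within B, continuous f} -> {within B, continuous (j \o f)}.
  by move=> jc fc z; apply: (@continuous_comp (subspace B) _ _ f j); [exact: fc|exact: jc].
split.
- by exists (k a); rewrite /= kh.
- move=> x y Ax Ay; have [g [gc g0 g1 gA]] := pc _ _ Ax Ay.
  exists (k \o g); split; first exact: comp.
  + by rewrite /= g0 hk.
  + by rewrite /= g1 hk.
  + by move=> t t01; rewrite /= kh; exact: gA.
- move=> g gc g01 gA.
  have [|||H [Hc HA H0 H1 Hs]] := nh (h \o g).
  + exact: comp.
  + by rewrite /= g01.
  + exact: gA.
  exists (k \o H); split; first exact: comp.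
  + by move=> s t s01 t01; rewrite /= kh; exact: HA.
  + by move=> t t01; rewrite /= H0//= hk.
  + by move=> t t01; rewrite /= H1//= hk.
  + by move=> s /Hs[h1 h2]; rewrite /= h1 h2 /= hk.
Qed.

Section Plane.
Variables (A : set (R * R)) (c : R * R).

(** The last clause makes a closed path contract through closed paths, with a base point free to
    move. Allowing paths that are not closed, constant ones in particular, yields path connectedness
    as well. *)
Definition contracts_paths : Prop := forall g : R -> R * R,
  continuous g -> (forall t, g (clamp01 t) = g t) -> (forall t, A (g t)) ->
  exists G : R * R -> R * R,
    [/\ continuous G, forall z, A (G z), forall t, G (0, t) = g t,
        forall t, G (1, t) = c &
        forall t t', g t = g t' -> forall s, G (s, t) = G (s, t')].

Lemma contracts_paths_path_connected : contracts_paths -> path_connected R A.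
Proof.
move=> cp.
have rad a : A a -> exists r : R -> R * R,
    [/\ continuous r, forall t, A (r t), r 0 = a & r 1 = c].
  move=> Aa; have [||//|G [Gc GA G0 G1 _]] := cp (cst a).
  - exact: cst_continuous.
  - by [].
  exists (fun s => G (s, 0)); split => //.
  apply: (@continuous_fun_comp _ _ _ (fun s => (s, 0)) G) => //.
  by apply: continuous_fun_pair; [move=> s; exact: cvg_id|exact: cst_continuous].
move=> a b Aa Ab; have [r [rc rA r0 r1]] := rad a Aa.
have [q [qc qA q0 q1]] := rad b Ab.
(* Concatenation of [r] and the reverse of [q] in one formula: on each half of [[0, 1]] one of the
   two terms equals [c] and cancels. *)
exists (fun t : R => r (clamp01 (2 * t)) + q (clamp01 (2 - 2 * t)) - c); split.
- have m : continuous (fun t : R => 2 * t).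
    by apply: continuous_fun_mul; [exact: cst_continuous|move=> s; exact: cvg_id].
  have rc' : continuous (fun t : R => r (clamp01 (2 * t))).
    apply: (@continuous_fun_comp _ _ _ (fun t : R => clamp01 (2 * t)) r) => //.
    exact: continuous_fun_clamp.
  have qc' : continuous (fun t : R => q (clamp01 (2 - 2 * t))).
    apply: (@continuous_fun_comp _ _ _ (fun t : R => clamp01 (2 - 2 * t)) q) => //.
    by apply: continuous_fun_clamp; apply: continuous_fun_sub => //; exact: cst_continuous.
  apply: continuous_subspaceT => t; apply: cvgB; last exact: cvg_cst.
  by apply: cvgD; [exact: rc'|exact: qc'].
- by rewrite mulr0 subr0 clamp01_le0// clamp01_ge1 ?ler1n// q1 addrK.
- by rewrite mulr1 subrr clamp01_ge1 ?ler1n// clamp01_le0// r1 addrC addKr.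
- move=> t _; have [t2|t2] := leP (2 * t) 1.
    by rewrite [clamp01 (2 - _)]clamp01_ge1 ?q1 ?addrK//; lra.
  by rewrite clamp01_ge1 ?r1 1?addrC ?addKr//; lra.
Qed.

(* Free contraction [G] of a loop to [c], turned into a homotopy fixing the base
   point: at time [s <= 1/2] run along the track [G (., 0)] of the base point up
   to level [2 s], then along the loop [G (2 s, .)], and back; at [s = 1/2] the
   middle part is constant, and the track can be pulled back. *)
Lemma contracts_paths_null_homotopic : contracts_paths -> forall g : R -> R * R,
  {within `[0, 1], continuous g} -> g 0 = g 1 ->
  (forall t, 0 <= t <= 1 -> A (g t)) -> null_homotopic_in A g.
Proof.
move=> cp g gc g01 gA.
have [|||G [Gc GA G0 G1 Gg]] := cp (fun t : R => g (clamp01 t)).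
- exact: path_clamp_continuous.
- by move=> t; rewrite clamp01K.
- by move=> t; apply: gA; exact: clamp01_itv.
have c0 : clamp01 0 = 0 by rewrite clamp01_le0.
have c1 : clamp01 1 = 1 by rewrite clamp01_ge1.
have G01 s : G (s, 1) = G (s, 0) by apply: Gg; rewrite c0 c1.
have G00 : G (0, 0) = g 0 by rewrite G0 c0.
(* [u] is time rescaled to the length [1 + 4 s] of the itinerary: [2 s] along the track, 1 around
   the loop, [2 s] back. The level [sg] rises, stays at [2 s] and falls accordingly. *)
pose u (z : R * R) := z.2 * (1 + 2 * (2 * z.1)).
pose sg (z : R * R) : R := Num.min (2 * z.1) (Num.min (u z) (1 + 2 * (2 * z.1) - u z)).
pose K1 (z : R * R) : R * R := G (sg z, clamp01 (u z - 2 * z.1)).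
(* Second half: the track is followed up to level [2 - 2 s] only. *)
pose K2 (z : R * R) : R * R := G (Num.min (2 - 2 * z.1) (sg (1/2, z.2)), 0).
have id1 : continuous (fun z : R * R => z.1) by exact: fst_continuous.
have id2 : continuous (fun z : R * R => z.2) by exact: snd_continuous.
have cstc (a : R) : continuous (fun _ : R * R => a) by exact: cst_continuous.
have d1 : continuous (fun z : R * R => 2 * z.1) by exact: continuous_fun_mul.
have d2 : continuous (fun z : R * R => 1 + 2 * (2 * z.1)).
  by apply: continuous_fun_add => //; exact: continuous_fun_mul.
have uc : continuous u by exact: continuous_fun_mul.
have sgc : continuous sg.
  apply: continuous_fun_min => //; apply: continuous_fun_min => //.
  exact: continuous_fun_sub.
have K1c : continuous K1.
  apply: continuous_fun_comp => //; apply: continuous_fun_pair => //.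
  by apply: continuous_fun_clamp; exact: continuous_fun_sub.
have half_c : continuous (fun z : R * R => (1/2 : R, z.2)) by exact: continuous_fun_pair.
have sg_half : continuous (fun z : R * R => sg (1/2, z.2)).
  exact: (@continuous_fun_comp (R * R)%type (R * R)%type R _ sg half_c sgc).
have K2c : continuous K2.
  apply: continuous_fun_comp => //; apply: continuous_fun_pair => //.
  by apply: continuous_fun_min => //; exact: continuous_fun_sub.
have K12 t : K1 (1/2, t) = K2 (1/2, t).
  rewrite /K1 /K2 /sg /u /=.
  have -> : 2 * (1 / 2) = 1 :> R by field.
  have -> : 2 - 1 = 1 :> R by ring.
  have -> : 1 + 2 * 1 = 3 :> R by ring.
  rewrite [in RHS]minA minxx.
  have [t1|t1] := leP (t * 3) 1; first by rewrite clamp01_le0//; lra.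
  have [t2|t2] := leP 2 (t * 3).
    by rewrite clamp01_ge1 ?G01//; lra.
  have -> : Num.min 1 (Num.min (t * 3) (3 - t * 3)) = 1.
    by apply/min_idPl; rewrite le_min; apply/andP; split; lra.
  by rewrite !G1.
(* Gluing in one formula: on either side of [s = 1/2] one of the first two terms cancels the common
   value at [1/2] by [K12], so continuity is immediate. *)
pose H (z : R * R) : R * R := K1 (Num.min z.1 (1/2), z.2) + K2 (Num.max z.1 (1/2), z.2) - K1 (1/2, z.2).
have Hl s t : s <= 1/2 -> H (s, t) = K1 (s, t).
  move=> s2; rewrite /H /= (min_idPl s2) (max_idPr s2) K12.
  by rewrite addrK.
have Hr s t : 1/2 <= s -> H (s, t) = K2 (s, t).
  move=> s2; rewrite /H /= (min_idPr s2) (max_idPl s2).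
  by rewrite addrC addKr.
have l2 : 0 <= 1/2 :> R by lra.
have r2 : 1/2 <= 1 :> R by lra.
exists H; split.
- have H1c : continuous (fun z : R * R => K1 (Num.min z.1 (1/2), z.2)).
    apply: (@continuous_fun_comp _ _ _ (fun z : R * R => (Num.min z.1 (1/2), z.2)) K1) => //.
    by apply: continuous_fun_pair => //; exact: continuous_fun_min.
  have H2c : continuous (fun z : R * R => K2 (Num.max z.1 (1/2), z.2)).
    apply: (@continuous_fun_comp _ _ _ (fun z : R * R => (Num.max z.1 (1/2), z.2)) K2) => //.
    by apply: continuous_fun_pair => //; exact: continuous_fun_max.
  have H3c : continuous (fun z : R * R => K1 (1/2, z.2)).
    exact: (@continuous_fun_comp _ _ _ _ K1 half_c K1c).
  apply: continuous_subspaceT => z; apply: cvgB; last exact: H3c.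
  by apply: cvgD; [exact: H1c|exact: H2c].
- by move=> s t _ _; have [s2|/ltW s2] := leP s (1/2); [rewrite Hl// /K1|rewrite Hr// /K2].
- move=> t /andP[t0 t1]; rewrite Hl// /K1 /sg /u /= !mulr0 addr0 mulr1 subr0.
  rewrite (_ : Num.min 0 _ = 0); last first.
    by apply/min_idPl; rewrite le_min t0 subr_ge0.
  by rewrite G0 !clamp01_id// t0.
- move=> t /andP[t0 t1]; rewrite Hr// /K2 /= mulr1 subrr.
  rewrite (_ : Num.min 0 _ = 0) ?G00//.
  apply/min_idPl; rewrite /sg /u /= !le_min.
  have -> : 2 * (1 / 2) = 1 :> R by field.
  by apply/and3P; split; lra.
- move=> s /andP[s0 s1]; have [s2|/ltW s2] := leP s (1/2).
    rewrite !Hl// /K1 /sg /u /= !mul0r !mul1r subr0 subrr sub0r; split.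
      rewrite (_ : Num.min (2 * s) _ = 0) ?clamp01_le0 ?G00//; first lra.
      rewrite (_ : Num.min 0 _ = 0); last by apply/min_idPl; lra.
      by apply/min_idPr; lra.
    rewrite (_ : Num.min (2 * s) _ = 0) ?clamp01_ge1 ?G01 ?G00//; first lra.
    rewrite (_ : Num.min _ 0 = 0); last by apply/min_idPr; lra.
    by apply/min_idPr; lra.
  rewrite !Hr// /K2 /sg /u /=.
  have -> : 2 * (1 / 2) = 1 :> R by field.
  have s3 : 0 <= 2 - 2 * s by lra.
  have e0 : Num.min 1 (Num.min (0 * (1 + 2 * 1)) (1 + 2 * 1 - 0 * (1 + 2 * 1))) = 0 :> R.
    have h3 : 0 <= 1 + 2 * 1 :> R by lra.
    rewrite mul0r subr0 (min_idPl h3).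
    exact: (min_idPr ler01).
  have e1 : Num.min 1 (Num.min (1 * (1 + 2 * 1)) (1 + 2 * 1 - 1 * (1 + 2 * 1))) = 0 :> R.
    have h3 : 0 <= 1 + 2 * 1 :> R by lra.
    rewrite mul1r subrr (min_idPr h3).
    exact: (min_idPr ler01).
  by rewrite e0 e1 (min_idPr s3) G00.
Qed.

Lemma contracts_paths_simply_connected :
  A c -> contracts_paths -> simply_connected R A.
Proof.
move=> Ac cp; split; first by exists c.
- exact: contracts_paths_path_connected.
- exact: contracts_paths_null_homotopic.
Qed.

(** For [s <= 1/2] the path is carried by [Psi] into [W]; afterwards it is shrunk linearly to [c]
    inside [W]. [Psi] and [T] may depend on the path, since the truncation level does. *)
Lemma star_trap_simply_connected (W : set (R * R)) :
  W c -> W `<=` A ->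
  (forall z k, W z -> 0 <= k <= 1 -> W (c + k *: (z - c))) ->
  (forall g : R -> R * R, continuous g -> (forall t, g (clamp01 t) = g t) ->
     (forall t, A (g t)) ->
   exists T (Psi : R * R -> R -> R * R),
     [/\ continuous (fun u : R * (R * R) => Psi u.2 u.1),
         0 <= T, forall z, Psi z 0 = z,
         forall s t, 0 <= s -> s <= T -> A (Psi (g t) s) &
         forall t, W (Psi (g t) T)]) ->
  simply_connected R A.
Proof.
move=> Wc WA star flow; apply: contracts_paths_simply_connected; first exact: WA.
move=> g gc gK gA; have [T [Psi [Pc T0 P0 PA PW]]] := flow g gc gK gA.
pose lam (s : R) := clamp01 (2 - 2 * s); pose tau (s : R) := T * clamp01 (2 * s).
exists (fun z => c + lam z.1 *: (Psi (g z.2) (tau z.1) - c)); split.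
- have id1 : continuous (fun z : R * R => z.1) by exact: fst_continuous.
  have cstc (a : R) : continuous (fun _ : R * R => a) by exact: cst_continuous.
  have d1 : continuous (fun z : R * R => 2 * z.1) by exact: continuous_fun_mul.
  have lc : continuous (fun z : R * R => lam z.1).
    by apply: continuous_fun_clamp; exact: continuous_fun_sub.
  have tc : continuous (fun z : R * R => tau z.1).
    by apply: continuous_fun_mul => //; exact: continuous_fun_clamp.
  have pc : continuous (fun z : R * R => Psi (g z.2) (tau z.1)).
    apply: (@continuous_fun_comp _ _ _ (fun z : R * R => (tau z.1, g z.2))
      (fun u : R * (R * R) => Psi u.2 u.1)) => //.
    apply: continuous_fun_pair => //.
    by apply: continuous_fun_comp => //; exact: snd_continuous.
  move=> z; apply: cvgD; first exact: cvg_cst.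
  apply: cvgZ; first exact: lc.
  by apply: cvgB; [exact: pc|exact: cvg_cst].
- move=> [s t] /=; have [s2|s2] := leP (2 * s) 1.
    rewrite /lam clamp01_ge1; last lra.
    rewrite scale1r addrC subrK; have /andP[k0 k1] := clamp01_itv (2 * s).
    by apply: PA; rewrite ?mulr_ge0// ler_piMr.
  apply: WA; apply: star; last exact: clamp01_itv.
  rewrite /tau clamp01_ge1; last exact: ltW.
  by rewrite mulr1.
- move=> t /=; rewrite /lam /tau mulr0 subr0 clamp01_ge1 ?ler1n// clamp01_le0//.
  by rewrite mulr0 P0 scale1r addrC subrK.
- by move=> t /=; rewrite /lam mulr1 subrr clamp01_le0// scale0r addr0.
- by move=> t t' /= gtt s; rewrite gtt.
Qed.

End Plane.
End SimplyConnected.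

(** * Attracting and repelling zeros *)

Section Signs.
Context {R : realType}.
Implicit Types (f g df dg : R -> R).

Definition clamp (lo hi x : R) : R := Num.max lo (Num.min hi x).

Lemma clamp_itv lo hi x : lo <= hi -> lo <= clamp lo hi x <= hi.
Proof. by move=> lh; rewrite /clamp le_max lexx ge_max lh ge_min lexx. Qed.

Lemma clamp_id lo hi x : lo <= x -> x <= hi -> clamp lo hi x = x.
Proof. by move=> lx xh; rewrite /clamp (min_idPr xh) (max_idPr lx). Qed.

Lemma clamp_contract lo hi x y : lo <= hi -> `|clamp lo hi x - clamp lo hi y| <= `|x - y|.
Proof.
move=> lh; rewrite /clamp.
wlog xy : x y / x <= y.
  move=> H; have [/H//|/ltW/H] := leP x y.
  by rewrite distrC (distrC y).
have [hx|xh] := leP hi x; have [hy|yh] := leP hi y; rewrite ?(max_idPr lh).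
- by rewrite subrr normr0.
- lra.
- by have [lx|xl] := leP lo x; rewrite !ler0_norm; lra.
- have [lx|xl] := leP lo x; have [ly|yl] := leP lo y; rewrite !ler0_norm; lra.
Qed.

Lemma clamp_lipschitz f df lo hi : lo <= hi ->
  (forall y : R, is_derive y 1 f (df y)) -> continuous df ->
  exists l G, [/\ 0 < l,
    forall x y, `|f (clamp lo hi x) - f (clamp lo hi y)| <= l * `|x - y| &
    forall x, `|f (clamp lo hi x)| <= G].
Proof.
move=> lh fd dfc.
have fc : continuous f by move=> y; exact: is_derive_cts (fd y).
have nc h : continuous h -> {within `[lo, hi], continuous (fun x => `|h x : R|)}.
  by move=> hc; apply: continuous_subspaceT => x; apply: cvg_norm; exact: hc.
have [m1 m1i hm1] := EVT_max lh (nc _ dfc).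
have [m2 m2i hm2] := EVT_max lh (nc _ fc).
exists (`|df m1| + 1), `|f m2|; split.
- by rewrite ltr_wpDl.
- move=> x y; apply: (@le_trans _ _ ((`|df m1| + 1) * `|clamp lo hi x - clamp lo hi y|)); last first.
    by rewrite ler_wpM2l ?addr_ge0// clamp_contract.
  have := clamp_itv x lh; have := clamp_itv y lh.
  set u := clamp lo hi x; set v := clamp lo hi y => /andP[v1 v2] /andP[u1 u2].
  wlog uv : u v u1 u2 v1 v2 / v <= u.
    move=> H; have [/H|/ltW/H] := leP v u; first exact.
    by rewrite distrC (distrC u); apply.
  have [z zuv ->] := MVT_segment uv (fun y _ => fd y) (continuous_subspaceT fc).
  rewrite normrM ler_wpM2r//; move: zuv; rewrite in_itv/= => /andP[vz zu].
  have := hm1 z; rewrite in_itv/= (le_trans v1 vz) (le_trans zu u2) => /(_ isT).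
  lra.
- by move=> x; apply: hm2; rewrite in_itv/= clamp_itv.
Qed.

Lemma sign_const f u v : u <= v -> continuous f ->
  (forall y, u <= y -> y <= v -> f y != 0) -> (0 < f u) = (0 < f v).
Proof.
move=> uv fc nz.
have fcw := continuous_subspaceT fc : {within `[u, v], continuous f}.
have fu := nz u (lexx u) uv; have fv := nz v uv (lexx v).
apply/idP/idP => h; rewrite ltNge; apply/negP => h'.
- have [|y yi fy] := @IVT R f u v 0 uv fcw; first by rewrite ge_min le_max h' (ltW h) !orbT.
  move: yi; rewrite in_itv/= => /andP[uy yv].
  by have := nz y uy yv; rewrite fy eqxx.
- have [|y yi fy] := @IVT R f u v 0 uv fcw; first by rewrite ge_min le_max h' (ltW h) !orbT.
  move: yi; rewrite in_itv/= => /andP[uy yv].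
  by have := nz y uy yv; rewrite fy eqxx.
Qed.

Definition isolated_zeros f : Prop := forall c : R, exists2 d, 0 < d &
  forall y, 0 < `|y - c| -> `|y - c| <= d -> f y != 0.

Lemma finite_zeros_isolated (m n : nat) (xs : 'I_m -> R) (xu : 'I_n -> R) f :
  (forall y, f y = 0 -> (exists i, xs i = y) \/ (exists j, xu j = y)) ->
  isolated_zeros f.
Proof.
move=> fz c.
have sep k (h : 'I_k -> R) : \forall d \near 0^'+, forall i, h i != c -> d < `|h i - c|.
  apply: filter_forall => i; have [->|hc] := eqVneq (h i) c.
    by near=> d.
  have : 0 < `|h i - c| by rewrite normr_gt0 subr_eq0.
  by move=> h0; near=> d => _; near: d; exact: nbhs_right_lt.
have : \forall d \near (0 : R)^'+, [/\ 0 < d, forall i, xs i != c -> d < `|xs i - c| &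
    forall i, xu i != c -> d < `|xu i - c|].
  near=> d; split; near: d; [exact: nbhs_right_gt|exact: sep|exact: sep].
move=> /filter_ex[d [d0 h1 h2]]; exists d => // y y0 yd; apply/eqP => /fz.
have yc : y != c by move: y0; rewrite normr_gt0 subr_eq0.
by case=> -[i hi]; subst y; [have := h1 i yc|have := h2 i yc]; rewrite ltNge yd.
Unshelve. all: by end_near. Qed.

(** A sign change rather than a sign of the derivative, so that degenerate zeros are covered. *)
Definition attracting f (c d : R) : Prop :=
  (forall y, c < y -> y <= c + d -> f y < 0) /\
  (forall y, c - d <= y -> y < c -> 0 < f y).

Definition repelling f (c d : R) : Prop :=
  (forall y, c < y -> y <= c + d -> 0 < f y) /\
  (forall y, c - d <= y -> y < c -> f y < 0).

(** [u] is the supremum of the points of the gap where [f < 0]. Beyond it [f >= 0], just before it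
    [f] takes negative values, and isolation of the zeros makes both signs strict and constant. *)
Lemma gap_repelling f y0 y1 : continuous f -> isolated_zeros f -> y0 < y1 ->
  f y0 < 0 -> 0 < f y1 ->
  exists u d, [/\ y0 < u, u < y1, f u = 0, 0 < d & repelling f u d].
Proof.
move=> fc iso y01 f0 f1.
pose S := [set y | [/\ y0 <= y, y <= y1 & f y < 0]].
have S0 : S y0 by split => //; exact: ltW.
have Sub : has_ubound S by exists y1 => y [].
have Ssup : has_sup S by split => //; exists y0.
pose u := sup S.
have y0u : y0 <= u by exact: ub_le_sup.
have uy1 : u <= y1 by apply: ge_sup; [exists y0|move=> y []].
have near_sup e : 0 < e -> exists2 y, S y & u - e < y.
  by move=> e0; exact: sup_adherent.
have fu_le : f u <= 0.
  rewrite leNgt; apply/negP => fu.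
  have : \forall y \near u, 0 < f y by exact: (cvgr_gt _ (fc u)).
  move=> /nbhs_ballP[e /= e0 he]; have [y Sy uy] := near_sup e e0.
  have yu : y <= u by exact: ub_le_sup.
  have : 0 < f y.
    by apply: he; rewrite /ball/= ltr_norml; apply/andP; split; lra.
  by case: Sy => _ _ fy; rewrite ltNge (ltW fy).
have uy1' : u < y1.
  by rewrite lt_neqAle uy1 andbT; apply/eqP => uE; move: fu_le; rewrite uE leNgt f1.
have right_ge y : u < y -> y <= y1 -> 0 <= f y.
  move=> uy yy1; rewrite leNgt; apply/negP => fy.
  have : y <= u by apply: ub_le_sup => //; split => //; lra.
  by rewrite leNgt uy.
have fu : f u = 0.
  apply/eqP; rewrite eq_le fu_le /= leNgt; apply/negP => fu.
  have : \forall y \near u, f y < 0 by exact: (cvgr_lt _ (fc u)).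
  move=> /nbhs_ballP[e /= e0 he].
  pose y := Num.min y1 (u + e / 2).
  have uy : u < y by rewrite lt_min uy1' /=; lra.
  have yy1 : y <= y1 by rewrite ge_min lexx.
  have := right_ge y uy yy1; rewrite leNgt => /negP; apply; apply: he.
  have ye : y <= u + e / 2 by rewrite ge_min lexx orbT.
  by rewrite /ball/= ltr_norml; apply/andP; split; lra.
have y0u' : y0 < u.
  by rewrite lt_neqAle y0u andbT; apply/eqP => uE; move: f0; rewrite uE fu ltxx.
have [d d0 hd] := iso u.
pose d' := Num.min d (y1 - u).
have d'0 : 0 < d' by rewrite lt_min d0 subr_gt0.
have d'd : d' <= d by rewrite ge_min lexx.
have d'1 : d' <= y1 - u by rewrite ge_min lexx orbT.
exists u, d'; split => //; split.
- move=> y uy yd; rewrite lt_neqAle eq_sym; apply/andP; split.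
    by apply: hd; rewrite gtr0_norm ?subr_gt0//; lra.
  by apply: right_ge => //; lra.
- have nz y : u - d' <= y -> y < u -> f y != 0.
    by move=> dy yu; apply: hd; rewrite ltr0_norm ?subr_lt0//; lra.
  have [z [z1 z2 fz] zu] := near_sup d' d'0.
  have zu' : z < u.
    have : z <= u by exact: ub_le_sup.
    rewrite le_eqVlt => /predU1P[zE|//]; by move: fz; rewrite zE fu ltxx.
  move=> y dy yu; rewrite ltNge le_eqVlt eq_sym (negbTE (nz y dy yu)) /=.
  have [yz|/ltW zy] := leP y z.
    rewrite (sign_const yz fc) -?leNgt ?(ltW fz)// => w w1 w2; apply: nz; lra.
  rewrite -(sign_const zy fc) -?leNgt ?(ltW fz)// => w w1 w2; apply: nz; lra.
Qed.

(* Solutions on one side of [c] are those of [r' = e f (c + e r)], [r > 0]. *)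
Lemma lyapunov_not_escaping f df (c e d : R) :
  (forall y : R, is_derive y 1 f (df y)) -> continuous df ->
  lyapunov_stable f c -> e ^+ 2 = 1 -> 0 < d ->
  (forall r, 0 < r -> r <= d -> 0 < e * f (c + e * r)) -> False.
Proof.
move=> fd dfc stab e2 d0 esc.
pose h r := e * f (c + e * r).
have hd (r : R) : is_derive r 1 h (df (c + e * r)).
  have ad : is_derive r 1 (fun r : R => c + e * r) e.
    have := is_deriveD (is_derive_cst c r (1 : R)) (is_deriveZ e (is_derive_id r (1 : R))).
    by rewrite add0r /GRing.scale/= mulr1.
  have := is_deriveZ e (@is_derive1_comp R f (fun r => c + e * r) r _ _ (fd (c + e * r)) ad).
  by move=> /is_derive_eq; apply; rewrite /GRing.scale/= mulrCA -expr2 e2 mulr1.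
have hc : continuous h by move=> r; exact: is_derive_cts (hd r).
have dhc : continuous (fun r => df (c + e * r)).
  move=> r; apply: (@continuous_comp _ _ _ (fun r : R => c + e * r) df); last exact: dfc.
  by apply: cvgD; [exact: cvg_cst|apply: cvgMr; exact: cvg_id].
have eps0 : 0 < d / 2 by lra.
have [del del0 hdel] := stab _ eps0.
(* Start within the stability radius for [eps = d / 2], and below [d / 2]. *)
pose r0 := Num.min (del / 2) (d / 4).
have r00 : 0 < r0 by rewrite lt_min; apply/andP; split; lra.
have r0del : r0 <= del / 2 by rewrite ge_min lexx.
have r0d : r0 <= d / 4 by rewrite ge_min lexx orbT.
have r0d' : r0 <= d by lra.
have [l [G [l0 hl _]]] := clamp_lipschitz r0d' hd dhc.
have hl1 (x y x' y' : R) : `|h (clamp r0 d x) - h (clamp r0 d x')| <= l * (`|x - x'| + `|y - y'|).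
  by apply: le_trans (hl _ _) _; rewrite ler_pM2l// lerDl.
have hl2 (x y x' y' : R) : `|(0 : R) - 0| <= l * (`|x - x'| + `|y - y'|).
  by rewrite subrr normr0 mulr_ge0 ?addr_ge0// ltW.
(* The planar existence theorem is used with a constant second component; clamping to [[r0, d]]
   makes the field globally Lipschitz and changes nothing until [r] reaches [d]. *)
have [r [_ [r0E _ rd _]]] := picard_lindelof (F1 := fun x _ => h (clamp r0 d x))
  (F2 := fun _ _ => 0) l0 hl1 hl2 r0 0.
have rc : continuous r by move=> t; exact: is_derive_cts (rd t).
(* The escape speed is at least the positive minimum of [h] on [[r0, d]], so [r] reaches [d],
   passing [d / 2] on its way, against stability. *)
have [m mi hm] := EVT_min r0d' (continuous_subspaceT hc).
have m0 : 0 < h m by apply: esc; move: mi; rewrite in_itv/= => /andP[]; lra.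
have rge s t : s <= t -> h m * (t - s) <= r t - r s.
  move=> st; rewrite -subr_ge0.
  have : r s - h m * s <= r t - h m * t.
    apply: (@nondecr_line R (fun s => r s - h m * s) (fun s => h (clamp r0 d (r s)) - h m)) => //.
      move=> u; have := is_deriveB (rd u) (is_deriveZ (h m) (is_derive_id u (1 : R))).
      by rewrite /GRing.scale/= mulr1.
    by move=> u _ _; rewrite subr_ge0; apply: hm; rewrite in_itv/=; exact: clamp_itv.
  by rewrite mulrBr; lra.
have rnd s t : s <= t -> r s <= r t.
  move=> st; have := rge s t st; have : 0 <= h m * (t - s).
    by apply: mulr_ge0; [exact: ltW|rewrite subr_ge0].
  lra.
have [t1 t10 rt1] : exists2 t1, 0 < t1 & r t1 = d.
  have T0 : 0 <= d / h m by apply: divr_ge0; exact: ltW.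
  have [|t ti rt] := @IVT R r 0 (d / h m) d T0 (continuous_subspaceT rc).
    have := rge _ _ T0; rewrite subr0 mulrC divfK ?gt_eqF// => H.
    by rewrite ge_min le_max r0E r0d' /=; apply/orP; right; lra.
  exists t => //; rewrite lt_neqAle; move: ti; rewrite in_itv/= => /andP[-> _].
  by rewrite andbT; apply/eqP => t0; move: rt; rewrite -t0 r0E; lra.
pose x t := c + e * r t.
have xabs t : 0 <= t -> `|x t - c| = r t.
  move=> t0; have := rnd 0 t t0; rewrite r0E => rt.
  rewrite /x addrC addKr normrM.
  have -> : `|e| = 1.
    by apply/eqP; rewrite -sqrp_eq1// real_normK ?num_real// e2.
  by rewrite mul1r ger0_norm//; lra.
have sol : is_solution f t1%:E x.
  split.
  - by rewrite lte_fin.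
  - apply: cvgD; first exact: cvg_cst.
    by apply: cvgMr; apply: cvg_at_right_filter; exact: rc.
  - move=> t t0; rewrite lte_fin => tt1.
    have := is_deriveD (is_derive_cst c t (1 : R)) (is_deriveZ e (rd t)).
    move=> /is_derive_eq; apply; rewrite add0r /GRing.scale/= clamp_id.
    + by rewrite /h mulrA -expr2 e2 mul1r.
    + by rewrite -r0E; apply: rnd; exact: ltW.
    + by rewrite -rt1; apply: rnd; exact: ltW.
have t10' := ltW t10.
have [|t ti rt] := @IVT R r 0 t1 (d / 2) t10' (continuous_subspaceT rc).
  by rewrite ge_min le_max r0E rt1; apply/andP; split; apply/orP; [left|right]; lra.
move: ti; rewrite in_itv/= => /andP[t0 tt1].
have tt1' : t < t1.
  by rewrite lt_neqAle tt1 andbT; apply/eqP => tE; move: rt; rewrite tE rt1; lra.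
have := hdel _ _ sol; rewrite xabs// r0E => /(_ _ t t0); rewrite lte_fin tt1' xabs// rt ltxx.
by move=> H; suff : false by []; apply: H; lra.
Qed.

(** Near [c] the sign of [f] is constant on each side, and an outward sign would let solutions
    escape. *)
Lemma lyapunov_attracting f df (c : R) :
  (forall y : R, is_derive y 1 f (df y)) -> continuous df ->
  isolated_zeros f -> lyapunov_stable f c ->
  exists2 d, 0 < d & attracting f c d.
Proof.
move=> fd dfc iso stab; have [d d0 hd] := iso c.
have fc : continuous f by move=> y; exact: is_derive_cts (fd y).
exists d => //; split.
- have nz y : c < y -> y <= c + d -> f y != 0.
    by move=> cy yd; apply: hd; rewrite gtr0_norm ?subr_gt0//; lra.
  move=> y cy yd; rewrite ltNge le_eqVlt eq_sym (negbTE (nz y cy yd)) /=; apply/negP => fy.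
  apply: (lyapunov_not_escaping fd dfc stab (e := 1) (expr1n _ _) d0) => r r0 rd.
  rewrite !mul1r; have [yr|/ltW ry] := leP y (c + r).
    by rewrite -(sign_const yr fc) => // z z1 z2; apply: nz; lra.
  by rewrite (sign_const ry fc) => // z z1 z2; apply: nz; lra.
- have nz y : c - d <= y -> y < c -> f y != 0.
    by move=> dy yc; apply: hd; rewrite ltr0_norm ?subr_lt0//; lra.
  move=> y dy yc; rewrite ltNge; apply/negP => fy.
  have e2 : (-1 : R) ^+ 2 = 1 by rewrite sqrrN expr1n.
  apply: (lyapunov_not_escaping fd dfc stab e2 d0) => r r0 rd.
  rewrite !mulN1r oppr_gt0 ltNge le_eqVlt eq_sym (negbTE (nz _ _ _)) /=; [|lra|lra].
  have [yr|/ltW ry] := leP y (c - r).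
    by rewrite -(sign_const yr fc) -?leNgt// => z z1 z2; apply: nz; lra.
  by rewrite (sign_const ry fc) -?leNgt// => z z1 z2; apply: nz; lra.
Qed.

(** A negative derivative at [c] would make [g] decrease through its zero; so [dg c >= 0], and
    continuity gives the slope bound nearby. *)
Lemma repelling_hump g dg (rho c d : R) : 0 < rho ->
  (forall y : R, is_derive y 1 g (dg y)) -> continuous dg -> g c = 0 ->
  0 < d -> repelling g c d -> exists2 eps, 0 < eps & hump g rho c eps.
Proof.
move=> rho0 gd dgc gc0 d0 [gr gl].
have dgc0 : 0 <= dg c.
  rewrite leNgt; apply/negP => dgc0.
  have : \forall y \near c, dg y < 0 by exact: (cvgr_lt _ (dgc c)).
  move=> /nbhs_ballP[e /= e0 he].
  pose r := Num.min d (e / 2).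
  have r0 : 0 < r by rewrite lt_min d0; lra.
  have rd : r <= d by rewrite ge_min lexx.
  have re : r <= e / 2 by rewrite ge_min lexx orbT.
  have cr : c <= c + r by lra.
  have : - g c <= - g (c + r).
    apply: (nondecr_line cr (fun s => is_deriveN (gd s))) => s s1 s2.
    rewrite oppr_ge0; apply/ltW/he.
    by rewrite /ball/= ltr_norml; apply/andP; split; lra.
  by have := gr (c + r); rewrite gc0 oppr0; lra.
have k0 : 0 < rho ^+ 2 / 8 by rewrite divr_gt0// exprn_gt0.
have kc : - (rho ^+ 2 / 8) < dg c by lra.
have : \forall y \near c, - (rho ^+ 2 / 8) < dg y by exact: (cvgr_gt _ (dgc c)).
move=> /nbhs_ballP[e /= e0 he].
pose r := Num.min d (e / 2).
have r0 : 0 < r by rewrite lt_min d0; lra.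
have rd : r <= d by rewrite ge_min lexx.
have re : r <= e / 2 by rewrite ge_min lexx orbT.
exists r => //; split.
- by move=> y cy yr; apply: gr => //; lra.
- by move=> y ry yc; apply: gl => //; lra.
- move=> y z ry yz zr; set k := rho ^+ 2 / 8 in k0 kc he *.
  have : g y + k * y <= g z + k * z.
    apply: (@nondecr_line R (fun s => g s + k * s) (fun s => dg s + k)) => // s.
      have := is_deriveD (gd s) (is_deriveZ k (is_derive_id s (1 : R))).
      by rewrite /GRing.scale/= mulr1.
    move=> s1 s2; have : - k < dg s; last lra.
    by apply: he; rewrite /ball/= ltr_norml; apply/andP; split; lra.
  by lra.
Qed.

(* There are only [N] unstable zeros for the [N] gaps between consecutive stable
   ones, and each gap contains a repelling zero. *)
Lemma unstable_repelling f (N : nat) (xs : 'I_N.+1 -> R) (xu : 'I_N -> R) :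
  continuous f -> isolated_zeros f -> injective xs ->
  (forall y, f y = 0 -> (exists i, xs i = y) \/ (exists j, xu j = y)) ->
  (forall i, exists2 d, 0 < d & attracting f (xs i) d) ->
  forall j, exists2 d, 0 < d & repelling f (xu j) d.
Proof.
move=> fc iso xs_inj fz att.
have not_both c d d' : 0 < d -> 0 < d' -> attracting f c d -> repelling f c d' -> False.
  move=> d0 d'0 [h1 _] [h2 _]; pose r := Num.min d d'.
  have r0 : 0 < r by rewrite lt_min d0.
  have rd : r <= d by rewrite ge_min lexx.
  have rd' : r <= d' by rewrite ge_min lexx orbT.
  have : f (c + r) < 0 by apply: h1; lra.
  have : 0 < f (c + r) by apply: h2; lra.
  lra.
pose im := [arg max_(i > ord0 : 'I_N.+1) xs i]%O.
have imP i : xs i <= xs im.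
  by rewrite /im; case: arg_maxP => // k _ /(_ i isT).
have next i : i != im -> exists j, [/\ exists2 d, 0 < d & repelling f (xu j) d,
    xs i < xu j & forall k, xs i < xs k -> xu j < xs k].
  move=> iim.
  have lim : xs i < xs im.
    by rewrite lt_neqAle imP andbT; apply: contra iim => /eqP/xs_inj ->.
  have [k ik kmin] : exists2 k, xs i < xs k & forall k', xs i < xs k' -> xs k <= xs k'.
    pose k := [arg min_(k < im | xs i < xs k) xs k]%O.
    by exists k; rewrite /k; case: arg_minP.
  have [d1 d10 [a1 _]] := att i; have [d2 d20 [_ a2]] := att k.
  (* Moving by at most a third of the gap from each end keeps [y0 < y1]. *)
  pose y0 := xs i + Num.min d1 ((xs k - xs i) / 3).
  pose y1 := xs k - Num.min d2 ((xs k - xs i) / 3).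
  have m1 : Num.min d1 ((xs k - xs i) / 3) <= d1 by rewrite ge_min lexx.
  have m2 : Num.min d2 ((xs k - xs i) / 3) <= d2 by rewrite ge_min lexx.
  have n1 : Num.min d1 ((xs k - xs i) / 3) <= (xs k - xs i) / 3 by rewrite ge_min lexx orbT.
  have n2 : Num.min d2 ((xs k - xs i) / 3) <= (xs k - xs i) / 3 by rewrite ge_min lexx orbT.
  have p1 : 0 < Num.min d1 ((xs k - xs i) / 3) by rewrite lt_min d10; lra.
  have p2 : 0 < Num.min d2 ((xs k - xs i) / 3) by rewrite lt_min d20; lra.
  have [|||u [d [y0u uy1 fu d0 rep]]] := @gap_repelling f y0 y1 fc iso.
  - by rewrite /y0 /y1; lra.
  - by apply: a1; rewrite /y0; lra.
  - by apply: a2; rewrite /y1; lra.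
  have [[i' ui]|[j uj]] := fz u fu.
    by have [d' d'0] := att i'; rewrite ui => att'; have := not_both _ _ _ d'0 d0 att' rep.
  exists j; rewrite uj; split; first by exists d.
    by move: y0u; rewrite /y0; lra.
  by move=> k' /kmin; move: uy1; rewrite /y1; lra.
have /choice[h hP] : forall i : {i | i != im}, exists j,
    [/\ exists2 d, 0 < d & repelling f (xu j) d,
    xs (val i) < xu j & forall k, xs (val i) < xs k -> xu j < xs k].
  by move=> [i ii]; exact: next.
(* The zero chosen for [i] lies before every stable zero to the right of [xs i], so different gaps
   give different zeros. Source and target both have [N] elements, so all unstable zeros are
   obtained. *)
have h_inj : injective h.
  have lt i i' : xs (val i) < xs (val i') -> h i != h i'.
    move=> ii; have [_ _ h1] := hP i; have [_ h2 _] := hP i'.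
    by apply/eqP => hh; have := lt_trans (h1 _ ii) h2; rewrite hh ltxx.
  move=> i i' hh; apply/val_inj/xs_inj.
  have [/lt|/lt|//] := ltgtP (xs (val i)) (xs (val i')); by rewrite hh eqxx.
move=> j.
have : j \in codom h.
  apply: inj_card_onto => //; rewrite card_ord card_sig.
  by have := cardC1 im; rewrite card_ord /= => c1; rewrite [X in (_ <= X)%N]c1.
by move=> /codomP[i ->]; have [] := hP i.
Qed.

End Signs.

(** * Truncated flows and their basins *)

Section Basins.
Context {R : realType}.
Variables (g dg : R -> R) (rho a b : R) (K0 : R).
Hypothesis rho0 : 0 < rho.
Hypothesis gd : forall y : R, is_derive y 1 g (dg y).
Hypothesis dgc : continuous dg.
Hypothesis iso : isolated_zeros g.
Hypothesis g_lo : forall y, y < a -> g y < 0.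
Hypothesis g_hi : forall y, b < y -> 0 < g y.
Hypothesis K0a : `|a| < K0.
Hypothesis K0b : `|b| < K0.

Definition truncation (K x : R) : R := g (clamp (- K) K x).

Let K0pos : 0 < K0. Proof. exact: le_lt_trans (normr_ge0 a) K0a. Qed.
Let aK K : K0 <= K -> - K < a /\ a < K.
Proof. by move=> K0K; have := lt_le_trans K0a K0K; rewrite ltr_norml => /andP. Qed.
Let bK K : K0 <= K -> - K < b /\ b < K.
Proof. by move=> K0K; have := lt_le_trans K0b K0K; rewrite ltr_norml => /andP. Qed.
Let NKK K : K0 <= K -> - K <= K.
Proof. by move=> K0K; have := lt_le_trans K0pos K0K; lra. Qed.

Lemma truncation_id K x : `|x| <= K -> truncation K x = g x.
Proof. by rewrite ler_norml => /andP[x1 x2]; rewrite /truncation clamp_id. Qed.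

Lemma truncation_tame K : K0 <= K -> exists l G, [/\ 0 < l,
  forall x y, `|truncation K x - truncation K y| <= l * `|x - y| &
  forall x, `|truncation K x| <= G].
Proof. by move=> K0K; exact: (clamp_lipschitz (NKK K0K) gd dgc). Qed.

Lemma truncation_lo K y : K0 <= K -> y < a -> truncation K y < 0.
Proof.
move=> K0K ya; apply: g_lo; have [aK1 aK2] := aK K0K.
by rewrite gt_max aK1 gt_min ya orbT.
Qed.

Lemma truncation_hi K y : K0 <= K -> b < y -> 0 < truncation K y.
Proof.
move=> K0K yb; apply: g_hi; have [bK1 bK2] := bK K0K.
by rewrite lt_max lt_min bK2 yb orbT.
Qed.

Lemma truncation_zero K y : K0 <= K -> truncation K y = 0 -> g y = 0 /\ `|y| < K.
Proof.
move=> K0K y0; have [a1 a2] := aK K0K; have [b1 b2] := bK K0K.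
have ya : a <= y by rewrite leNgt; apply/negP => /(truncation_lo K0K); rewrite y0 ltxx.
have yb : y <= b by rewrite leNgt; apply/negP => /(truncation_hi K0K); rewrite y0 ltxx.
have yK : `|y| < K by rewrite ltr_norml; apply/andP; split; lra.
by split => //; rewrite -y0 truncation_id// ltW.
Qed.

Lemma truncation_nonflat K u v : K0 <= K -> u < v ->
  exists y, [/\ u < y, y < v & truncation K y != 0].
Proof.
move=> K0K uv; have [d d0 hd] := iso u.
pose y := u + Num.min d ((v - u) / 2).
have m0 : 0 < Num.min d ((v - u) / 2) by rewrite lt_min d0; lra.
have m1 : Num.min d ((v - u) / 2) <= d by rewrite ge_min lexx.
have m2 : Num.min d ((v - u) / 2) <= (v - u) / 2 by rewrite ge_min lexx orbT.
exists y; split; rewrite /y; [lra|lra|].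
apply/eqP => /(truncation_zero K0K)[/eqP gy _]; move: gy; apply/negP/hd.
  by rewrite addrC addKr normr_gt0 gt_eqF.
by rewrite addrC addKr gtr0_norm.
Qed.

Lemma truncation_hump K c eps : hump g rho c eps -> `|c| + eps <= K ->
  hump (truncation K) rho c eps.
Proof.
move=> [h1 h2 h3] cK.
have inK y : c - eps <= y -> y <= c + eps -> truncation K y = g y.
  move=> y1 y2; apply: truncation_id; rewrite ler_norml.
  have := ler_norm c; have := ler_norm (- c); rewrite normrN => ? ?.
  by apply/andP; split; lra.
split.
- by move=> y cy yc; rewrite inK ?h1//; lra.
- by move=> y cy yc; rewrite inK ?h2//; lra.
- by move=> y z cy yz zc; rewrite !inK ?h3//; lra.
Qed.

Lemma hump_narrow c eps eps' : eps' <= eps -> hump g rho c eps -> hump g rho c eps'.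
Proof.
move=> e [h1 h2 h3]; split.
- by move=> y cy yc; apply: h1; lra.
- by move=> y cy yc; apply: h2; lra.
- by move=> y z cy yz zc; apply: h3; lra.
Qed.

Variable Phi : R -> R * R -> R -> R * R.
Hypothesis PhiP : forall K, K0 <= K -> is_flow (truncation K) rho (Phi K).

Lemma truncated_flow_agree K K' z t : K0 <= K -> K <= K' -> 0 <= t ->
  (forall s, 0 <= s -> s <= t -> `|(Phi K z s).1| <= K) ->
  Phi K' z t = Phi K z t.
Proof.
move=> K0K KK' t0 zK; have K0K' := le_trans K0K KK'.
have [l [G [l0 hl _]]] := truncation_tame K0K'.
have o1 := flow_orbit (PhiP K0K) z; have o2 := flow_orbit (PhiP K0K') z.
have rc (x p : R -> R) h : orbit h rho x p ->
    x s @[s --> 0^'+] --> x 0 /\ p s @[s --> 0^'+] --> p 0.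
  move=> o; split; apply: cvg_at_right_filter.
    exact: (orbit_continuous1 o).
  exact: (orbit_continuous2 o).
have [c1 c2] := rc _ _ _ o1; have [c3 c4] := rc _ _ _ o2.
have := orbit_gronwall rho0 l0 hl t0 c3 c4 c1 c2.
rewrite (flow0 (PhiP K0K)) (flow0 (PhiP K0K')) !subrr expr0n/= addr0 mulr0.
move=> /(_ (fun s _ _ => o2 s)) H.
apply/sqr_dist_le0/H => s s0 st; have [h1 h2] := o1 s; split => //.
have sK := zK s (ltW s0) st.
by rewrite truncation_id ?(le_trans sK)// -(truncation_id sK).
Qed.

(** Up to time [t] the orbit remains where the force is not modified, so this concerns the true
    dynamics. The strict bound makes the condition stable under small perturbations. *)
Definition reaches (W : set (R * R)) (K t : R) (z : R * R) : Prop :=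
  [/\ K0 <= K, 0 <= t, forall s, 0 <= s -> s <= t -> `|(Phi K z s).1| < K &
      W (Phi K z t)].

Definition basin (W : set (R * R)) : set (R * R) :=
  [set z | exists K t, reaches W K t z].

Definition forward_invariant (W : set (R * R)) : Prop :=
  forall K z t, K0 <= K -> W z -> 0 <= t -> W (Phi K z t).

Lemma reaches_mono W K K' t z : K <= K' -> reaches W K t z -> reaches W K' t z.
Proof.
move=> KK' [K0K t0 zK zW].
have agree s : 0 <= s -> s <= t -> Phi K' z s = Phi K z s.
  move=> s0 st; apply: truncated_flow_agree => // r r0 rs.
  by apply/ltW/zK => //; exact: le_trans st.
split => //; first exact: le_trans KK'.
  by move=> s s0 st; rewrite agree//; apply: lt_le_trans KK'; exact: zK.
by rewrite agree.
Qed.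

(** After [t] the orbit may leave [|x| < K], but [W] is invariant under every truncated flow. *)
Lemma reaches_later W K t z : forward_invariant W -> reaches W K t z ->
  forall s, t <= s -> W (Phi K z s).
Proof.
move=> inv [K0K t0 _ zW] s ts.
have [l [G [l0 hl _]]] := truncation_tame K0K.
have -> : s = t + (s - t) by ring.
by rewrite -(flowD rho0 l0 hl (PhiP K0K)); apply: inv => //; rewrite subr_ge0.
Qed.

(** At a common level and a common late time the same point of the orbit is in both sets; so
    disjoint traps have disjoint basins. *)
Lemma basin_meet W W' z : forward_invariant W -> forward_invariant W' ->
  basin W z -> basin W' z -> exists y, W y /\ W' y.
Proof.
move=> i i' [K [t r]] [K' [t' r']].
have KM : K <= Num.max K K' by rewrite le_max lexx.
have KM' : K' <= Num.max K K' by rewrite le_max lexx orbT.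
exists (Phi (Num.max K K') z (Num.max t t')); split.
- by apply: (reaches_later i (reaches_mono KM r)); rewrite le_max lexx.
- by apply: (reaches_later i' (reaches_mono KM' r')); rewrite le_max lexx orbT.
Qed.

Lemma sub_basin W : W `<=` basin W.
Proof.
move=> z Wz; pose K := Num.max K0 (`|z.1| + 1).
have K0K : K0 <= K by rewrite le_max lexx.
have z0 := flow0 (PhiP K0K) z.
exists K, 0; split => //; last by rewrite z0.
move=> s s0 s0'; have -> : s = 0 by apply/eqP; rewrite eq_le s0 s0'.
by rewrite z0 lt_max ltrDl ltr01 orbT.
Qed.

(** Neighbouring orbits stay within distance 1 up to time [t], whence the loss from [K] to
    [K + 1]. *)
Lemma reaches_near W K t z : open W -> reaches W K t z ->
  \forall w \near z, reaches W (K + 1) t w.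
Proof.
move=> oW r; have KK : K <= K + 1 by lra.
have [K0K1 t0 zK1 zW1] := reaches_mono KK r.
have zK s : 0 <= s -> s <= t -> `|(Phi (K + 1) z s).1| < K.
  move=> s0 st; case: r => K0K _ zK _.
  rewrite (truncated_flow_agree K0K KK s0) ?zK// => u u0 us.
  by apply/ltW/zK => //; exact: le_trans st.
have [l [G [l0 hl _]]] := truncation_tame K0K1.
have : \forall y \near Phi (K + 1) z t, W y by exact: open_nbhs_nbhs.
move=> /nbhs_ballP[e /= e0 he].
have m0 : 0 < Num.min 1 e by rewrite lt_min ltr01.
have [d d0 hd] := flow_unif rho0 l0 hl (PhiP K0K1) t m0.
have close w s : `|z - w| < d -> 0 <= s -> s <= t ->
    `|Phi (K + 1) z s - Phi (K + 1) w s| < 1 /\ `|Phi (K + 1) z s - Phi (K + 1) w s| < e.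
  move=> zw s0 st; have := hd z w s; rewrite ger0_norm// => /(_ st zw).
  by rewrite lt_min => /andP.
have nb : \forall w \near z, `|z - w| < d.
  by have := @nbhsx_ballx _ (R * R)%type z d d0; rewrite -ball_normE.
apply: filterS nb => w zw; split => //.
- move=> s s0 st; have [h1 _] := close w s zw s0 st.
  move: h1; rewrite prod_normE /= gt_max => /andP[h1 _].
  have := zK s s0 st; have := ler_normB (Phi (K + 1) z s).1
    ((Phi (K + 1) z s).1 - (Phi (K + 1) w s).1).
  by rewrite opprB addrC subrK; lra.
- apply: he; have [_ h2] := close w t zw t0 (lexx t).
  by rewrite -ball_normE.
Qed.

Lemma basin_simply_connected W c : open W -> forward_invariant W -> W c ->
  (forall z k, W z -> 0 <= k <= 1 -> W (c + k *: (z - c))) ->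
  simply_connected R (basin W).
Proof.
move=> oW inv Wc star.
apply: (star_trap_simply_connected Wc (@sub_basin W) star) => h hc hK hB.
(* By compactness of [[0, 1]], one [n] serves for the whole path, both as truncation level and as
   bound on the arrival time. *)
pose P (n : nat) (t : R) := exists2 s, s <= n%:R & reaches W n%:R s (h t).
have : \forall n \near \oo, forall t, `[0, 1]%classic t -> P n t.
  have := @segment_compact R 0 1 => /compact_near_coveringP; apply => t _.
  have [K [s r]] := hB t.
  have := hc t _ (reaches_near oW r) => nt.
  pose m := Num.bound (Num.max `|K + 1| `|s|).
  have mb : Num.max `|K + 1| `|s| < m%:R.
    by apply: archi_boundP; rewrite le_max normr_ge0.
  exists ([set u | reaches W (K + 1) s (h u)], [set n | (m <= n)%N]) => /=.
    by split => //; exists m.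
  move=> [u n] /= [ru mn].
  have mn' : m%:R <= n%:R :> R by rewrite ler_nat.
  move: mb; rewrite gt_max => /andP[mb1 mb2].
  exists s.
    by apply: le_trans mn'; apply: le_trans (ler_norm _) (ltW mb2).
  apply: reaches_mono ru; apply: le_trans mn'.
  by apply: le_trans (ler_norm _) (ltW mb1).
move=> /filter_ex[n hn].
have {}hn t : P n t.
  by rewrite /P -hK; apply: hn; rewrite /= in_itv/=; exact: clamp01_itv.
have [s0 _ [K0n _ _ _]] := hn 0.
have [l [G [l0 hl _]]] := truncation_tame K0n.
exists n%:R, (Phi n%:R); split => //.
- exact: (flow_continuous rho0 l0 hl (PhiP K0n)).
- exact: flow0 (PhiP K0n).
- move=> s t s_0 sn; have [t1 t1n r] := hn t.
  (* After the arrival time [t1] the orbit is in [W]; before it, the rest of the same orbit still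
     arrives, after a time [t1 - s]. *)
  have [ts|/ltW st] := leP t1 s.
    by apply: sub_basin; exact: (reaches_later inv r).
  exists n%:R, (t1 - s); case: r => _ t10 zK zW; split => //; first by rewrite subr_ge0.
    move=> u u0 ut; rewrite (flowD rho0 l0 hl (PhiP K0n)).
    by apply: zK; lra.
  by rewrite (flowD rho0 l0 hl (PhiP K0n)) addrC subrK.
- by move=> t; have [t1 t1n r] := hn t; exact: (reaches_later inv r).
Qed.

Definition ray (e c : R) : set (R * R) :=
  [set z | 0 < e * (z.1 - c) /\ 0 < e * z.2].

Lemma ray_truncation_sign (e c K y : R) : (e, c) = (-1, a) \/ (e, c) = (1, b) ->
  K0 <= K -> 0 < e * (y - c) -> 0 < e * truncation K y.
Proof.
move=> ec K0K; case: ec => -[-> ->]; rewrite ?mulN1r ?mul1r.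
- rewrite oppr_gt0 subr_lt0 oppr_gt0; exact: truncation_lo.
- rewrite subr_gt0; exact: truncation_hi.
Qed.

Lemma ray_forward_invariant e c : (e, c) = (-1, a) \/ (e, c) = (1, b) ->
  forward_invariant (ray e c).
Proof.
move=> ec K z t K0K [z1 z2] t0.
have z0 := flow0 (PhiP K0K) z.
have gP y : 0 < e * (y - c) -> 0 < e * truncation K y by exact: ray_truncation_sign.
have := ray_trap (flow_orbit (PhiP K0K) z) gP; rewrite z0 => H.
by have [h1 h2 _] := H z1 z2 t t0.
Qed.

Lemma open_ray e c : open (ray e c).
Proof.
have fc := @fst_continuous R R; have sc := @snd_continuous R R.
have cc (k : R) : continuous (fun _ : R * R => k) by exact: cst_continuous.
apply: openI; apply: open_comp (@open_gt R 0) => z _.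
- by apply: continuous_fun_mul => //; exact: continuous_fun_sub.
- by apply: continuous_fun_mul.
Qed.

Lemma zero_bounds y : g y = 0 -> [/\ a <= y, y <= b & `|y| < K0].
Proof.
move=> y0.
have ya : a <= y by rewrite leNgt; apply/negP => /g_lo; rewrite y0 ltxx.
have yb : y <= b by rewrite leNgt; apply/negP => /g_hi; rewrite y0 ltxx.
split => //; have [? ?] := aK (lexx K0); have [? ?] := bK (lexx K0).
by rewrite ltr_norml; apply/andP; split; lra.
Qed.

Section Well.
Variables (V : R -> R) (c d : R).
Hypothesis Vd : forall y : R, is_derive y 1 V (- g y).
Hypothesis att : attracting g c d.

(** A sublevel set of the energy can have several components; the bound on the position retains the
    one around [c]. *)
Definition well (eps m : R) : set (R * R) :=
  [set z | `|z.1 - c| < eps /\ z.2 ^+ 2 / 2 + V z.1 < V c + m].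

(** [V] is monotone on each side of [c] because the force points towards [c]. It need not be convex,
    but this suffices for the well to be star-shaped. *)
Lemma potential_unimodal u k : `|u| <= d -> 0 <= k <= 1 -> V (c + k * u) <= V (c + u).
Proof.
move=> ud /andP[k0 k1]; have [att1 att2] := att.
have [u0|u0] := leP 0 u.
- have ku : k * u <= u by rewrite ler_piMl.
  have ku0 : 0 <= k * u by rewrite mulr_ge0.
  have cu : c + k * u <= c + u by rewrite lerD2l.
  apply: (nondecr_line cu Vd) => s s1 s2; rewrite oppr_ge0; apply/ltW/att1; first lra.
  by move: ud; rewrite ger0_norm//; lra.
- have ku : u <= k * u by rewrite -lerN2 -mulrN ler_piMl// oppr_ge0 ltW.
  have ku0 : k * u <= 0 by rewrite mulr_ge0_le0// ltW.
  have cu : c + u <= c + k * u by rewrite lerD2l.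
  have : - V (c + u) <= - V (c + k * u); last by rewrite lerN2.
  apply: (nondecr_line cu (fun s => is_deriveN (Vd s))) => s s1 s2.
  rewrite opprK; apply/ltW/att2; last lra.
  by move: ud; rewrite ltr0_norm//; lra.
Qed.

Lemma potential_barrier eps : 0 < eps -> eps <= d ->
  exists2 m, 0 < m & forall y, `|y - c| = eps -> V c + m <= V y.
Proof.
move=> e0 ed; have [att1 att2] := att.
have Vc : continuous V by move=> y; exact: is_derive_cts (Vd y).
have c1 : c < c + eps by lra.
have c2 : c - eps < c by lra.
have [z1 z1i e1] := MVT c1 (fun y _ => Vd y) (continuous_subspaceT Vc).
have [z2 z2i e2] := MVT c2 (fun y _ => Vd y) (continuous_subspaceT Vc).
move: z1i z2i; rewrite !in_itv/= => /andP[z11 z12] /andP[z21 z22].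
have g1 : g z1 < 0 by apply: att1 => //; lra.
have g2 : 0 < g z2 by apply: att2 => //; lra.
have p1 : 0 < - g z1 * (c + eps - c) by apply: mulr_gt0; lra.
have p2 : 0 < g z2 * (c - (c - eps)) by apply: mulr_gt0; lra.
exists (Num.min (V (c + eps) - V c) (V (c - eps) - V c)).
  by rewrite lt_min; apply/andP; split; lra.
move=> y /eqP; rewrite eqr_norml => /andP[/orP[/eqP ye|/eqP ye] _].
- have -> : y = c + eps by lra.
  by rewrite -lerBrDl ge_min lexx.
- have -> : y = c - eps by lra.
  by rewrite -lerBrDl ge_min lexx orbT.
Qed.

Lemma open_well eps m : open (well eps m).
Proof.
have fc := @fst_continuous R R; have sc := @snd_continuous R R.
have cc (k : R) : continuous (fun _ : R * R => k) by exact: cst_continuous.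
have Vc : continuous V by move=> y; exact: is_derive_cts (Vd y).
have nc : continuous (fun z : R * R => `|z.1 - c|).
  by move=> z; apply: cvg_norm; apply: continuous_fun_sub.
have Ec : continuous (fun z : R * R => z.2 ^+ 2 / 2 + V z.1).
  apply: continuous_fun_add; last exact: (@continuous_fun_comp _ _ _ fst V).
  apply: continuous_fun_mul => //.
  exact: (@continuous_fun_mul _ _ (snd : R * R -> R) snd).
apply: openI.
- by apply: (open_comp _ (@open_lt R eps)) => z _; exact: nc.
- by apply: (open_comp _ (@open_lt R (V c + m))) => z _; exact: Ec.
Qed.

Hypothesis gc0 : g c = 0.
Variables (eps m : R).
Hypothesis eps0 : 0 < eps.
Hypothesis epsd : eps <= d.
Hypothesis epsa : a < c - eps.
Hypothesis epsb : c + eps < b.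
Hypothesis m0 : 0 < m.
Hypothesis barrier : forall y, `|y - c| = eps -> V c + m <= V y.

Lemma well_center : well eps m (c, 0).
Proof. by split; rewrite /= ?subrr ?normr0// expr0n/= mul0r add0r ltrDl. Qed.

Lemma well_star z k : well eps m z -> 0 <= k <= 1 ->
  well eps m ((c, 0) + k *: (z - (c, 0))).
Proof.
move=> [z1 z2] k01; have /andP[k0 k1] := k01.
have -> : (c, 0) + k *: (z - (c, 0)) = (c + k * (z.1 - c), k * z.2).
  by case: z {z1 z2} => x p; congr pair; rewrite /= ?subr0 ?add0r.
split => /=.
  rewrite addrC addKr normrM ger0_norm//; apply: le_lt_trans z1.
  by rewrite ler_piMl.
apply: le_lt_trans z2; apply: lerD.
  rewrite ler_pM2r ?invr_gt0// exprMn ler_piMl ?sqr_ge0//.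
  by rewrite expr_le1.
have : `|z.1 - c| <= d by exact: le_trans (ltW z1) epsd.
by move=> /potential_unimodal/(_ k01); rewrite [c + (z.1 - c)]addrC subrK.
Qed.

Lemma well_orbit K z : K0 <= K -> well eps m z -> forall t, 0 <= t ->
  well eps m (Phi K z t).
Proof.
move=> K0K [z1 z2] t t0.
have z0 := flow0 (PhiP K0K) z; have o := flow_orbit (PhiP K0K) z.
apply: (well_trap rho0 o _ barrier) => //; rewrite ?z0// => y yc.
rewrite truncation_id; first exact: Vd.
have [a1 _] := aK K0K; have [_ b2] := bK K0K.
move: yc; rewrite !ler_norml => /andP[y1 y2].
move: epsa epsb => ea eb; apply/andP; split; lra.
Qed.

Lemma well_in_band z : well eps m z -> [/\ a < z.1, z.1 < b, `|z.1 - c| <= d &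
  forall K, K0 <= K -> `|z.1| < K].
Proof.
move=> [z1 _]; have zd : `|z.1 - c| <= d by exact: le_trans (ltW z1) epsd.
move: epsa epsb z1 => ea eb; rewrite ltr_norml => /andP[z1 z2].
split => //; [lra|lra|] => K K0K; have [a1 _] := aK K0K; have [_ b2] := bK K0K.
by rewrite ltr_norml; apply/andP; split; lra.
Qed.

Lemma well_orbit_converges K z : K0 <= K -> well eps m z ->
  Phi K z t @[t --> +oo] --> (c, 0).
Proof.
move=> K0K Wz; have [l [G [l0 hl hG]]] := truncation_tame K0K.
have o := flow_orbit (PhiP K0K) z.
have xK t : 0 <= t -> `|(Phi K z t).1| <= K.
  by move=> t0; have [_ _ _ /(_ K K0K)/ltW] := well_in_band (well_orbit K0K Wz t0).
have [c' [gc' xl pl]] := orbit_converges rho0 (lipschitz_continuous l0 hl) hG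
  (fun u v => truncation_nonflat K0K) o xK.
suff cc : c' = c.
  rewrite -{1}cc [Phi K z](_ : _ = (fun s => ((Phi K z s).1, (Phi K z s).2))).
    exact: cvg_pair xl pl.
  by apply/funext => s; exact: surjective_pairing.
have cin : `|c' - c| <= d.
  rewrite leNgt; apply/negP => hc.
  have lim : `|(Phi K z t).1 - c| @[t --> +oo] --> `|c' - c|.
    by apply: cvg_norm; apply: cvgB => //; exact: cvg_cst.
  have [t t0] := pinfty_frequently 0 (cvgr_gt _ lim _ hc).
  by have [_ _ + _] := well_in_band (well_orbit K0K Wz t0); rewrite leNgt => /negP.
have [gc'0 _] := truncation_zero K0K gc'; have [att1 att2] := att.
move: cin; rewrite ler_norml => /andP[c1 c2].
have [cc'|cc'|//] := ltgtP c c'.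
- by have := att1 c' cc'; rewrite gc'0 ltxx => H; suff: false by []; apply: H; lra.
- by have := att2 c'; rewrite gc'0 ltxx => H; suff: false by []; apply: H => //; lra.
Qed.

End Well.

(** Neither neighbourhood contains the other zero, and a common point strictly between the zeros
    would feel forces of both signs. Hence wells are disjoint without being shrunk. *)
Lemma attracting_uniq c d c' d' x : attracting g c d -> attracting g c' d' ->
  g c = 0 -> g c' = 0 -> `|x - c| <= d -> `|x - c'| <= d' -> c = c'.
Proof.
wlog cc : c d c' d' / c <= c'.
  move=> H h h' g0 g0' xc xc'; have [cc|/ltW cc] := leP c c'.
    exact: (H c d c' d').
  by apply/esym; exact: (H c' d' c d).
move=> [h1 h2] [k1 k2] g0 g0'; rewrite !ler_norml => /andP[x1 x2] /andP[x3 x4].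
apply: contrapT => /eqP ne; have cc' : c < c' by rewrite lt_neqAle ne.
have [xc|cx] := leP x c.
  by have := k2 c; rewrite g0 ltxx => H; suff: false by []; apply: H => //; lra.
have [xc'|cx'] := leP c' x.
  by have := h1 c'; rewrite g0' ltxx => H; suff: false by []; apply: H => //; lra.
have : g x < 0 by apply: h1 => //; lra.
have : 0 < g x by apply: k2 => //; lra.
lra.
Qed.

(** Either the truncated orbit enters a ray, and it must be shown to do so before [|x|] reaches [K],
    or [ray_avoid_bound] bounds it by [M < K]. In the second case it converges to a zero of [g],
    which the last hypothesis prevents from being a hump. *)
Lemma orbit_fate (m n : nat) (cs : 'I_m -> R) (Ws : 'I_m -> set (R * R))
    (hs es : 'I_n -> R) K z :
  (forall y, g y = 0 -> (exists i, cs i = y) \/ (exists j, hs j = y)) ->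
  (forall i, open (Ws i)) -> (forall i, Ws i (cs i, 0)) ->
  (forall j, 0 < es j) -> K0 <= K -> `|z.1| < K ->
  (forall j T, exists2 t, T <= t & es j < `|(Phi K z t).1 - hs j|) ->
  [\/ basin (ray (-1) a) z, basin (ray 1 b) z | exists i, basin (Ws i) z].
Proof.
move=> gz oW Wc es0 K0K zK av.
have o := flow_orbit (PhiP K0K) z; have z0 := flow0 (PhiP K0K) z.
pose x t := (Phi K z t).1; pose p t := (Phi K z t).2.
have xc : continuous x by exact: (orbit_continuous1 o).
pose M := Num.max `|z.1| (Num.max `|a| `|b|).
have MK : M < K.
  by rewrite !gt_max zK (lt_le_trans K0a)// (lt_le_trans K0b).
have Mz : `|z.1| <= M by rewrite le_max lexx.
have Ma : `|a| <= M by rewrite !le_max lexx orbT.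
have Mb : `|b| <= M by rewrite !le_max lexx !orbT.
pose out t := ray (-1) a (Phi K z t) \/ ray 1 b (Phi K z t).
have bound t : 0 <= t -> (forall s, 0 <= s -> s <= t -> ~ out s) -> `|x t| <= M.
  move=> t0 no.
  have h1 := ray_avoid_bound (e := -1) (c := a) o t0
    (fun s s0 st h => no s s0 st (or_introl h)).
  have h2 := ray_avoid_bound (e := 1) (c := b) o t0
    (fun s s0 st h => no s s0 st (or_intror h)).
  rewrite z0 !mulN1r !opprB le_max -/(x t) in h1.
  rewrite z0 !mul1r le_max -/(x t) in h2.
  move: Mz Ma Mb; rewrite 4!ler_norml => /andP[? ?] /andP[? ?] /andP[? ?].
  by apply/andP; split; [case/orP: h1; lra|case/orP: h2; lra].
have [[t [t0 ot]]|never] := pselect (exists t, 0 <= t /\ out t).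
  have [s [s0 os sK]] : exists s, [/\ 0 <= s, out s &
      forall r, 0 <= r -> r <= s -> `|x r| < K].
    (* At the first time [s] with [|x| = K1] the bound [M] is already violated, and by continuity a
       little earlier; so a ray was entered before [s], while [|x|] was still below [K1]. *)
    pose K1 := (M + K) / 2.
    have K1K : K1 < K by rewrite /K1; lra.
    have MK1 : M < K1 by rewrite /K1; lra.
    have kc : continuous (fun s => K1 - `|x s|).
      by move=> s; apply: cvgB; [exact: cvg_cst|apply: cvg_norm; exact: xc].
    have [[u [u0 ut hu]]|small] :=
        pselect (exists u, [/\ 0 <= u, u <= t & K1 - `|x u| <= 0]); last first.
      exists t; split => // r r0 rt; rewrite ltNge; apply/negP => rK.
      by apply: small; exists r; split => //; lra.
    have k0 : 0 < K1 - `|x 0| by rewrite /x z0; lra.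
    have [s [s0 su ks pos]] := ge0_first_exit u0 kc k0 hu.
    apply: contrapT => H.
    have noout r : 0 <= r -> r < s -> ~ out r.
      move=> r0 rs or; apply: H; exists r; split => // q q0 qr.
      by have := pos q q0 (le_lt_trans qr rs); lra.
    have Ms : M < `|x s| by lra.
    have cs' : `|x u| @[u --> s] --> `|x s| by apply: cvg_norm; exact: xc.
    have : \forall u \near s, M < `|x u| by exact: (cvgr_gt _ cs').
    move=> /nbhs_ballP[e /= e0 he].
    pose r := Num.max 0 (s - e / 2).
    have r0 : 0 <= r by rewrite le_max lexx.
    have rs : r < s by rewrite gt_max s0 /=; lra.
    have re : s - e / 2 <= r by rewrite le_max lexx orbT.
    have : M < `|x r| by apply: he; rewrite /ball/= ltr_norml; apply/andP; split; lra.
    rewrite ltNge bound// => q q0 qr; apply: noout => //; exact: le_lt_trans qr rs.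
  by case: os => os; [apply: Or31|apply: Or32]; exists K, s; split.
have xM t : 0 <= t -> `|x t| <= M.
  by move=> t0; apply: bound => // s s0 _ os; apply: never; exists s.
have [l [G [l0 hl hG]]] := truncation_tame K0K.
have [c [gc xl pl]] := orbit_converges rho0 (lipschitz_continuous l0 hl) hG
  (fun u v => truncation_nonflat K0K) o xM.
have [gc0 _] := truncation_zero K0K gc.
have [[i ci]|[j cj]] := gz c gc0; last first.
  have : `|(Phi K z t).1 - hs j| @[t --> +oo] --> `|c - hs j|.
    by apply: cvg_norm; apply: cvgB => //; exact: cvg_cst.
  rewrite -cj subrr normr0 => lim.
  have : \forall t \near +oo, `|(Phi K z t).1 - hs j| < es j.
    exact: (cvgr_lt _ lim).
  move=> [T [_ hT]].
  have [t Tt] := av j (T + 1); rewrite ltNge ltW//; apply: hT; lra.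
apply: Or33; exists i.
have lim : Phi K z t @[t --> +oo] --> (cs i, 0 : R).
  rewrite ci [Phi K z](_ : _ = (fun s => ((Phi K z s).1, (Phi K z s).2))).
    exact: cvg_pair xl pl.
  by apply/funext => s; exact: surjective_pairing.
have : \forall t \near +oo, Ws i (Phi K z t).
  by apply: lim; apply: open_nbhs_nbhs.
move=> /(pinfty_frequently 0)[t t0 Wt].
exists K, t; split => // s s0 _; exact: le_lt_trans (xM s s0) MK.
Qed.

Lemma basins_dense (m n : nat) (cs : 'I_m -> R) (Ws : 'I_m -> set (R * R))
    (hs : 'I_n -> R) :
  (forall y, g y = 0 -> (exists i, cs i = y) \/ (exists j, hs j = y)) ->
  (forall i, open (Ws i)) -> (forall i, Ws i (cs i, 0)) ->
  (forall j, g (hs j) = 0) ->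
  (forall j, exists2 eps, 0 < eps & hump g rho (hs j) eps) ->
  dense (basin (ray (-1) a) `|` basin (ray 1 b) `|` \bigcup_i basin (Ws i)).
Proof.
move=> gz oW Wc hs0 hh O [z Oz] oO.
pose K := Num.max K0 (`|z.1| + 1).
have K0K : K0 <= K by rewrite le_max lexx.
have zK : `|z.1| + 1 <= K by rewrite le_max lexx orbT.
have [l [G [l0 hl hG]]] := truncation_tame K0K.
have /choice[es hes] : forall j, exists e, 0 < e /\ hump (truncation K) rho (hs j) e.
  move=> j; have [e e0 he] := hh j.
  have [_ _ hK] := zero_bounds (hs0 j).
  (* The hump is narrowed to fit in [[- K, K]], where the truncation does not alter [g]. *)
  exists (Num.min e (K - `|hs j|)); split; first by rewrite lt_min e0; lra.
  apply: truncation_hump.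
    by apply: hump_narrow he; rewrite ge_min lexx.
  have : Num.min e (K - `|hs j|) <= K - `|hs j| by rewrite ge_min lexx orbT.
  lra.
have av := avoid_humps_dense rho0 l0 hl hG (fun u v => truncation_nonflat K0K)
  (PhiP K0K) (fun j => (hes j).2).
have ob : open (O `&` [set w : R * R | `|w.1| < K]).
  apply: openI => //.
  apply: (open_comp _ (@open_lt R K)) => w _.
  by apply: cvg_norm; exact: fst_continuous.
have ne : (O `&` [set w : R * R | `|w.1| < K]) !=set0.
  by exists z; split => //=; lra.
have [w [[Ow wK] wav]] := av _ ne ob.
exists w; split => //.
have [h|h|[i h]] := orbit_fate gz oW Wc (fun j => (hes j).1) K0K wK wav.
- by left; left.
- by left; right.
- by right; exists i.
Qed.

End Basins.

(** * Solutions of the planar system *)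

Lemma is_derive1_cvg (R : realType) (V : normedModType R) (f : R -> V) (t : R) (v : V) :
  is_derive t 1 f v <->
  h^-1 *: (f (h *: (1 : R) + t) - f t) @[h --> 0^'] --> v.
Proof.
split; first by move=> [d e]; rewrite -e; exact: d.
by move=> h; split; [exact: cvgP h|exact: cvg_lim h].
Qed.

Lemma is_derive_pair (R : realType) (U V : normedModType R) (f : R -> U) (g : R -> V)
    (t : R) (u : U) (v : V) : is_derive t 1 f u -> is_derive t 1 g v ->
  is_derive t 1 (fun s => (f s, g s)) (u, v).
Proof. by rewrite !is_derive1_cvg => hf hg; exact: cvg_pair hf hg. Qed.

Lemma is_derive_fst (R : realType) (U V : normedModType R) (f : R -> U * V)
    (t : R) (w : U * V) : is_derive t 1 f w -> is_derive t 1 (fun s => (f s).1) w.1.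
Proof.
rewrite !is_derive1_cvg => h.
exact: (cvg_comp _ _ h (@fst_continuous U V w)).
Qed.

Lemma is_derive_snd (R : realType) (U V : normedModType R) (f : R -> U * V)
    (t : R) (w : U * V) : is_derive t 1 f w -> is_derive t 1 (fun s => (f s).2) w.2.
Proof.
rewrite !is_derive1_cvg => h.
exact: (cvg_comp _ _ h (@snd_continuous U V w)).
Qed.

(* Uniqueness lets the solutions from [z] be glued into a maximal one. *)
Lemma maximal_solution_exists (R : realType) (V : normedModType R) (F : V -> V)
    (z : V) :
  (exists T phi, is_solution F T phi /\ phi 0 = z) ->
  (forall T T' phi psi t, is_solution F T phi -> is_solution F T' psi ->
     phi 0 = z -> psi 0 = z -> 0 <= t -> (t%:E < T)%E -> (t%:E < T')%E ->
     phi t = psi t) ->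
  exists T phi, is_maximal_solution F z T phi.
Proof.
move=> [T0 [phi0 [sol0 phi00]]] uniq.
pose Ts := [set T | exists phi, is_solution F T phi /\ phi 0 = z].
have /choice[phi phiP] : forall t, exists v : V, forall T psi,
    is_solution F T psi -> psi 0 = z -> 0 <= t -> (t%:E < T)%E -> v = psi t.
  move=> t.
  have [[T [psi [sT pz t0 tT]]]|no] := pselect (exists T psi,
      [/\ is_solution F T psi, psi 0 = z, 0 <= t & (t%:E < T)%E]).
    by exists (psi t) => T' psi' sT' pz' _ tT'; exact: uniq sT sT' _ _ _ _ _.
  by exists z => T psi sT pz t0 tT; exfalso; apply: no; exists T, psi.
have T00 : (0 < T0)%E by case: sol0.
have T0sup : (T0 <= ereal_sup Ts)%E by apply: ereal_sup_ubound; exists phi0.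
exists (ereal_sup Ts), phi.
have p0 : phi 0 = z by rewrite (phiP 0 T0 phi0).
split => //; last first.
  by move=> T' psi sT' pz; apply: ereal_sup_ubound; exists psi.
split; first exact: lt_le_trans T0sup.
- have c0 : phi0 t @[t --> 0^'+] --> phi 0 by rewrite p0 -phi00; case: sol0.
  apply: cvg_trans c0; apply: near_eq_cvg.
  have [r r0 rT0] : exists2 r : R, 0 < r & (r%:E < T0)%E.
    move: T00; case: (T0) => [s| |//]; rewrite ?lte_fin => s0.
      by exists (s / 2); rewrite ?lte_fin; lra.
    by exists 1 => //; exact: ltry.
  near=> t; apply/esym/(phiP t T0 phi0) => //.
  by apply: lt_trans rT0; rewrite lte_fin; near: t; exact: nbhs_right_lt.
- move=> t t0 /ereal_sup_gt[T [psi [sT pz]] tT].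
  have [_ _ /(_ t t0 tT) psid] := sT.
  have pt : phi t = psi t by apply: (phiP t T) => //; exact: ltW.
  rewrite pt; apply: (near_eq_is_derive _ psid).
  have [r tr rT] : exists2 r : R, t < r & (r%:E < T)%E.
    move: tT; case: (T) => [s| |//]; rewrite ?lte_fin => ts.
      by exists ((t + s) / 2); rewrite ?lte_fin; lra.
    by exists (t + 1); [lra|exact: ltry].
  near=> s; apply: esym; apply: (phiP s T psi) => //.
  - by apply: ltW; near: s; exact: (cvgr_gt t cvg_id).
  - by apply: lt_trans rT; rewrite lte_fin; near: s; exact: (cvgr_lt t cvg_id).
Unshelve. all: by end_near. Qed.

(** * The planar system in the momentum coordinate *)

Section TrueFlow.
Context {R : realType}.
Variables (f : R -> R) (rho : R).
Hypothesis fd : forall y : R, is_derive y 1 f (derive1 f y).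

Definition to_momentum (z : R * R) : R * R := (z.1, f z.1 + z.2).
Definition of_momentum (z : R * R) : R * R := (z.1, z.2 - f z.1).

Lemma to_momentumK : cancel to_momentum of_momentum.
Proof. by case=> x q; rewrite /to_momentum /of_momentum /= addrC addKr. Qed.

Lemma of_momentumK : cancel of_momentum to_momentum.
Proof. by case=> x q; rewrite /to_momentum /of_momentum /= addrC subrK. Qed.

Let fc : continuous f. Proof. by move=> y; exact: is_derive_cts (fd y). Qed.

Lemma to_momentum_continuous : continuous to_momentum.
Proof.
have c1 := @fst_continuous R R; have c2 := @snd_continuous R R.
apply: continuous_fun_pair => //; apply: continuous_fun_add => //.
exact: (@continuous_fun_comp _ _ _ fst f).
Qed.

Lemma of_momentum_continuous : continuous of_momentum.
Proof.
have c1 := @fst_continuous R R; have c2 := @snd_continuous R R.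
apply: continuous_fun_pair => //; apply: continuous_fun_sub => //.
exact: (@continuous_fun_comp _ _ _ fst f).
Qed.

Definition force (x : R) : R := (rho + derive1 f x) * f x.

Let F := planar_field f rho.

(** With [p = x' = f x + q] one finds [p' = f' p - (rho + f') (p - f) = - rho p + (rho + f') f]. *)
Lemma solution_momentum (T : \bar R) (phi : R -> R * R) : is_solution F T phi ->
  let x t := (to_momentum (phi t)).1 in let p t := (to_momentum (phi t)).2 in
  [/\ x t @[t --> 0^'+] --> x 0, p t @[t --> 0^'+] --> p 0 &
    forall t : R, 0 < t -> (t%:E < T)%E ->
      is_derive t 1 x (p t) /\ is_derive t 1 p (- rho * p t + force (x t))].
Proof.
move=> [T0 c0 d0] x p.
have cc : to_momentum (phi t) @[t --> 0^'+] --> to_momentum (phi 0).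
  by apply: continuous_cvg c0; exact: to_momentum_continuous.
split.
- by apply: (continuous_cvg _ _ cc); exact: fst_continuous.
- by apply: (continuous_cvg _ _ cc); exact: snd_continuous.
- move=> t t0 tT; have d := d0 t t0 tT.
  have d1 := is_derive_fst d; have d2 := is_derive_snd d.
  split; first exact: d1.
  have d3 := @is_derive1_comp R f (fun s => (phi s).1) t _ _ (fd (phi t).1) d1.
  have := is_deriveD d3 d2; move=> /is_derive_eq; apply.
  by rewrite /x /p /= /force /=; ring.
Qed.

Lemma orbit_solution (g : R -> R) (x p : R -> R) (T : \bar R) : orbit g rho x p ->
  (0 < T)%E -> (forall t : R, 0 <= t -> (t%:E < T)%E -> g (x t) = force (x t)) ->
  is_solution F T (fun t => of_momentum (x t, p t)).
Proof.
move=> o T0 gE; split => //.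
- have cc : continuous (fun t => (x t, p t)).
    apply: continuous_fun_pair; [exact: (orbit_continuous1 o)|exact: (orbit_continuous2 o)].
  apply: cvg_at_right_filter.
  by apply: continuous_cvg (cc 0); exact: of_momentum_continuous.
- move=> t t0 tT; have [xd pd] := o t.
  have d3 := @is_derive1_comp R f x t _ _ (fd (x t)) xd.
  apply: is_derive_eq.
    exact: (is_derive_pair xd (is_deriveB pd d3)).
  rewrite gE ?ltW// /F /planar_field /of_momentum /= /force.
  by congr pair; ring.
Qed.

End TrueFlow.

(** * Truncated orbits and the true flow *)

Section FlowFate.
Context {R : realType}.
Variables (f : R -> R) (dg : R -> R) (rho a b K0 : R).
Hypothesis rho0 : 0 < rho.
Hypothesis fd : forall y : R, is_derive y 1 f (derive1 f y).
Let g := force f rho.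
Hypothesis gd : forall y : R, is_derive y 1 g (dg y).
Hypothesis dgc : continuous dg.
Hypothesis iso : isolated_zeros g.
Hypothesis g_lo : forall y, y < a -> g y < 0.
Hypothesis g_hi : forall y, b < y -> 0 < g y.
Hypothesis K0a : `|a| < K0.
Hypothesis K0b : `|b| < K0.
Variable Phi : R -> R * R -> R -> R * R.
Hypothesis PhiP : forall K, K0 <= K -> is_flow (truncation g K) rho (Phi K).

Let F := planar_field f rho.
Let tame := truncation_tame gd dgc K0a.

(** A solution may explode, but not on a compact part of its domain; the bound provides the
    truncation level for that part. *)
Lemma solution_bounded (T : \bar R) (phi : R -> R * R) (t : R) :
  is_solution F T phi -> 0 <= t -> (t%:E < T)%E ->
  exists M, forall s, 0 <= s -> s <= t -> `|(phi s).1| <= M.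
Proof.
move=> sol; rewrite le_eqVlt => /predU1P[<- _|t0 tT].
  exists `|(phi 0).1| => s s0 s0'; have -> // : s = 0.
  by apply/eqP; rewrite eq_le s0 s0'.
have [xc _ xd] := solution_momentum fd sol.
have dcts (s : R) : 0 < s -> s <= t -> {for s, continuous (fun s => (phi s).1)}.
  move=> s0 st; have sT : (s%:E < T)%E by apply: le_lt_trans tT; rewrite lee_fin.
  by have [h _] := xd s s0 sT; exact: is_derive_cts h.
have nc : {within `[0, t], continuous (fun s => `|(phi s).1|)}.
  apply/continuous_within_itvP => //; split.
  - move=> s; rewrite in_itv/= => /andP[s0 st]; apply: cvg_norm.
    exact: dcts (ltW st).
  - by apply: cvg_norm; exact: xc.
  - by apply: cvg_norm; apply: cvg_at_left_filter; exact: dcts.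
have [m mi hm] := EVT_max (ltW t0) nc.
exists `|(phi m).1| => s s0 st; apply: hm; by rewrite in_itv/= s0.
Qed.

Lemma solution_truncated (T : \bar R) (phi : R -> R * R) (t K : R) :
  is_solution F T phi -> 0 <= t -> (t%:E < T)%E -> K0 <= K ->
  (forall s, 0 <= s -> s <= t -> `|(phi s).1| <= K) ->
  to_momentum f (phi t) = Phi K (to_momentum f (phi 0)) t.
Proof.
move=> sol t0 tT K0K phiK.
have [l [G [l0 hl _]]] := tame K0K.
have [xc pc xpd] := solution_momentum fd sol.
set z := to_momentum f (phi 0).
have o := flow_orbit (PhiP K0K) z.
have c1 : (Phi K z s).1 @[s --> 0^'+] --> (Phi K z 0).1.
  by apply: cvg_at_right_filter; exact: (orbit_continuous1 o).
have c2 : (Phi K z s).2 @[s --> 0^'+] --> (Phi K z 0).2.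
  by apply: cvg_at_right_filter; exact: (orbit_continuous2 o).
have := orbit_gronwall rho0 l0 hl t0 xc pc c1 c2.
rewrite (flow0 (PhiP K0K)) /z !subrr expr0n addr0 mulr0 => H.
apply/sqr_dist_le0/(H _ (fun s _ _ => o s)) => s s0 st.
have sT : (s%:E < T)%E by apply: le_lt_trans tT; rewrite lee_fin.
have [h1 h2] := xpd s s0 sT; split => //.
by rewrite truncation_id //; apply: phiK => //; exact: ltW.
Qed.

Lemma solution_uniq T T' (phi psi : R -> R * R) z (t : R) :
  is_solution F T phi -> is_solution F T' psi -> phi 0 = z -> psi 0 = z ->
  0 <= t -> (t%:E < T)%E -> (t%:E < T')%E -> phi t = psi t.
Proof.
move=> s1 s2 p1 p2 t0 tT tT'.
have [M1 h1] := solution_bounded s1 t0 tT; have [M2 h2] := solution_bounded s2 t0 tT'.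
pose K := Num.max K0 (Num.max M1 M2).
have K0K : K0 <= K by rewrite le_max lexx.
apply: (can_inj (to_momentumK f)).
rewrite (solution_truncated s1 t0 tT K0K) ?p1; last first.
  by move=> s s0 st; rewrite !le_max h1 ?orbT.
rewrite (solution_truncated s2 t0 tT' K0K) ?p2// => s s0 st.
by rewrite !le_max h2 ?orbT.
Qed.

Lemma truncated_solution (K : R) (T : \bar R) z : K0 <= K -> (0 < T)%E ->
  (forall s : R, 0 <= s -> (s%:E < T)%E -> `|(Phi K (to_momentum f z) s).1| <= K) ->
  is_solution F T (fun t => of_momentum f (Phi K (to_momentum f z) t)).
Proof.
move=> K0K T0 zK.
have := orbit_solution fd (flow_orbit (PhiP K0K) (to_momentum f z)) T0.
rewrite (_ : (fun t => of_momentum f (_, _)) = (fun t => of_momentum f (Phi K (to_momentum f z) t))).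
  by apply=> t t0 tT; rewrite truncation_id// zK.
by apply/funext => t; rewrite -surjective_pairing.
Qed.

Lemma below_extends K z (t : R) : K0 <= K -> 0 <= t ->
  (forall s, 0 <= s -> s <= t -> `|(Phi K z s).1| < K) ->
  exists2 e, 0 < e & forall s, 0 <= s -> s < t + e -> `|(Phi K z s).1| < K.
Proof.
move=> K0K t0 zK.
have xc := orbit_continuous1 (flow_orbit (PhiP K0K) z).
have nt : `|(Phi K z s).1| @[s --> t] --> `|(Phi K z t).1|.
  by apply: cvg_norm; exact: xc.
have : \forall s \near t, `|(Phi K z s).1| < K.
  by apply: (cvgr_lt _ nt); exact: zK.
move=> /nbhs_ballP[e /= e0 he]; exists e => // s s0 se.
have [st|ts] := leP s t; first exact: zK.
by apply: he; rewrite /ball/= ltr_norml; apply/andP; split; lra.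
Qed.

(** [existence_time] and [flow] fall back to a default unless a maximal solution exists. A truncated
    orbit, followed for a short time, gives the local solution needed to start the gluing. *)
Lemma flow_maximal z :
  is_maximal_solution F z (existence_time F z) (fun t => flow F t z).
Proof.
suff : exists p : \bar R * (R -> R * R), is_maximal_solution F z p.1 p.2.
  by move=> /(@xgetPex _ (0%E, cst z)).
suff [T [phi h]] : exists T phi, is_maximal_solution F z T phi by exists (T, phi).
apply: maximal_solution_exists; last first.
  by move=> T T' phi psi t s1 s2 p1 p2 t0 tT tT'; exact: (solution_uniq s1 s2 p1 p2).
pose K := Num.max K0 (`|z.1| + 1).
have K0K : K0 <= K by rewrite le_max lexx.
have z0 := flow0 (PhiP K0K) (to_momentum f z).
have [|e e0 he] := @below_extends K (to_momentum f z) 0 K0K (lexx 0).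
  move=> s s0 s0'; have -> : s = 0 by apply/eqP; rewrite eq_le s0 s0'.
  by rewrite z0 lt_max ltrDl ltr01 orbT.
exists e%:E, (fun t => of_momentum f (Phi K (to_momentum f z) t)); split.
  apply: truncated_solution => //.
  by move=> s s0; rewrite lte_fin => se; apply/ltW/he => //; rewrite add0r.
by rewrite z0 to_momentumK.
Qed.

(** The truncated orbit stays below [K] slightly past [t], so it solves the planar system there and
    maximality puts [t] strictly before the existence time. *)
Lemma flow_truncated K z (t : R) : K0 <= K -> 0 <= t ->
  (forall s, 0 <= s -> s <= t -> `|(Phi K (to_momentum f z) s).1| < K) ->
  (t%:E < existence_time F z)%E /\
  to_momentum f (flow F t z) = Phi K (to_momentum f z) t.
Proof.
move=> K0K t0 zK; have [sol z0 mx] := flow_maximal z.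
have [e e0 he] := below_extends K0K t0 zK.
have sol' : is_solution F (t + e)%:E
    (fun t => of_momentum f (Phi K (to_momentum f z) t)).
  apply: truncated_solution => //; first by rewrite lte_fin; lra.
  by move=> s s0; rewrite lte_fin => se; apply/ltW/he.
have z0' : of_momentum f (Phi K (to_momentum f z) 0) = z.
  by rewrite (flow0 (PhiP K0K)) to_momentumK.
have te : (t%:E < (t + e)%:E)%E by rewrite lte_fin; lra.
have tT : (t%:E < existence_time F z)%E by apply: lt_le_trans te (mx _ _ sol' z0').
split => //; rewrite (solution_uniq sol sol' z0 z0' t0 tT te).
by rewrite of_momentumK.
Qed.

(** Once in [W] the orbit stays below the level [K] for ever, so a single truncated orbit is the
    true one for all times. *)
Lemma basin_flow_tends_to (W : set (R * R)) (c : R) z :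
  forward_invariant K0 Phi W ->
  (forall y K, W y -> K0 <= K -> `|y.1| < K) ->
  (forall K y, K0 <= K -> W y -> Phi K y t @[t --> +oo] --> (c, 0 : R)) ->
  f c = 0 -> basin K0 Phi W (to_momentum f z) -> flow_tends_to F z (c, 0).
Proof.
move=> inv Wb Wc fc0 [K [t r]]; have [K0K t0 zK zW] := r.
have [l [G [l0 hl _]]] := tame K0K.
have zK' s : 0 <= s -> `|(Phi K (to_momentum f z) s).1| < K.
  move=> s0; have [st|/ltW ts] := leP s t; first exact: zK.
  by apply: Wb => //; exact: (reaches_later rho0 gd dgc K0a PhiP inv r).
have [sol z0 mx] := flow_maximal z.
split.
  apply/eqP; rewrite eq_le leey /=; apply: (mx _ (fun t => of_momentum f (Phi K (to_momentum f z) t))).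
    by apply: truncated_solution => // s s0 _; exact/ltW/zK'.
  by rewrite (flow0 (PhiP K0K)) to_momentumK.
have lim0 : Phi K (Phi K (to_momentum f z) t) s @[s --> +oo] --> (c, 0 : R) by exact: Wc.
have lim : Phi K (to_momentum f z) s @[s --> +oo] --> (c, 0 : R).
  have sh : (fun s : R => s - t) @ +oo%R --> +oo%R.
    move=> A [M [_ hM]]; exists (M + t); split; first exact: num_real.
    by move=> s Ms; apply: hM; rewrite ltrBrDr.
  have := cvg_comp _ _ sh lim0; apply: cvg_trans; apply: near_eq_cvg.
  by near=> s; rewrite /= (flowD rho0 l0 hl (PhiP K0K)) addrC subrK.
have ofc : of_momentum f (c, 0) = (c, 0) by rewrite /of_momentum /= fc0 subr0.
have : of_momentum f (Phi K (to_momentum f z) s) @[s --> +oo] --> (c, 0 : R).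
  rewrite -ofc; apply: continuous_cvg lim; exact: of_momentum_continuous.
apply: cvg_trans; apply: near_eq_cvg; near=> s.
have s0 : 0 <= s by near: s; exact: nbhs_pinfty_ge.
have [_ <-] := flow_truncated K0K s0 (fun u u0 _ => zK' u u0).
by rewrite to_momentumK.
Unshelve. all: by end_near. Qed.

(** From time [t] on, [e (x - c)] is positive and nondecreasing, so the orbit diverges as soon as it
    is unbounded. If it were bounded, a single truncation would describe it up to the existence
    time, and both a finite and an infinite existence time are contradictory. *)
Lemma basin_ray_flow_diverges (e c : R) z :
  (e, c) = (-1, a) \/ (e, c) = (1, b) ->
  basin K0 Phi (ray e c) (to_momentum f z) -> flow_diverges F z.
Proof.
move=> ec [K [t [K0K t0 zK [zW1 zW2]]]] M.
have e2 : `|e| = 1 by case: ec => -[-> _]; rewrite ?normrN normr1.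
have [tT tE] := flow_truncated K0K t0 zK.
have [sol z0 mx] := flow_maximal z.
set T := existence_time F z in tT sol mx *.
pose x s := (flow F s z).1.
have xE s : x s = (to_momentum f (flow F s z)).1 by [].
have agree K' s : K0 <= K' -> 0 <= s -> (s%:E < T)%E ->
    (forall r, 0 <= r -> r <= s -> `|x r| <= K') ->
    to_momentum f (flow F s z) = Phi K' (to_momentum f z) s.
  move=> K0K' s0 sT h; have := solution_truncated sol s0 sT K0K' h.
  by rewrite z0.
(* No level is known to serve for all times yet; each [r] gets its own truncation. *)
have mono s r : t <= s -> s <= r -> (r%:E < T)%E ->
    0 < e * (x s - c) /\ e * (x s - c) <= e * (x r - c).
  move=> ts sr rT; have s0 : 0 <= s by exact: le_trans ts.
  have r0 : 0 <= r by exact: le_trans sr.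
  have [B hB] := solution_bounded sol r0 rT.
  pose K' := Num.max K0 B.
  have K0K' : K0 <= K' by rewrite le_max lexx.
  have [l [G [l0 hl _]]] := tame K0K'.
  have ag u : 0 <= u -> u <= r -> to_momentum f (flow F u z) = Phi K' (to_momentum f z) u.
    move=> u0 ur; apply: agree => //.
      by apply: le_lt_trans rT; rewrite lee_fin.
    by move=> v v0 vu; rewrite le_max (hB v v0 (le_trans vu ur)) orbT.
  have gP y : 0 < e * (y - c) -> 0 < e * truncation g K' y.
    exact: (ray_truncation_sign g_lo g_hi K0a K0b ec).
  pose w := Phi K' (to_momentum f z) t.
  have wE : w = Phi K (to_momentum f z) t by rewrite -tE ag//; exact: le_trans sr.
  have wd u : Phi K' w u = Phi K' (to_momentum f z) (t + u).
    exact: (flowD rho0 l0 hl (PhiP K0K')).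
  have o := flow_orbit (PhiP K0K') w.
  have w0 := flow0 (PhiP K0K') w.
  have p0 : 0 < e * ((Phi K' w 0).1 - c) by rewrite w0 wE.
  have p1 : 0 < e * (Phi K' w 0).2 by rewrite w0 wE.
  have st0 : 0 <= s - t by rewrite subr_ge0.
  have rs0 : 0 <= r - s by rewrite subr_ge0.
  have [h1 h2 _] := ray_trap o gP p0 p1 st0.
  have q0 : 0 < e * ((Phi K' w (s - t + 0)).1 - c) by rewrite addr0.
  have q1 : 0 < e * (Phi K' w (s - t + 0)).2 by rewrite addr0.
  have [_ _ h3] := ray_trap (orbit_shift (s - t) o) gP q0 q1 rs0.
  move: h1 h3; rewrite addr0 !wd.
  rewrite (_ : t + (s - t) = s); last ring.
  rewrite (_ : t + (s - t + (r - s)) = r); last ring.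
  by rewrite -!ag.
have [[s [ts sT sM]]|small] := pselect (exists s, [/\ t <= s, (s%:E < T)%E & `|M| + `|c| <= e * (x s - c)]).
  exists s; split => //; first exact: le_trans ts.
  move=> r sr rT; have [_ h] := mono s r ts sr rT.
  rewrite prod_normE /= le_max; apply/orP; left.
  have h1 : e * (x r - c) <= `|x r| + `|c|.
    apply: le_trans (ler_norm _) _; rewrite normrM e2 mul1r; exact: ler_normB.
  by have := ler_norm M; rewrite -/(x r); lra.
exfalso.
have bd s : 0 <= s -> (s%:E < T)%E -> `|x s| < Num.max K (`|M| + `|c| + `|c|).
  move=> s0 sT; rewrite lt_max; have [st|ts] := leP s t.
    have [_ h] := flow_truncated K0K s0 (fun u u0 us => zK u u0 (le_trans us st)).
    by rewrite xE h zK.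
  apply/orP; right; rewrite ltNge; apply/negP => xs; apply: small; exists s.
  split => //; first exact: ltW.
  have [xp _] := mono s s (ltW ts) (lexx s) sT.
  have : `|x s - c| = e * (x s - c).
    by rewrite -[RHS]gtr0_norm// normrM e2 mul1r.
  by move=> <-; have := lerB_dist (x s) c; lra.
set B := Num.max _ _ in bd; pose K' := B + 1.
have KB : K <= B by rewrite le_max lexx.
have K0K' : K0 <= K' by rewrite /K'; lra.
have ag s : 0 <= s -> (s%:E < T)%E ->
    to_momentum f (flow F s z) = Phi K' (to_momentum f z) s.
  move=> s0 sT; apply: agree => // r r0 rs.
  have rT : (r%:E < T)%E by apply: le_lt_trans sT; rewrite lee_fin.
  by have := bd r r0 rT; rewrite /K'; lra.
have bd' s : 0 <= s -> (s%:E < T)%E -> `|(Phi K' (to_momentum f z) s).1| <= B.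
  by move=> s0 sT; rewrite -ag//; exact/ltW/bd.
have o := flow_orbit (PhiP K0K') (to_momentum f z).
have xc := orbit_continuous1 o.
have [l [G [l0 hl hG]]] := tame K0K'.
have [[T1 TE]|TE|TE] : [\/ exists T1 : R, T = T1%:E, T = +oo%E | T = -oo%E].
  by case: (T) => [r| |]; [apply: Or31; exists r|apply: Or32|apply: Or33].
(* Finite existence time: the bounded truncated orbit continues the solution past [T1], against
   maximality. *)
- have tT1 : t < T1 by move: tT; rewrite TE lte_fin.
  have T10 : 0 <= T1 by lra.
  have bT1 : `|(Phi K' (to_momentum f z) T1).1| <= B.
    rewrite leNgt; apply/negP => h.
    have nt : `|(Phi K' (to_momentum f z) s).1| @[s --> T1] -->
        `|(Phi K' (to_momentum f z) T1).1| by apply: cvg_norm; exact: xc.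
    have : \forall s \near T1, B < `|(Phi K' (to_momentum f z) s).1|.
      exact: (cvgr_gt _ nt).
    move=> /nbhs_ballP[d /= d0 hd]; pose s := Num.max t (T1 - d / 2).
    have ts : t <= s by rewrite le_max lexx.
    have ds : T1 - d / 2 <= s by rewrite le_max lexx orbT.
    have sT1 : s < T1 by rewrite gt_max tT1 /=; lra.
    have : B < `|(Phi K' (to_momentum f z) s).1|.
      by apply: hd; rewrite /ball/= ltr_norml; apply/andP; split; lra.
    by rewrite ltNge bd'// ?TE ?lte_fin//; lra.
  have [|d d0 hd] := below_extends (K := K') (z := to_momentum f z) K0K' T10.
    move=> s s0; rewrite le_eqVlt => /predU1P[->|sT1]; first by rewrite /K'; lra.
    by have := bd' s s0; rewrite TE lte_fin => /(_ sT1); rewrite /K'; lra.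
  have : ((T1 + d)%:E <= T)%E.
    apply: (mx _ (fun s => of_momentum f (Phi K' (to_momentum f z) s))).
      apply: truncated_solution => //; first by rewrite lte_fin; lra.
      by move=> s s0; rewrite lte_fin => sd; apply/ltW/hd.
    by rewrite (flow0 (PhiP K0K')) to_momentumK.
  by rewrite TE lee_fin; lra.
(* Infinite existence time: the orbit would converge to a zero of the force strictly inside the
   half-line of the ray, where there is none. *)
- have sT s : (s%:E < T)%E by rewrite TE ltry.
  have [c' [gc xl _]] := orbit_converges rho0 (lipschitz_continuous l0 hl) hG
    (fun u v => truncation_nonflat iso g_lo g_hi K0a K0b K0K') o
    (fun s s0 => bd' s s0 (sT s)).
  have [d0 _] := mono t t (lexx t) (lexx t) (sT t).
  suff : 0 < e * (c' - c).
    by move=> /(ray_truncation_sign g_lo g_hi K0a K0b ec K0K'); rewrite gc mulr0 ltxx.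
  rewrite ltNge; apply/negP => h.
  have lim : e * ((Phi K' (to_momentum f z) s).1 - c) @[s --> +oo] --> e * (c' - c).
    by apply: cvgMr; apply: cvgB => //; exact: cvg_cst.
  have [s ts] := pinfty_frequently t (cvgr_lt _ lim _ (le_lt_trans h d0)).
  have s0 : 0 <= s by exact: le_trans ts.
  rewrite -ag//; have [_ h'] := mono t s (lexx t) ts (sT s).
  by rewrite ltNge h'.
- by move: tT; rewrite TE.
Qed.

End FlowFate.

(** * Signs of [f] and of the force on the line *)

Lemma card_eq_II (T : pointedType) (S : set T) : (S #= `I_2)%card ->
  exists x y, x <> y /\ S = [set x; y].
Proof.
move=> /card_esym/card_set_bijP => -[h [hS hinj hsurj]].
exists (h 0%N), (h 1%N); split.
  by move=> /hinj; rewrite !inE/= => /(_ isT isT).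
rewrite predeqE => z; split.
  by move=> /hsurj[[|[|k]] //= _ <-]; [left|right].
by case=> ->; apply: hS.
Qed.

Section Force.
Context {R : realType}.
Variables (f : R -> R) (rho : R).
Hypothesis fd : forall y : R, is_derive y 1 f (derive1 f y).
Hypothesis dfc : continuous (derive1 f).
Hypothesis rho0 : 0 < rho.
Let h y := rho + derive1 f y.
Let fc : continuous f. Proof. by move=> y; exact: is_derive_cts (fd y). Qed.
Let hc : continuous h.
Proof. by move=> y; apply: cvgD; [exact: cvg_cst|exact: dfc]. Qed.

(** The sign of [rho + f'] is read off at infinity on the outer intervals and at the fixed point
    [x0] on the inner one. All fixed points lie in the inner interval, so one value of [f] decides
    its sign on each outer half-line. *)
Lemma force_band (S : set R) (x0 : R) : (forall y, f y = 0 -> S y) -> S x0 ->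
  S `<=` D_set f rho ->
  ([set x : R | rho + derive1 f x = 0] #= `I_2)%card ->
  derive1 f x @[x --> +oo] --> -oo -> derive1 f x @[x --> -oo] --> -oo ->
  exists a b, [/\ a < b, forall y, h y = 0 <-> y = a \/ y = b,
    (forall y, y < a -> h y < 0) /\ (forall y, b < y -> h y < 0),
    forall y, a < y -> y < b -> 0 < h y &
    (forall y, y <= a -> 0 < f y) /\ (forall y, b <= y -> f y < 0)].
Proof.
move=> fS S0 SD /card_eq_II[u [v [uv hE]]] hp hm.
have [a [b [ab hab]]] : exists a b, a < b /\ forall y, h y = 0 <-> y = a \/ y = b.
  have H y : h y = 0 <-> y = u \/ y = v by rewrite -[h y = 0]/([set x : R | rho + derive1 f x = 0] y) hE.
  have [luv|lvu|/uv//] := ltgtP u v.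
    by exists u, v.
  by exists v, u; split => // y; rewrite H; split=> -[]; [right|left|right|left].
have farp : exists M, forall y, M < y -> h y < 0.
  have : nbhs (-oo%R : set_system R) [set y : R | y < - rho].
    by exists (- rho); split; [exact: num_real|].
  move=> /hp [M [_ hM]]; exists M => y /hM /=; rewrite /h; lra.
have farm : exists M, forall y, y < M -> h y < 0.
  have : nbhs (-oo%R : set_system R) [set y : R | y < - rho].
    by exists (- rho); split; [exact: num_real|].
  move=> /hm [M [_ hM]]; exists M => y /hM /=; rewrite /h; lra.
have nz y : y != a -> y != b -> h y != 0.
  by move=> /eqP ya /eqP yb; apply/eqP => /hab[].
have neg y : h y != 0 -> ~~ (0 < h y) -> h y < 0.
  by move=> y0; rewrite -leNgt le_eqVlt (negbTE y0).
have ha y : y < a -> h y < 0.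
  move=> ya; have [M hM] := farm.
  pose w := Num.min y (M - 1).
  have wy : w <= y by rewrite ge_min lexx.
  have wM : w <= M - 1 by rewrite ge_min lexx orbT.
  have zz z : w <= z -> z <= y -> h z != 0.
    by move=> _ zy; apply: nz; apply/eqP; lra.
  apply: neg; first exact: zz.
  by rewrite -(sign_const wy hc zz) -leNgt ltW// hM//; lra.
have hb y : b < y -> h y < 0.
  move=> yb; have [M hM] := farp.
  pose w := Num.max y (M + 1).
  have wy : y <= w by rewrite le_max lexx.
  have wM : M + 1 <= w by rewrite le_max lexx orbT.
  have zz z : y <= z -> z <= w -> h z != 0.
    by move=> yz _; apply: nz; apply/eqP; lra.
  apply: neg; first exact: zz.
  by rewrite (sign_const wy hc zz) -leNgt ltW// hM//; lra.
have pos_in y : 0 < h y -> a < y /\ y < b.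
  move=> hy; split; rewrite ltNge le_eqVlt; apply/negP => /orP[/eqP ye|].
  - by move: hy; have /hab -> : y = a \/ y = b; [left|rewrite ltxx].
  - by move/ha; lra.
  - by move: hy; have /hab -> : y = a \/ y = b; [right|rewrite ltxx].
  - by move/hb; lra.
have hx0 : 0 < h x0 by exact: SD.
have [ax0 x0b] := pos_in _ hx0.
have hin y : a < y -> y < b -> 0 < h y.
  move=> ay yb; have [yx|/ltW xy] := leP y x0.
    by rewrite (sign_const yx hc)// => z z1 z2; apply: nz; apply/eqP; lra.
  by rewrite -(sign_const xy hc)// => z z1 z2; apply: nz; apply/eqP; lra.
have f_in y : f y = 0 -> a < y /\ y < b by move=> /fS/SD; exact: pos_in.
exists a, b; split => //; split.
(* [f s + rho s] decreases on the left of [a], so [f w >= f a + rho (a - w) >= f a + |f a| + 1 >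
   0]. *)
- move=> y ya; pose w := Num.min y (a - (`|f a| + 1) / rho).
  have wy : w <= y by rewrite ge_min lexx.
  have wa : w <= a - (`|f a| + 1) / rho by rewrite ge_min lexx orbT.
  rewrite -(sign_const wy fc); last by move=> z _ zy; apply/eqP => /f_in[]; lra.
  have wa' : w <= a by exact: le_trans ya.
  have kd (s : R) : is_derive s 1 (fun s => f s + rho * s) (h s).
    have := is_deriveD (fd s) (is_deriveZ rho (is_derive_id s (1 : R))).
    by move=> /is_derive_eq; apply; rewrite /GRing.scale/= mulr1 addrC.
  have : - (f w + rho * w) <= - (f a + rho * a).
    apply: (nondecr_line wa' (fun s => is_deriveN (kd s))) => s _ sa.
    by rewrite oppr_ge0; apply/ltW/ha.
  have : rho * w <= rho * (a - (`|f a| + 1) / rho) by rewrite ler_pM2l.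
  rewrite mulrBr mulrCA divff ?gt_eqF// mulr1.
  by have := ler_norm (- f a); rewrite normrN; lra.
- move=> y yb; pose w := Num.max y (b + (`|f b| + 1) / rho).
  have wy : y <= w by rewrite le_max lexx.
  have wb : b + (`|f b| + 1) / rho <= w by rewrite le_max lexx orbT.
  have fy0 : f y != 0 by apply/eqP => /f_in[]; lra.
  rewrite lt_neqAle fy0 leNgt.
  rewrite (sign_const wy fc); last by move=> z yz _; apply/eqP => /f_in[]; lra.
  have wb' : b <= w by exact: le_trans yb _.
  have kd (s : R) : is_derive s 1 (fun s => f s + rho * s) (h s).
    have := is_deriveD (fd s) (is_deriveZ rho (is_derive_id s (1 : R))).
    by move=> /is_derive_eq; apply; rewrite /GRing.scale/= mulr1 addrC.
  have : - (f b + rho * b) <= - (f w + rho * w).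
    apply: (nondecr_line wb' (fun s => is_deriveN (kd s))) => s bs _.
    by rewrite oppr_ge0; apply/ltW/hb.
  have : rho * (b + (`|f b| + 1) / rho) <= rho * w by rewrite ler_pM2l.
  rewrite mulrDr mulrCA divff ?gt_eqF// mulr1 -leNgt.
  by have := ler_norm (f b); lra.
Qed.

Variables (a b : R).
Hypothesis ab : a < b.
Hypothesis h_zero : forall y, h y = 0 <-> y = a \/ y = b.
Hypothesis h_lo : forall y, y < a -> h y < 0.
Hypothesis h_hi : forall y, b < y -> h y < 0.
Hypothesis h_in : forall y, a < y -> y < b -> 0 < h y.
Hypothesis f_lo : forall y, y <= a -> 0 < f y.
Hypothesis f_hi : forall y, b <= y -> f y < 0.

Lemma force_lo y : y < a -> force f rho y < 0.
Proof. by move=> ya; rewrite /force nmulr_rlt0 ?f_lo ?h_lo// ltW. Qed.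

Lemma force_hi y : b < y -> 0 < force f rho y.
Proof. by move=> yb; rewrite /force nmulr_rgt0 ?f_hi ?h_hi// ltW. Qed.

Lemma fixed_point_in y : f y = 0 -> a < y /\ y < b.
Proof.
move=> y0; split; rewrite ltNge; apply/negP.
- by move=> /f_lo; rewrite y0 ltxx.
- by move=> /f_hi; rewrite y0 ltxx.
Qed.

Lemma force_attracting c d : f c = 0 -> 0 < d -> attracting f c d ->
  exists d', [/\ 0 < d', a < c - d', c + d' < b & attracting (force f rho) c d'].
Proof.
move=> fc0 d0 [h1 h2]; have [ac cb] := fixed_point_in fc0.
pose r := Num.min d (Num.min ((c - a) / 2) ((b - c) / 2)).
have r0 : 0 < r by rewrite !lt_min d0; apply/andP; split; lra.
have rd : r <= d by rewrite ge_min lexx.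
have ra : r <= (c - a) / 2 by rewrite !ge_min lexx orbT.
have rb : r <= (b - c) / 2 by rewrite !ge_min lexx !orbT.
exists r; split => //; [lra|lra|split].
- move=> y cy yr; rewrite /force pmulr_rlt0 ?h1//; first lra.
  by apply: h_in; lra.
- move=> y cy yr; rewrite /force pmulr_rgt0 ?h2//; first lra.
  by apply: h_in; lra.
Qed.

Lemma force_repelling c d : f c = 0 -> 0 < d -> repelling f c d ->
  exists2 d', 0 < d' & repelling (force f rho) c d'.
Proof.
move=> fc0 d0 [h1 h2]; have [ac cb] := fixed_point_in fc0.
pose r := Num.min d (Num.min ((c - a) / 2) ((b - c) / 2)).
have r0 : 0 < r by rewrite !lt_min d0; apply/andP; split; lra.
have rd : r <= d by rewrite ge_min lexx.
have ra : r <= (c - a) / 2 by rewrite !ge_min lexx orbT.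
have rb : r <= (b - c) / 2 by rewrite !ge_min lexx !orbT.
exists r => //; split.
- move=> y cy yr; rewrite /force pmulr_rgt0 ?h1//; first lra.
  by apply: h_in; lra.
- move=> y cy yr; rewrite /force pmulr_rlt0 ?h2//; first lra.
  by apply: h_in; lra.
Qed.

(** At [a] it is the factor [rho + f'] that changes sign, from negative to positive, while [f] stays
    positive. *)
Lemma force_repelling_lo : exists2 d, 0 < d & repelling (force f rho) a d.
Proof.
have : \forall y \near a, 0 < f y.
  by apply: (cvgr_gt _ (@fc a)); exact: f_lo.
move=> /nbhs_ballP[e /= e0 he].
pose r := Num.min (e / 2) ((b - a) / 2).
have r0 : 0 < r by rewrite lt_min; move: ab => ab'; apply/andP; split; lra.
have re : r <= e / 2 by rewrite ge_min lexx.
have rb : r <= (b - a) / 2 by rewrite ge_min lexx orbT.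
exists r => //; split; last by move=> y _; exact: force_lo.
move=> y ay yr; rewrite /force mulr_gt0//; first by apply: h_in => //; move: ab => ab'; lra.
by apply: he; rewrite /ball/= ltr_norml; apply/andP; split; lra.
Qed.

Lemma force_repelling_hi : exists2 d, 0 < d & repelling (force f rho) b d.
Proof.
have : \forall y \near b, f y < 0.
  by apply: (cvgr_lt _ (@fc b)); exact: f_hi.
move=> /nbhs_ballP[e /= e0 he].
pose r := Num.min (e / 2) ((b - a) / 2).
have r0 : 0 < r by rewrite lt_min; move: ab => ab'; apply/andP; split; lra.
have re : r <= e / 2 by rewrite ge_min lexx.
have rb : r <= (b - a) / 2 by rewrite ge_min lexx orbT.
exists r => //; split; first by move=> y by_ _; exact: force_hi.
move=> y ry yb; rewrite /force pmulr_rlt0; last by apply: h_in => //; move: ab => ab'; lra.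
by apply: he; rewrite /ball/= ltr_norml; apply/andP; split; lra.
Qed.

End Force.

(** * Assembly of the sets [A k] *)

Lemma ray_star (R : realType) (e c : R) (w z : R * R) (k : R) :
  ray e c w -> ray e c z -> 0 <= k <= 1 -> ray e c (w + k *: (z - w)).
Proof.
move=> [w1 w2] [z1 z2] /andP[k0 k1].
have conv (u v : R) : 0 < u -> 0 < v -> 0 < (1 - k) * u + k * v.
  move=> u0 v0; have := mulr_ge0 k0 (ltW v0); have k1' : 0 <= 1 - k by lra.
  have := mulr_ge0 k1' (ltW u0); have [->|kn] := eqVneq k 0; first lra.
  have : 0 < k * v by rewrite mulr_gt0// lt_neqAle eq_sym kn.
  lra.
have s1 : (w + k *: (z - w)).1 = w.1 + k * (z.1 - w.1) by [].
have s2 : (w + k *: (z - w)).2 = w.2 + k * (z.2 - w.2) by [].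
split; rewrite ?s1 ?s2.
- by have := conv _ _ w1 z1; congr (0 < _); ring.
- by have := conv _ _ w2 z2; congr (0 < _); ring.
Qed.

Lemma smooth_derive (R : realType) (f : R -> R) (n : nat) (y : R) : smooth f ->
  is_derive y 1 (derive1n n f) (derive1n n.+1 f y).
Proof. by move=> sf; apply: DeriveDef; [exact: sf|rewrite derive1nS derive1E]. Qed.

Theorem theoremB3 (R : realType) (f : R -> R) (rho : R) (N : nat)
    (xs : 'I_N.+1 -> R) (xu : 'I_N -> R)
    (f_smooth : smooth f)
    (rho_gt0 : 0 < rho)
    (N_large : (2 < N.+1)%N)
    (xs_inj : injective xs) (xs_range : stable_fixed_points f = range xs)
    (xu_inj : injective xu) (xu_range : unstable_fixed_points f = range xu)
    (A1s : stable_fixed_points f `<=` D_set f rho)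
    (A1u : unstable_fixed_points f `<=` D_set f rho)
    (A2 : ([set x : R | rho + derive1 f x = 0] #= `I_2)%card)
    (A3 : forall x : R, ~ D_set f rho x -> 0 < f x * derive1n 2 f x)
    (A4p : derive1 f x @[x --> +oo] --> -oo)
    (A4m : derive1 f x @[x --> -oo] --> -oo) :
  exists A : 'I_N.+3 -> set (R * R),
    [/\ trivIset setT A,
        forall k : 'I_N.+3, simply_connected R (A k),
        closure (\bigcup_(k in setT) A k) = setT,
        forall (i : 'I_N.+1) (z : R * R), A (inord i.+1) z ->
          flow_tends_to (planar_field f rho) z (xs i, 0) &
        forall z : R * R, A ord0 z \/ A ord_max z ->
          flow_diverges (planar_field f rho) z].
Proof.
have fd (y : R) : is_derive y 1 f (derive1 f y) := smooth_derive 0 y f_smooth.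
have dfd (y : R) : is_derive y 1 (derive1 f) (derive1n 2 f y) := smooth_derive 1 y f_smooth.
have ddfc : continuous (derive1n 2 f).
  by move=> y; exact: is_derive_cts (smooth_derive 2 y f_smooth).
have dfc : continuous (derive1 f) by move=> y; exact: is_derive_cts (dfd y).
have fc : continuous f by move=> y; exact: is_derive_cts (fd y).
have stab i : f (xs i) = 0 /\ lyapunov_stable f (xs i).
  have h : stable_fixed_points f (xs i) by rewrite xs_range; exists i.
  exact: h.
have xu0 j : f (xu j) = 0.
  have [//] : unstable_fixed_points f (xu j) by rewrite xu_range; exists j.
have fz y : f y = 0 -> (exists i, xs i = y) \/ (exists j, xu j = y).
  move=> fy; have [st|ns] := pselect (lyapunov_stable f y).
    have : stable_fixed_points f y by [].
    by rewrite xs_range => -[i _ <-]; left; exists i.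
  have : unstable_fixed_points f y by [].
  by rewrite xu_range => -[j _ <-]; right; exists j.
have fS y : f y = 0 -> (stable_fixed_points f `|` unstable_fixed_points f) y.
  by move=> fy; have [st|ns] := pselect (lyapunov_stable f y); [left|right].
have S0 : (stable_fixed_points f `|` unstable_fixed_points f) (xs ord0).
  by left; exact: stab.
have SD : stable_fixed_points f `|` unstable_fixed_points f `<=` D_set f rho.
  by move=> y [/A1s|/A1u].
have [a [b [ab h0 [h_lo h_hi] h_in [f_lo f_hi]]]] :=
  force_band fd dfc rho_gt0 fS S0 SD A2 A4p A4m.
pose g := force f rho.
pose dg y := derive1n 2 f y * f y + (rho + derive1 f y) * derive1 f y.
have gd (y : R) : is_derive y 1 g (dg y).
  have := is_deriveM (is_deriveD (is_derive_cst rho y (1 : R)) (dfd y)) (fd y).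
  by move=> /is_derive_eq; apply; rewrite /dg /GRing.scale/= add0r addrC; congr (_ + _); exact: mulrC.
have dgc : continuous dg.
  move=> y; apply: cvgD; apply: cvgM; [exact: ddfc|exact: fc| |exact: dfc].
  by apply: cvgD; [exact: cvg_cst|exact: dfc].
have g_lo := force_lo h_lo f_lo; have g_hi := force_hi h_hi f_hi.
have fiso : isolated_zeros f := finite_zeros_isolated fz.
have fatt i : exists2 d, 0 < d & attracting f (xs i) d.
  exact: lyapunov_attracting fd dfc fiso (stab i).2.
have frep := unstable_repelling fc fiso xs_inj fz fatt.
(* All humps in one list: [a] and [b], then the unstable fixed points. *)
pose hs (k : 'I_(2 + N)) : R := match fintype.split k with
  | inl i => if i == ord0 then a else b
  | inr j => xu j end.
have hsl i : hs (lshift N i) = if i == ord0 then a else b.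
  by rewrite /hs -[lshift N i]/(unsplit (inl i)) unsplitK.
have hsr j : hs (rshift 2 j) = xu j.
  by rewrite /hs -[rshift 2 j]/(unsplit (inr j)) unsplitK.
have gz y : g y = 0 -> (exists i, xs i = y) \/ (exists k, hs k = y).
  move=> /eqP; rewrite mulf_eq0 => /orP[/eqP/h0[->|->]|/eqP/fz[?|[j <-]]].
  - by right; exists (lshift N ord0); rewrite hsl.
  - by right; exists (lshift N ord_max); rewrite hsl.
  - by left.
  - by right; exists (rshift 2 j); rewrite hsr.
have giso : isolated_zeros g := finite_zeros_isolated gz.
have hump_ex c : g c = 0 -> (exists2 d, 0 < d & repelling g c d) ->
    exists2 eps, 0 < eps & hump g rho c eps.
  by move=> gc [d d0]; exact: repelling_hump.
have ga : g a = 0 by rewrite /g /force (h0 a).2 ?mul0r//; left.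
have gb : g b = 0 by rewrite /g /force (h0 b).2 ?mul0r//; right.
have gf y : f y = 0 -> g y = 0 by move=> fy; rewrite /g /force fy mulr0.
have hsP k : g (hs k) = 0 /\ exists2 eps, 0 < eps & hump g rho (hs k) eps.
  rewrite /hs; case: (fintype.split k) => [i|j].
    case: ifP => _; split => //; apply: hump_ex => //.
    - exact: (force_repelling_lo fd ab h_lo h_in f_lo).
    - exact: (force_repelling_hi fd ab h_hi h_in f_hi).
  have gj : g (xu j) = 0 by exact: gf.
  split => //; apply: hump_ex => //; have [d d0 rep] := frep j.
  exact: (force_repelling h_in f_lo f_hi (xu0 j) d0 rep).
pose K0 := Num.max `|a| `|b| + 1.
have K0a : `|a| < K0.
  by apply: (@le_lt_trans _ _ (Num.max `|a| `|b|)); [rewrite le_max lexx|rewrite ltrDl].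
have K0b : `|b| < K0.
  by apply: (@le_lt_trans _ _ (Num.max `|a| `|b|)); [rewrite le_max lexx orbT|rewrite ltrDl].
have /choice[Phi PhiP] : forall K, exists Phi, K0 <= K -> is_flow (truncation g K) rho Phi.
  move=> K; have [K0K|nK] := pselect (K0 <= K); last by exists (fun z _ => z).
  have [l [G [l0 hl _]]] := truncation_tame gd dgc K0a K0K.
  by have [Phi h] := is_flow_exists rho_gt0 l0 hl; exists Phi.
have gc : continuous g by move=> y; exact: is_derive_cts (gd y).
have [V0 [_ V0d]] := antiderivative gc.
pose V := - V0.
have Vd (y : R) : is_derive y 1 V (- g y) := is_deriveN (V0d y).
(* [dm i] consists of the radius of the well at [xs i] and its energy height. *)
have /choice[dm dmP] : forall i, exists dm : R * R,
    [/\ 0 < dm.1, a < xs i - dm.1 /\ xs i + dm.1 < b, attracting g (xs i) dm.1,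
        0 < dm.2 & forall y, `|y - xs i| = dm.1 -> V (xs i) + dm.2 <= V y].
  move=> i; have [d0 d00 fa] := fatt i.
  have [d [d_gt0 da db att]] := force_attracting h_in f_lo f_hi (stab i).1 d00 fa.
  have [m m0 hm] := potential_barrier Vd att d_gt0 (lexx d).
  by exists (d, m).
pose Wi i := well V (xs i) (dm i).1 (dm i).2.
(* The extreme indices are the two rays. The well of [xs i] has index [i + 1], whence the
   predecessor. *)
pose W (k : 'I_N.+3) : set (R * R) :=
  if k == ord0 then ray (-1) a else if k == ord_max then ray 1 b else Wi (inord k.-1).
pose A (k : 'I_N.+3) := to_momentum f @^-1` basin K0 Phi (W k).
have W_ray_lo : W ord0 = ray (-1) a by [].
have W_ray_hi : W ord_max = ray 1 b by rewrite /W eqxx.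
have W_well (i : 'I_N.+1) : W (inord i.+1) = Wi i.
  have ik : ((inord i.+1 : 'I_N.+3) : nat) = i.+1 by rewrite inordK// !ltnS ltnW.
  have -> : W (inord i.+1) = Wi (inord (inord i.+1 : 'I_N.+3).-1).
    by rewrite /W -!val_eqE /= ik /= eqSS ltn_eqF.
  by rewrite ik /= inord_val.
have W_cases (P : set (R * R) -> Prop) : P (ray (-1) a) -> P (ray 1 b) ->
    (forall i, P (Wi i)) -> forall k, P (W k).
  by move=> Pa Pb Pi k; rewrite /W; case: ifP => // _; case: ifP.
have ec_lo : (-1 : R, a) = (-1, a) \/ (-1 : R, a) = (1, b) by left.
have ec_hi : (1 : R, b) = (-1, a) \/ (1 : R, b) = (1, b) by right.
have inv k : forward_invariant K0 Phi (W k).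
  apply: (W_cases (forward_invariant K0 Phi)).
  - exact: (ray_forward_invariant g_lo g_hi K0a K0b PhiP ec_lo).
  - exact: (ray_forward_invariant g_lo g_hi K0a K0b PhiP ec_hi).
  - move=> i K z t K0K Wz t0; have [d0 [da db] att m0 hm] := dmP i.
    exact: (well_orbit rho_gt0 K0a K0b PhiP Vd da db hm K0K Wz t0).
have Wi_band i z : Wi i z -> [/\ a < z.1, z.1 < b, `|z.1 - xs i| <= (dm i).1 &
    forall K, K0 <= K -> `|z.1| < K].
  have [d0 [da db] att m0 hm] := dmP i.
  exact: (well_in_band K0a K0b (lexx _) da db).
have Wi_open i : open (Wi i) by exact: (open_well Vd).
have Wi_center i : Wi i (xs i, 0).
  by have [d0 _ _ m0 _] := dmP i; exact: well_center.
(* Positions separate the traps: left of [a], right of [b], and in between the attracting intervals,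
   disjoint by [attracting_uniq]. *)
have disj k k' y : W k y -> W k' y -> k = k'.
  have lo_band z : ray (-1) a z -> z.1 < a by move=> []; rewrite mulN1r oppr_gt0 subr_lt0.
  have hi_band z : ray 1 b z -> b < z.1 by move=> []; rewrite mul1r subr_gt0.
  have lo_hi z : ray (-1) a z -> ray 1 b z -> False.
    by move=> /lo_band z1 /hi_band z2; move: ab; lra.
  have lo_well z i : ray (-1) a z -> Wi i z -> False.
    by move=> /lo_band z1 /Wi_band[z2 _ _ _]; move: z2; lra.
  have hi_well z i : ray 1 b z -> Wi i z -> False.
    by move=> /hi_band z1 /Wi_band[_ z2 _ _]; move: z2; lra.
  rewrite /W; have [->|k0] := eqVneq k ord0; have [->|k0'] := eqVneq k' ord0 => //.
  - by case: ifP => _ yh yl; [case: (lo_hi _ yh yl)|case: (lo_well _ _ yh yl)].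
  - by case: ifP => _ yh yl; [case: (lo_hi _ yl yh)|case: (lo_well _ _ yl yh)].
  - have [->|km] := eqVneq k ord_max; have [->|km'] := eqVneq k' ord_max => //.
    + by move=> yh yl; case: (hi_well _ _ yh yl).
    + by move=> yl yh; case: (hi_well _ _ yh yl).
    move=> /Wi_band[_ _ y1 _] /Wi_band[_ _ y2 _].
    have [_ _ att1 _ _] := dmP (inord k.-1); have [_ _ att2 _ _] := dmP (inord k'.-1).
    have /xs_inj/(congr1 val) := attracting_uniq att1 att2
      (gf _ (stab _).1) (gf _ (stab _).1) y1 y2.
    have small (q : 'I_N.+3) : q != ord0 -> q != ord_max ->
        (0 < q)%N /\ (q.-1 < N.+1)%N.
      rewrite -!val_eqE /= -lt0n => q0 qm; split => //.
      have := ltn_ord q; rewrite ltnS leq_eqVlt (negbTE qm) /= => qN.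
      by rewrite -(ltn_add2r 1) !addn1 prednK.
    have [k_0 kN] := small k k0 km; have [k_0' kN'] := small k' k0' km'.
    rewrite /= !inordK// => kk; apply/val_inj.
    by rewrite /= -(prednK k_0) -(prednK k_0') kk.
exists A; split.
- move=> k k' _ _ [z [zk zk']].
  have [y [y1 y2]] := basin_meet rho_gt0 gd dgc K0a PhiP (inv k) (inv k') zk zk'.
  exact: disj y1 y2.
- move=> k; apply: (@simply_connected_homeo _ _ _ _ (of_momentum f)).
  + exact: to_momentum_continuous.
  + exact: of_momentum_continuous.
  + exact: to_momentumK.
  + exact: of_momentumK.
  have ray_sc e c : e ^+ 2 = 1 -> forward_invariant K0 Phi (ray e c) ->
      simply_connected R (basin K0 Phi (ray e c)).
    move=> e2 ie.
    have Wc : ray e c (c + e, e).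
      by rewrite /ray /= addrC addKr -expr2 e2.
    apply: (basin_simply_connected rho_gt0 gd dgc K0a PhiP _ ie Wc).
      exact: open_ray.
    by move=> z r Wz; exact: ray_star.
  have ik := inv k; move: ik; apply: (W_cases (fun W => forward_invariant K0 Phi W ->
    simply_connected R (basin K0 Phi W))).
  + by apply: ray_sc; rewrite sqrrN expr1n.
  + by apply: ray_sc; rewrite expr1n.
  + move=> i ii; have [d0 [da db] att m0 hm] := dmP i.
    apply: (basin_simply_connected rho_gt0 gd dgc K0a PhiP _ ii (Wi_center i)) => //.
    by move=> z r; exact: (well_star Vd att (lexx _)).
- have dens := basins_dense rho_gt0 gd dgc giso g_lo g_hi K0a K0b PhiP gz Wi_open
    Wi_center (fun k => (hsP k).1) (fun k => (hsP k).2).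
  rewrite -subTset => z _ B Bz.
  (* Density was obtained in the coordinates [(x, p)]; the homeomorphism [of_momentum] carries it
     back to [(x, q)]. *)
  have oO : open (of_momentum f @^-1` B°).
    apply: open_comp; last exact: open_interior.
    by move=> y _; exact: of_momentum_continuous.
  have [|w [Bw Aw]] := dens _ _ oO.
    by exists (to_momentum f z); rewrite /= to_momentumK.
  have Ak k : basin K0 Phi (W k) w -> (\bigcup_(k in setT) A k) (of_momentum f w).
    by move=> h; exists k => //; rewrite /A /= of_momentumK.
  exists (of_momentum f w); split; last exact: interior_subset.
  case: Aw => [[h|h]|[i _ h]].
  + by apply: (Ak ord0); rewrite W_ray_lo.
  + by apply: (Ak ord_max); rewrite W_ray_hi.
  + by apply: (Ak (inord i.+1)); rewrite W_well.
- move=> i z; rewrite /A W_well /= => zW.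
  have ii := inv (inord i.+1); rewrite W_well in ii.
  apply: (basin_flow_tends_to rho_gt0 fd gd dgc K0a PhiP ii _ _ (stab i).1 zW).
  + by move=> y K /Wi_band[_ _ _]; apply.
  + move=> K y K0K Wy; have [d0 [da db] att m0 hm] := dmP i.
    exact: (well_orbit_converges rho_gt0 gd dgc giso g_lo g_hi K0a K0b PhiP Vd att
      (lexx _) da db hm K0K Wy).
- move=> z [|].
  + rewrite /A W_ray_lo; exact: (basin_ray_flow_diverges rho_gt0 fd gd dgc giso g_lo g_hi K0a K0b PhiP ec_lo).
  + rewrite /A W_ray_hi; exact: (basin_ray_flow_diverges rho_gt0 fd gd dgc giso g_lo g_hi K0a K0b PhiP ec_hi).
Qed.
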